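(* Let $0<p<\infty$ with $p\notin 2\mathbb N$. Then for every symmetric measurable set $E\subset\mathbb T$ with $|E|>0$ and every $0<q<p$, there exists $f$ in the Hardy space $H^q(\mathbb T)$ with nonnegative Fourier coefficients such that its pointwise boundary value $f^*$ belongs to $L^p(\mathbb T\setminus E)$ while $f^*\notin L^p(\mathbb T)$. Moreover, $f$ can be chosen with gaps tending to $\infty$ in its Fourier series.
   Context: $\mathbb T=\mathbb R/\mathbb Z$ with Lebesgue measure $|\cdot|$; $E$ symmetric means $E=-E$. For $q>0$, $H^q(\mathbb T)$ is the space of periodic distributions $f$ with $\hat f(n)=0$ for $n<0$ such that the functions $f_r(t)=\sum_n \hat f(n)r^{|n|}e^{2\pi i nt}$, $0<r<1$, are uniformly bounded in $L^q(\mathbb T)$, with $\|f\|_{H^q}^q=\sup_{0<r<1}\int_0^1|f_r|^q$. For $f\in H^q(\mathbb T)$, $f_r$ converges a.e. as $r\to1$ to a function $f^*\in L^q(\mathbb T)$, the pointwise boundary value. $f$ has gaps tending to $\infty$ if its Fourier series is $\sum_{k\ge0}a_k e^{2\pi i n_k x}$ with $n_k$ increasing and $n_{k+1}-n_k\to\infty$. *)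

(* Defs.v *)
From HB Require Import structures.
From mathcomp Require Import all_boot all_order all_algebra.
From mathcomp Require Import all_classical all_reals all_analysis.
Set Implicit Arguments. Unset Strict Implicit. Unset Printing Implicit Defensive.
Import Order.TTheory GRing.Theory Num.Theory.
Import numFieldNormedType.Exports.
Local Open Scope classical_set_scope.
Local Open Scope ring_scope.

(* The circle T = R/Z is modelled by [0,1] (the endpoint 1 is a null set);
   subsets of T are modelled as 1-periodic subsets of R. *)

(* R equipped with the Lebesgue (= completed, Caratheodory) sigma-algebra. *)
Definition LebT (R : realType) := caratheodory_type (@wlength R idfun)^*%mu.

Definition I01 (R : realType) : set (LebT R) := `[0%R, 1%R]%classic.
Arguments I01 R : clear implicits.

Notation Leb := (@completed_lebesgue_measure _).

(* A sequence a : nat -> R of (real) Fourier coefficients \hat f(n), n >= 0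
   (with \hat f(n) = 0 for n < 0) is the coefficient sequence of a periodic
   distribution iff it has at most polynomial growth. *)
Definition distribution_coefs (R : realType) (a : nat -> R) : Prop :=
  exists (C : R) (k : nat), forall n, `|a n| <= C * (n.+1)%:R ^+ k.

(* Real and imaginary parts of f_r(t) = sum_n \hat f(n) r^|n| e^{2 pi i n t},
   for real coefficients \hat f(n) = a n. *)
Definition fr_re (R : realType) (a : nat -> R) (r t : R) : R :=
  limn (series (fun n => a n * r ^+ n * cos (2 * pi * n%:R * t))).
Definition fr_im (R : realType) (a : nat -> R) (r t : R) : R :=
  limn (series (fun n => a n * r ^+ n * sin (2 * pi * n%:R * t))).

Definition cmod (R : realType) (x y : R) : R := Num.sqrt (x ^+ 2 + y ^+ 2).

Definition in_Hardy (R : realType) (q : R) (a : nat -> R) : Prop :=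
  distribution_coefs a /\
  exists M : R, forall r : R, 0 < r < 1 ->
    (\int[Leb]_(t in I01 R) ((cmod (fr_re a r t) (fr_im a r t)) `^ q)%:E
      <= M%:E)%E.

Definition boundary_value (R : realType) (a : nat -> R) (gre gim : R -> R) :
  Prop :=
  measurable_fun (I01 R) gre /\
  measurable_fun (I01 R) gim /\
  {ae Leb, forall t : LebT R, I01 R t ->
     (fun r => fr_re a r t) @ at_left 1 --> gre t /\
     (fun r => fr_im a r t) @ at_left 1 --> gim t}.

Definition gaps_to_infty (R : realType) (a : nat -> R) : Prop :=
  exists nk : nat -> nat,
    (forall k, (nk k < nk k.+1)%N) /\
    (forall m, a m != 0 -> exists k, m = nk k) /\
    (forall M : nat, exists K : nat, forall k, (K <= k)%N ->
        (M <= nk k.+1 - nk k)%N).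

(* Main.v *)
Require Import Defs.
From HB Require Import structures.
From mathcomp Require Import all_boot all_order all_algebra.
From mathcomp Require Import all_classical all_reals all_analysis.
From mathcomp Require Import measurable_realfun ring lra zify.
Import Order.TTheory GRing.Theory Num.Theory.
Import numFieldNormedType.Exports.
Local Open Scope classical_set_scope.
Local Open Scope ring_scope.
Set Implicit Arguments. Unset Strict Implicit. Unset Printing Implicit Defensive.

(** Write e(x) for exp(2 pi i x) and s = p / 2.  Since s is not an integer, a
three-term recurrence shows that the Fourier coefficients of |1 + e0 e(x)|^p
take both signs.  Hence, for a large N, multiplying a polynomial f with
nonnegative coefficients by (1 + e0 e(N x)) (1 + b e((m + k N) x)) multiplies
|f|^p, in the weak sense, by a constant times 1 + beta cos(2 pi m x) + O(b^2),
where beta is of order b and its sign is prescribed by the choice of k.  By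
iteration |f|^p can be made to look like the Gaussian
exp(- L (cos(2 pi x) - cos(2 pi y))^2), which concentrates at a density point y
of E and at its mirror image; the frequencies used are as sparse as desired.

Apply this to disjoint symmetric pieces F_k of E: it gives polynomials P_k with
L^p mass at least k + 1 on F_k, but tiny mass off F_k and tiny L^q mass.  Take
f = sum_k e(M_k x) P_k.  Shifting by a huge M_k makes the radial extensions
harmless: r^M (1 - r^n) <= n / (M + 1), so that |r^M P_k(r e(t))| is at most
|P_k(e(t))| plus a tiny constant, for all r < 1 at once.  Neither subharmonicity
nor a maximal function is needed. *)

(** Nonnegative coefficients are the obstacle. A single factor |1 + b e(m x)|^p with b >= 0 is 1 + p
    b cos(2 pi m x) to first order, with one sign only. The auxiliary factor with e0 removes this: b
    acts through the k-th harmonic of the dilated weight |1 + e0 e(N x)|^p and is multiplied by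
    [fc s k], which may be negative. For integer s the weight is the squared modulus of a polynomial
    with nonnegative coefficients, so all [fc s k] are >= 0 and the trick fails. Real coefficients
    give |f(-x)| = |f(x)|, whence the symmetric pieces and the pair of peaks y, 1 - y. A Gaussian in
    cos(2 pi x) is chosen because its exponent contains the frequencies 1 and 2 only, so two values
    of m suffice. Since p and q may be below 1, block sums are not estimated by the triangle
    inequality in L^p: blocks are compared pointwise with 2^-k (see [Ysum]). *)

(** * Bounded measurable functions on [0, 1] and Bessel's inequality *)

Section BoundedMeasurable.
Context {R : realType}.
Implicit Types (f g h : R -> R) (a c : R).
Local Notation mu := (@lebesgue_measure R).

Definition unitI : set R := `[0, 1]%classic.

(** Bounded on all of R rather than on [unitI]: the bound must survive the dilations x -> N x. *)
Definition bm f := measurable_fun [set: R] f /\ exists M, forall x, `|f x| <= M.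

Definition Int f : R := \int[mu]_(x in unitI) f x.

Lemma measurable_unitI : measurable unitI.
Proof. exact: measurable_itv. Qed.

Lemma mu_unitI : mu unitI = 1%:E.
Proof. by rewrite /unitI lebesgue_measure_itv/= lte_fin ltr01 oppr0 adde0. Qed.

Lemma bm_cst c : bm (fun=> c).
Proof. by split; [exact: measurable_cst | exists `|c|]. Qed.

Lemma bmD f g : bm f -> bm g -> bm (fun x => f x + g x).
Proof.
move=> [mf [M hM]] [mg [N hN]]; split; first exact: measurable_funD.
by exists (M + N) => x; rewrite (le_trans (ler_normD _ _))// lerD.
Qed.

Lemma bmM f g : bm f -> bm g -> bm (fun x => f x * g x).
Proof.
move=> [mf [M hM]] [mg [N hN]]; split; first exact: measurable_funM.
by exists (M * N) => x; rewrite normrM ler_pM.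
Qed.

Lemma bmN f : bm f -> bm (fun x => - f x).
Proof.
move=> [mf [M hM]]; split; first exact: measurableT_comp.
by exists M => x; rewrite normrN.
Qed.

Lemma bmB f g : bm f -> bm g -> bm (fun x => f x - g x).
Proof. by move=> bf bg; apply: bmD => //; exact: bmN. Qed.

Lemma bmZ c f : bm f -> bm (fun x => c * f x).
Proof. by move=> bf; apply: bmM => //; exact: bm_cst. Qed.

Lemma bm_sum (F : nat -> R -> R) n : (forall i, bm (F i)) ->
  bm (fun x => \sum_(0 <= i < n) F i x).
Proof.
move=> bF; elim: n => [|n ih].
  by under eq_fun do rewrite big_nil; exact: bm_cst.
by under eq_fun do rewrite big_nat_recr//=; exact: bmD.
Qed.

Lemma bm_indic (A : set R) : measurable A -> bm (\1_A).
Proof.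
move=> mA; split; first exact: measurable_indic.
by exists 1 => x; rewrite indicE; case: (_ \in _); rewrite ?normr0 ?normr1.
Qed.

Lemma bm_continuous f M : continuous f -> (forall x, `|f x| <= M) -> bm f.
Proof. by move=> cf fM; split; [exact: continuous_measurable_fun|exists M]. Qed.

Lemma bm_expR f : bm f -> bm (fun x => expR (f x)).
Proof.
move=> [mf [M hM]]; split; first exact: measurableT_comp.
exists (expR M) => x; rewrite ger0_norm ?expR_ge0// ler_expR.
by rewrite (le_trans _ (hM x))// ler_norm.
Qed.

Lemma bm_powR f a : 0 <= a -> (forall x, 0 <= f x) -> bm f ->
  bm (fun x => f x `^ a).
Proof.
move=> a0 f0 [mf [M hM]]; split.
  by apply: (measurableT_comp (measurable_powR a)).
exists (M `^ a) => x; rewrite ger0_norm ?powR_ge0// ge0_ler_powR//.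
- exact: f0.
- by rewrite nnegrE (le_trans _ (hM x)).
- by rewrite (le_trans _ (hM x))// ler_norm.
Qed.

Lemma bm_integrable f (A : set R) : measurable A -> A `<=` unitI ->
  bm f -> mu.-integrable A (EFin \o f).
Proof.
move=> mA AI [mf [M hM]]; apply: measurable_bounded_integrable => //.
- apply: (@le_lt_trans _ _ (mu unitI)); last by rewrite mu_unitI ltry.
  by apply: le_measure; rewrite ?inE//; exact: measurable_unitI.
- exact: measurable_funTS.
- by exists M; split; [rewrite num_real | move=> N MN x _ /=; exact: le_trans (hM x) (ltW MN)].
Qed.

Lemma bm_integrableI f : bm f -> mu.-integrable unitI (EFin \o f).
Proof. by apply: bm_integrable => //; exact: measurable_unitI. Qed.

Lemma IntD f g : bm f -> bm g -> Int (fun x => f x + g x) = Int f + Int g.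
Proof.
by move=> bf bg; rewrite /Int RintegralD//;
  [exact: measurable_unitI|exact: bm_integrableI|exact: bm_integrableI].
Qed.

Lemma IntZ c f : bm f -> Int (fun x => c * f x) = c * Int f.
Proof.
by move=> bf; rewrite /Int RintegralZl//;
  [exact: measurable_unitI|exact: bm_integrableI].
Qed.

Lemma IntN f : bm f -> Int (fun x => - f x) = - Int f.
Proof.
by move=> bf; rewrite -mulN1r -IntZ//; congr Int; apply/funext => x; rewrite mulN1r.
Qed.

Lemma IntB f g : bm f -> bm g -> Int (fun x => f x - g x) = Int f - Int g.
Proof. by move=> bf bg; rewrite IntD ?IntN//; exact: bmN. Qed.

Lemma Int_cst c : Int (fun=> c) = c.
Proof.
rewrite /Int Rintegral_cst; last exact: measurable_unitI.
by rewrite -[X in fine X]/(mu unitI) mu_unitI mulr1.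
Qed.

Lemma le_Int f g : bm f -> bm g -> (forall x, unitI x -> f x <= g x) -> Int f <= Int g.
Proof.
move=> bf bg fg; apply: le_Rintegral => //; first exact: measurable_unitI.
  exact: bm_integrableI.
exact: bm_integrableI.
Qed.

Lemma eq_Int f g : (forall x, unitI x -> f x = g x) -> Int f = Int g.
Proof. by move=> fg; apply: eq_Rintegral => x; rewrite inE; exact: fg. Qed.

Lemma Int_ge0 f : (forall x, unitI x -> 0 <= f x) -> 0 <= Int f.
Proof. by move=> f0; exact: Rintegral_ge0. Qed.

Lemma Int_norm_le f M : bm f -> (forall x, unitI x -> `|f x| <= M) -> `|Int f| <= M.
Proof.
move=> bf fM; rewrite ler_norml; apply/andP; split.
  rewrite -[- M]Int_cst; apply: le_Int => // [|x /fM]; first exact: bm_cst.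
  by rewrite ler_norml => /andP[].
rewrite -[M]Int_cst; apply: le_Int => // [|x /fM]; first exact: bm_cst.
by rewrite ler_norml => /andP[].
Qed.

Lemma integral_IntE f : bm f -> (\int[mu]_(x in unitI) (f x)%:E)%E = (Int f)%:E.
Proof.
move=> bf; rewrite /Int /Rintegral fineK//.
by apply: integrable_fin_num; [exact: measurable_unitI|exact: bm_integrableI].
Qed.

(** The e i are not normalised, but |e i| <= 1 gives Int (e i)^2 <= 1, the direction needed.
    Replacing h by h - c e n leaves the earlier coefficients unchanged and lowers the square
    integral by at least c^2. *)
Lemma bessel (e : nat -> R -> R) n h :
  (forall i, bm (e i)) -> (forall i x, `|e i x| <= 1) ->
  (forall i j, i != j -> Int (fun x => e i x * e j x) = 0) -> bm h ->
  \sum_(0 <= i < n) (Int (fun x => h x * e i x)) ^+ 2 <= Int (fun x => h x ^+ 2).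
Proof.
move=> be e1 eo; elim: n h => [h _|n ih h bh].
  by rewrite big_nil; apply: Int_ge0 => x _; rewrite sqr_ge0.
rewrite big_nat_recr//=; set c := Int (fun x => h x * e n x).
pose h' x := h x - c * e n x.
have bce : bm (fun x => c * e n x) by exact: bmZ.
have bh' : bm h' by exact: bmB.
have bhe i : bm (fun x => h x * e i x) by exact: bmM.
have hE i : (i < n)%N -> Int (fun x => h x * e i x) = Int (fun x => h' x * e i x).
  move=> lin; transitivity (Int (fun x => h x * e i x - c * (e n x * e i x))).
    rewrite IntB//; last by apply: bmZ; exact: bmM.
    by rewrite IntZ ?eo ?mulr0 ?subr0//; [rewrite gtn_eqF|exact: bmM].
  by congr Int; apply/funext => x; rewrite /h'; ring.
under eq_big_nat => i /andP[_ lin] do rewrite hE//.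
suff -> : Int (fun x => h x ^+ 2) = Int (fun x => h' x ^+ 2) + 2 * c ^+ 2
    - c ^+ 2 * Int (fun x => e n x * e n x).
  have : Int (fun x => e n x * e n x) <= 1.
    rewrite -[leRHS](Int_cst 1); apply: le_Int; [exact: bmM|exact: bm_cst|].
    by move=> x _; rewrite (le_trans (ler_norm _))// normrM mulr_ile1.
  by have := ih h' bh'; have := sqr_ge0 c; nra.
have b2 : bm (fun x => h' x ^+ 2).
  by under eq_fun do rewrite expr2; exact: bmM.
transitivity (Int (fun x => h' x ^+ 2 + (2 * c) * (h x * e n x)
    - (c ^+ 2) * (e n x * e n x))).
  by congr Int; apply/funext => x; rewrite /h'; ring.
have bee : bm (fun x => e n x * e n x) by exact: bmM.
rewrite IntB; [|by apply: bmD => //; exact: bmZ|exact: bmZ].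
by rewrite IntD ?IntZ//; [rewrite -/c; ring|exact: bmZ].
Qed.

Lemma orthogonal_weak_cvg0 (e : nat -> R -> R) h :
  (forall i, bm (e i)) -> (forall i x, `|e i x| <= 1) ->
  (forall i j, i != j -> Int (fun x => e i x * e j x) = 0) -> bm h ->
  Int (fun x => h x * e n x) @[n --> \oo] --> (0 : R).
Proof.
move=> be e1 eo bh; pose c n := Int (fun x => h x * e n x).
have : (fun n => c n ^+ 2) @ \oo --> (0 : R).
  apply: cvg_series_cvg_0; apply: nondecreasing_is_cvgn.
    by apply/nondecreasing_seqP => n; rewrite seriesSr ler_wpDr ?sqr_ge0.
  by exists (Int (fun x => h x ^+ 2)) => _ [n _ <-]; exact: bessel.
move=> c0; apply/cvgrPdist_lt => eps eps0.
have /cvgrPdist_lt/(_ _ (exprn_gt0 2 eps0)) := c0.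
apply: filterS => n; rewrite !sub0r !normrN normrX => ltc.
by rewrite -(ltr_pXn2r (n := 2))// ?nnegrE ?ltW.
Qed.

End BoundedMeasurable.

(** * Trigonometric functions and the Riemann-Lebesgue lemma for dilations *)

Section RiemannLebesgue.
Context {R : realType}.
Implicit Types (f g h : R -> R) (a c x : R).
Local Notation mu := (@lebesgue_measure R).

Definition cs (n : nat) (x : R) : R := cos (2 * pi * n%:R * x).
Definition sn (n : nat) (x : R) : R := sin (2 * pi * n%:R * x).

Lemma two_pi_gt0 n : (0 < n)%N -> 0 < 2 * pi * n%:R :> R.
Proof.
move=> n0; apply: mulr_gt0; last by rewrite ltr0n.
by apply: mulr_gt0 => //; exact: pi_gt0.
Qed.

Lemma cs0 x : cs 0 x = 1. Proof. by rewrite /cs mulr0 mul0r cos0. Qed.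
Lemma sn0 x : sn 0 x = 0. Proof. by rewrite /sn mulr0 mul0r sin0. Qed.

Lemma csD m n x : cs (m + n) x = cs m x * cs n x - sn m x * sn n x.
Proof. by rewrite /cs /sn natrD mulrDr mulrDl cosD. Qed.

Lemma snD m n x : sn (m + n) x = sn m x * cs n x + cs m x * sn n x.
Proof. by rewrite /cs /sn natrD mulrDr mulrDl sinD. Qed.

Lemma csB m n x : (n <= m)%N -> cs (m - n) x = cs m x * cs n x + sn m x * sn n x.
Proof. by move=> nm; rewrite /cs /sn natrB// mulrBr mulrBl cosB. Qed.

Lemma snB m n x : (n <= m)%N -> sn (m - n) x = sn m x * cs n x - cs m x * sn n x.
Proof. by move=> nm; rewrite /cs /sn natrB// mulrBr mulrBl sinB. Qed.

Lemma cs2Dsn2 n x : cs n x ^+ 2 + sn n x ^+ 2 = 1.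
Proof. exact: cos2Dsin2. Qed.

Lemma cs_norm n x : `|cs n x| <= 1. Proof. exact: cos_max. Qed.
Lemma sn_norm n x : `|sn n x| <= 1. Proof. exact: sin_max. Qed.

Lemma cs_scale n m x : cs n (m%:R * x) = cs (n * m) x.
Proof. by rewrite /cs natrM !mulrA. Qed.

Lemma sn_scale n m x : sn n (m%:R * x) = sn (n * m) x.
Proof. by rewrite /sn natrM !mulrA. Qed.

Lemma cs_at1 n : cs n 1 = 1 /\ sn n 1 = 0.
Proof.
elim: n => [|n [c1 s0]]; first by rewrite cs0 sn0.
have [c11 s11] : cs 1 1 = 1 /\ sn 1 1 = 0.
  by rewrite /cs /sn !mulr1 mulr_natl cos2pi sin2pi.
by rewrite -addn1 csD snD c1 s0 c11 s11; split; ring.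
Qed.

Lemma is_derive_cs n x : is_derive x 1 (cs n) (- (2 * pi * n%:R) * sn n x).
Proof.
have -> : cs n = cos \o (fun y => 2 * pi * n%:R * y) by [].
apply: is_derive_eq; rewrite /sn; set a := 2 * pi * n%:R.
by rewrite /GRing.scale/=; ring.
Qed.

Lemma is_derive_sn n x : is_derive x 1 (sn n) (2 * pi * n%:R * cs n x).
Proof.
have -> : sn n = sin \o (fun y => 2 * pi * n%:R * y) by [].
apply: is_derive_eq; rewrite /cs; set a := 2 * pi * n%:R.
by rewrite /GRing.scale/=; ring.
Qed.

Lemma is_derive_continuous (F f : R -> R) : (forall x, is_derive x 1 F (f x)) ->
  continuous F.
Proof.
by move=> dF x; apply/differentiable_continuous/derivable1_diffP; case: (dF x).
Qed.

Lemma continuous_cs n : continuous (cs n).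
Proof. by apply: is_derive_continuous => x; exact: is_derive_cs. Qed.

Lemma continuous_sn n : continuous (sn n).
Proof. by apply: is_derive_continuous => x; exact: is_derive_sn. Qed.

Lemma bm_cs n : bm (cs n).
Proof. apply: bm_continuous; [exact: continuous_cs|exact: cs_norm]. Qed.

Lemma bm_sn n : bm (sn n).
Proof. apply: bm_continuous; [exact: continuous_sn|exact: sn_norm]. Qed.

Lemma Int_derive (F f : R -> R) : (forall x, is_derive x 1 F (f x)) ->
  continuous f -> Int f = F 1 - F 0.
Proof.
move=> dF cf; rewrite /Int /Rintegral (@continuous_FTC2 _ f F)//.
- exact: continuous_subspaceT.
- have cF := is_derive_continuous dF.
  split; first by move=> x _; case: (dF x).
    by apply: cvg_at_right_filter; exact: cF.
  by apply: cvg_at_left_filter; exact: cF.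
- by move=> x _; rewrite derive1E; case: (dF x).
Qed.

Lemma Int_cs n : (0 < n)%N -> Int (cs n) = 0.
Proof.
move=> n0; have [_ sn1] := cs_at1 n.
have nz : 2 * pi * n%:R != 0 :> R.
  by rewrite gt_eqF// two_pi_gt0.
have d x : is_derive x 1 (fun y => (2 * pi * n%:R)^-1 * sn n y) (cs n x).
  have := is_derive_sn n x => dsn; apply: is_derive_eq.
  by rewrite /GRing.scale/= mulrA mulVf// mul1r.
rewrite (Int_derive d) ?sn1; last exact: continuous_cs.
by rewrite /sn !mulr0 sin0 mulr0 subrr.
Qed.

Lemma Int_sn n : Int (sn n) = 0.
Proof.
have [->|n0] := eqVneq n 0%N; first by rewrite (eq_Int (g := fun=> 0)) ?Int_cst// => x _; exact: sn0.
have [cs1 _] := cs_at1 n.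
have nz : 2 * pi * n%:R != 0 :> R.
  by rewrite gt_eqF// two_pi_gt0// lt0n.
have d x : is_derive x 1 (fun y => - (2 * pi * n%:R)^-1 * cs n y) (sn n x).
  have := is_derive_cs n x => dsn; apply: is_derive_eq.
  by rewrite /GRing.scale/= mulrA mulrNN mulVf// mul1r.
rewrite (Int_derive d) ?cs1; last exact: continuous_sn.
by rewrite /cs !mulr0 cos0 subrr.
Qed.

Lemma cs_orthogonal i j : i != j -> Int (fun x => cs i x * cs j x) = 0.
Proof.
wlog ji : i j / (j < i)%N => [hw ij|_].
  have [/hw->//|ji|/eqP] := ltngtP j i; last by rewrite eq_sym (negbTE ij).
  by under eq_fun do rewrite mulrC; rewrite hw// eq_sym.
rewrite (eq_Int (g := fun x => 2^-1 * cs (i + j) x + 2^-1 * cs (i - j) x)).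
  rewrite IntD ?IntZ; [|exact: bm_cs|exact: bm_cs|by apply: bmZ; exact: bm_cs..].
  by rewrite !Int_cs ?mulr0 ?addr0// ?subn_gt0// addn_gt0 (leq_ltn_trans _ ji).
by move=> x _; rewrite csD csB; [field|exact: ltnW].
Qed.

Lemma sn_orthogonal i j : i != j -> Int (fun x => sn i x * sn j x) = 0.
Proof.
wlog ji : i j / (j < i)%N => [hw ij|_].
  have [/hw->//|ji|/eqP] := ltngtP j i; last by rewrite eq_sym (negbTE ij).
  by under eq_fun do rewrite mulrC; rewrite hw// eq_sym.
rewrite (eq_Int (g := fun x => 2^-1 * cs (i - j) x - 2^-1 * cs (i + j) x)).
  rewrite IntB ?IntZ; [|exact: bm_cs|exact: bm_cs|by apply: bmZ; exact: bm_cs..].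
  by rewrite !Int_cs ?mulr0 ?subr0// ?subn_gt0// addn_gt0 (leq_ltn_trans _ ji).
by move=> x _; rewrite csD csB; [field|exact: ltnW].
Qed.

(* [g] is asymptotically independent of every bounded function when its
   argument is dilated. *)
Definition RL g := bm g /\ forall h, bm h ->
  Int (fun x => h x * g (N%:R * x)) @[N --> \oo] --> Int h * Int g.

Lemma bm_dilate g N : bm g -> bm (fun x => g (N%:R * x)).
Proof.
move=> [mg [M gM]]; split; last by exists M.
by apply: (measurableT_comp mg); exact: measurable_funM.
Qed.

Lemma RL_cst c : RL (fun=> c).
Proof.
split=> [|h bh]; first exact: bm_cst.
rewrite Int_cst [X in X @ _](_ : _ = fun=> Int h * c); first exact: cvg_cst.
by apply/funext => N; under eq_fun do rewrite mulrC; rewrite IntZ// mulrC.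
Qed.

Lemma RLZ c g : RL g -> RL (fun x => c * g x).
Proof.
move=> [bg rg]; split=> [|h bh]; first exact: bmZ.
rewrite IntZ// mulrCA [X in X @ _](_ : _ =
  fun N => c * Int (fun x => h x * g (N%:R * x))); first by apply: cvgMr; exact: rg.
apply/funext => N; rewrite -IntZ; last by apply: bmM => //; exact: bm_dilate.
by congr Int; apply/funext => x; rewrite mulrCA.
Qed.

Lemma RLD f g : RL f -> RL g -> RL (fun x => f x + g x).
Proof.
move=> [bf rf] [bg rg]; split=> [|h bh]; first exact: bmD.
rewrite IntD// mulrDr [X in X @ _](_ : _ = fun N =>
  Int (fun x => h x * f (N%:R * x)) + Int (fun x => h x * g (N%:R * x))).
  by apply: cvgD; [exact: rf|exact: rg].
apply/funext => N; rewrite -IntD; [|by apply: bmM => //; exact: bm_dilate..].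
by congr Int; apply/funext => x; rewrite mulrDr.
Qed.

Lemma RL_sum (F : nat -> R -> R) n : (forall i, RL (F i)) ->
  RL (fun x => \sum_(0 <= i < n) F i x).
Proof.
move=> rF; elim: n => [|n ih].
  by under eq_fun do rewrite big_nil; exact: RL_cst.
by under eq_fun do rewrite big_nat_recr//=; exact: RLD.
Qed.

Lemma RL_uniform g : bm g -> (forall eps, 0 < eps ->
    exists2 g', RL g' & forall x, `|g x - g' x| <= eps) -> RL g.
Proof.
move=> bg approx; split=> // h bh.
have [mh [M hM]] := bh.
have M0 : 0 <= M by rewrite (le_trans _ (hM 0)).
apply/cvgrPdist_le => eps eps0.
(* The errors M d, d and M d below add up to eps. *)
have d0 : 0 < eps / (2 * M + 1) by rewrite divr_gt0// ltr_wpDl// mulr_ge0.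
set d := eps / _ in d0.
have [g' [bg' rg'] gg'] := approx _ d0.
have /cvgrPdist_le/(_ _ d0) := rg' h bh.
apply: filterS => N hN.
have bgN := bm_dilate N bg; have bgN' := bm_dilate N bg'.
have e1 : `|Int g - Int g'| <= d.
  by rewrite -IntB//; apply: Int_norm_le => //; exact: bmB.
have e2 : `|Int (fun x => h x * g (N%:R * x)) - Int (fun x => h x * g' (N%:R * x))| <= M * d.
  rewrite -IntB; [|exact: bmM..].
  apply: Int_norm_le => [|x _]; first by apply: bmB; exact: bmM.
  by rewrite -mulrBr normrM ler_pM.
have e3 : `|Int h| <= M by exact: Int_norm_le.
have e4 : `|Int h * Int g - Int h * Int g'| <= M * d.
  by rewrite -mulrBr normrM ler_pM.
have -> : eps = M * d + d + M * d.
  by rewrite /d; field; rewrite gt_eqF// ltr_wpDl// mulr_ge0.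
set A := Int h * Int g in e4 *; set B := Int _ in e2 *.
set C := Int h * Int g' in hN e4; set D := Int (fun x => h x * g' _) in hN e2.
rewrite (_ : A - B = (A - C) + (C - D) + (D - B)); last by ring.
rewrite (le_trans (ler_normD _ _))// lerD//; last by rewrite distrC.
by rewrite (le_trans (ler_normD _ _))// lerD.
Qed.

(** Dilating [cs k] by N gives the frequency k N, so only multiples of k are visited. *)
Lemma near_infty_mul (P : nat -> Prop) k : (0 < k)%N ->
  (\forall n \near \oo, P n) -> \forall n \near \oo, P (k * n)%N.
Proof.
move=> k0 [N _ hN]; exists N => // n /= Nn.
by apply: hN => /=; rewrite (leq_trans Nn)// leq_pmull.
Qed.

Lemma RL_cs k : RL (cs k).
Proof.
have [->|k0] := posnP k.
  by rewrite (_ : cs 0 = fun=> 1); [exact: RL_cst|apply/funext => x; exact: cs0].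
split=> [|h bh]; first exact: bm_cs.
rewrite Int_cs// mulr0.
have /cvgrPdist_le := orthogonal_weak_cvg0 bm_cs cs_norm cs_orthogonal bh.
move=> cvg0; apply/cvgrPdist_le => eps /cvg0 /(near_infty_mul k0).
by apply: filterS => N; under [in X in _ -> X]eq_fun do rewrite cs_scale.
Qed.

Lemma RL_sn k : RL (sn k).
Proof.
have [->|k0] := posnP k.
  by rewrite (_ : sn 0 = fun=> 0); [exact: RL_cst|apply/funext => x; exact: sn0].
split=> [|h bh]; first exact: bm_sn.
rewrite Int_sn mulr0.
have /cvgrPdist_le := orthogonal_weak_cvg0 bm_sn sn_norm sn_orthogonal bh.
move=> cvg0; apply/cvgrPdist_le => eps /cvg0 /(near_infty_mul k0).
by apply: filterS => N; under [in X in _ -> X]eq_fun do rewrite sn_scale.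
Qed.

(** Multiplication by cs 1 splits the frequency k into k + 1 and k - 1, so the class is closed under
    it; k = 0 is separate because k - 1 is truncated. *)
Lemma RL_Xcs a c n k : RL (fun x => (a + c * cs 1 x) ^+ n * cs k x).
Proof.
elim: n k => [|n ih] k; first by under eq_fun do rewrite mul1r; exact: RL_cs.
have [->|k0] := posnP k.
  rewrite (_ : (fun _ => _) = fun x => a * ((a + c * cs 1 x) ^+ n * cs 0 x) +
    c * ((a + c * cs 1 x) ^+ n * cs 1 x)); first by apply: RLD; exact: RLZ.
  by apply/funext => x; rewrite exprS cs0; ring.
rewrite (_ : (fun _ => _) = fun x => a * ((a + c * cs 1 x) ^+ n * cs k x) +
  (c / 2 * ((a + c * cs 1 x) ^+ n * cs (k + 1) x) +
  c / 2 * ((a + c * cs 1 x) ^+ n * cs (k - 1) x))).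
  by do 2 (apply: RLD; first exact: RLZ); exact: RLZ.
by apply/funext => x; rewrite exprS csD csB//; field.
Qed.

Lemma RL_Xsn a c n k : RL (fun x => (a + c * cs 1 x) ^+ n * sn k x).
Proof.
elim: n k => [|n ih] k; first by under eq_fun do rewrite mul1r; exact: RL_sn.
have [->|k0] := posnP k.
  by rewrite (_ : (fun _ => _) = fun=> 0); [exact: RL_cst|apply/funext => x; rewrite sn0 mulr0].
rewrite (_ : (fun _ => _) = fun x => a * ((a + c * cs 1 x) ^+ n * sn k x) +
  (c / 2 * ((a + c * cs 1 x) ^+ n * sn (k + 1) x) +
  c / 2 * ((a + c * cs 1 x) ^+ n * sn (k - 1) x))).
  by do 2 (apply: RLD; first exact: RLZ); exact: RLZ.
by apply/funext => x; rewrite exprS snD snB//; field.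
Qed.

End RiemannLebesgue.

(** * Uniform binomial expansion of (1 + t)^s for |t| <= 1/6 *)

Section BinomialSeries.
Context {R : realType}.
Implicit Types (s t y z : R).

(** Generalised binomial coefficients; [bins s n] consists of the first n terms of the binomial
    series of (1 + t)^s, and [dbins s n] is its derivative. *)
Fixpoint binc s (n : nat) : R :=
  if n is m.+1 then binc s m * (s - m%:R) / m.+1%:R else 1.

Definition bins s n t := \sum_(0 <= i < n) binc s i * t ^+ i.

Definition dbins s n t := \sum_(0 <= i < n) binc s i * (i%:R * t ^+ i.-1).

Lemma is_derive_bins s n t : is_derive t 1 (bins s n) (dbins s n t).
Proof.
elim: n => [|n ih].
  rewrite (_ : bins s 0 = cst 0); last by apply/funext => y; rewrite /bins big_nil.
  by rewrite /dbins big_nil; exact: is_derive_cst.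
rewrite (_ : bins s n.+1 = bins s n + (fun y => binc s n * y ^+ n)); last first.
  by apply/funext => y; rewrite /bins big_nat_recr.
rewrite /dbins big_nat_recr//=; apply: is_deriveD => /=.
rewrite (_ : (fun y => _) = binc s n \*: (id ^+ n : R -> R)); last first.
  by apply/funext => y; rewrite /= exprfctE.
by apply: is_derive_eq; rewrite /GRing.scale/= mulr1.
Qed.

(** (1 + t)^s solves (1 + t) y' = s y; truncating its series leaves only the boundary term on the
    right. *)
Lemma bins_ode s n t :
  dbins s n t * (1 + t) - s * bins s n t = - (n%:R * binc s n * t ^+ n.-1).
Proof.
elim: n => [|n ih]; first by rewrite /dbins /bins !big_nil; ring.
have -> : dbins s n.+1 t = dbins s n t + binc s n * (n%:R * t ^+ n.-1).
  by rewrite /dbins big_nat_recr.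
have -> : bins s n.+1 t = bins s n t + binc s n * t ^+ n.
  by rewrite /bins big_nat_recr.
transitivity (- (n%:R * binc s n * t ^+ n.-1) +
  binc s n * (n%:R * t ^+ n.-1) * (1 + t) - s * (binc s n * t ^+ n)).
  by rewrite -ih; ring.
have nt : n%:R * t ^+ n.-1 * t = n%:R * t ^+ n.
  by case: n {ih} => [|n]; rewrite ?mul0r// -mulrA -exprSr.
have -> : n.+1%:R * binc s n.+1 * t ^+ n.+1.-1 = binc s n * (s - n%:R) * t ^+ n.
  by rewrite /=; congr (_ * _); rewrite mulrC divfK// pnatr_eq0.
transitivity (binc s n * (n%:R * t ^+ n.-1 * t) - s * (binc s n * t ^+ n)); first by ring.
by rewrite nt; ring.
Qed.

(** Once n >= s, the ratio |s - n| / (n + 1) of consecutive coefficients is at most 1. *)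
Lemma binc_bounded s : 0 < s -> exists M, forall n, `|binc s n| <= M.
Proof.
move=> s0; pose K := Num.bound s.
have sK : s <= K%:R by rewrite ltW// archi_boundP// ltW.
have mono n : `|binc s (K + n)| <= `|binc s K|.
  elim: n => [|n ih]; first by rewrite addn0.
  rewrite addnS /= -mulrA normrM (le_trans _ ih)// ler_piMr// normrM normfV.
  rewrite normr_nat ler_pdivrMr ?mul1r ?ltr0n// ler0_norm; last first.
    by rewrite subr_le0 (le_trans sK)// ler_nat leq_addr.
  by rewrite opprB lerBlDr -natr1; have := ltW s0; lra.
exists (\sum_(0 <= i < K.+1) `|binc s i|) => n.
have [nK|/ltnW Kn] := leqP n K.
  by rewrite (bigD1_seq n) ?iota_uniq ?mem_index_iota//= lerDl sumr_ge0.
rewrite -(subnKC Kn) (le_trans (mono _))//.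
by rewrite (bigD1_seq K) ?iota_uniq ?mem_index_iota//= lerDl sumr_ge0.
Qed.

(** The quotient D of [bins s n] by (1 + t)^s is 1 at 0, and by [bins_ode] its derivative comes from
    the boundary term alone; the mean value theorem then gives the error. On this range 1 + t and
    its inverse are at most 2. *)
Lemma bins_error s n t : 0 < s -> (0 < n)%N -> `|t| <= 6^-1 ->
  `|(1 + t) `^ s - bins s n t| <=
  2 `^ s * (n%:R * `|binc s n| * `|t| ^+ n.-1 * 2 `^ (s + 1) * `|t|).
Proof.
move=> s0 n0 t6.
have sixth : 6^-1 = 1/6 :> R by rewrite div1r.
rewrite sixth ler_norml in t6; have {t6} [t1 t2] := andP t6.
pose D y := bins s n y * (1 + y) `^ (- s).
pose dD y : R := - (n%:R * binc s n * y ^+ n.-1) * (1 + y) `^ (- s - 1).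
have derD y : -1 < y -> is_derive y 1 D (dD y).
  move=> y1; have p1 : 0 < 1 + y by lra.
  have := is_derive_bins s n y => db.
  have dp : is_derive y 1 (fun z => (1 + z) `^ (- s)) (- s * (1 + y) `^ (- s - 1)).
    rewrite (_ : (fun _ => _) = (fun a => a `^ (- s)) \o (fun z => 1 + z))//.
    have := is_derive1_powR (- s) p1 => dpow.
    apply: is_derive_eq; rewrite /GRing.scale/=; ring.
  apply: is_derive_eq; rewrite /GRing.scale/= /dD -bins_ode.
  have -> : (1 + y) `^ (- s) = (1 + y) * (1 + y) `^ (- s - 1).
    rewrite -[X in X * _]powRr1 ?ltW// -powRD ?(gt_eqF p1) ?implybT//.
    by congr (_ `^ _); ring.
  by ring.
have D0 : D 0 = 1.
  rewrite /D /bins addr0 powR1 mulr1 big_ltn// expr0 mulr1 big_nat big1 ?addr0// => i /andP[i1 _].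
  by rewrite expr0n gtn_eqF// mulr0.
have key : `|D t - 1| <= n%:R * `|binc s n| * `|t| ^+ n.-1 * 2 `^ (s + 1) * `|t|.
  have [y yt ->] : exists2 y, `|y| <= `|t| & D t - 1 = dD y * t.
    suff : exists2 y, `|y| <= `|t| & D t - D 0 = dD y * t by rewrite D0.
    have cD y : -1 < y -> {for y, continuous D}.
      by move=> /derD[dy _]; exact/differentiable_continuous/derivable1_diffP.
    have [t0|t0] := leP 0 t.
      have [z|y|y] := MVT_segment t0 (df := dD) (f := D).
      - by rewrite in_itv/= => /andP[z1 z2]; apply: derD; lra.
      - apply: continuous_in_subspaceT => z; rewrite inE/= in_itv/= => /andP[z1 z2].
        by apply: cD; lra.
      - rewrite in_itv/= => /andP[y1 y2] ->; rewrite subr0.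
        by exists y => //; rewrite !ger0_norm.
    have [z|y|y] := MVT_segment (ltW t0) (df := dD) (f := D).
    - by rewrite in_itv/= => /andP[z1 z2]; apply: derD; lra.
    - apply: continuous_in_subspaceT => z; rewrite inE/= in_itv/= => /andP[z1 z2].
      by apply: cD; lra.
    - rewrite in_itv/= => /andP[y1 y2] h; exists y; last by rewrite -opprB h; ring.
      by rewrite !ler0_norm//; lra.
  have /andP[y1 y2] : - (1 / 6) <= y <= 1 / 6.
    by rewrite -ler_norml (le_trans yt)// ler_norml t1.
  rewrite normrM ler_wpM2r// /dD normrM normrN !normrM normr_nat normrX.
  rewrite ler_pM// ?mulr_ge0//.
    by rewrite ler_wpM2l ?mulr_ge0// lerXn2r// ?nnegrE.
  rewrite ger0_norm ?powR_ge0//.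
  rewrite (_ : - s - 1 = - (s + 1)); last by ring.
  rewrite powRN -powR_inv1 ?powR_ge0// -powRrM mulrC powRrM powR_inv1; last by lra.
  rewrite ge0_ler_powR ?nnegrE ?invr_ge0//; [lra|lra|].
  by rewrite -[leRHS]invrK lef_pV2 ?posrE ?invr_gt0//; lra.
have pt : 0 < 1 + t by lra.
have -> : (1 + t) `^ s - bins s n t = (1 + t) `^ s * (1 - D t).
  rewrite /D mulrBr mulr1 mulrCA -powRD ?(gt_eqF pt) ?implybT//.
  by rewrite subrr powRr0 mulr1.
rewrite normrM distrC ler_pM//.
rewrite ger0_norm ?powR_ge0// ge0_ler_powR ?nnegrE//; lra.
Qed.

Lemma powR_linear_error s : 0 < s -> exists2 C, 0 < C & forall t, `|t| <= 6^-1 ->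
  `|(1 + t) `^ s - (1 + s * t)| <= C * t ^+ 2.
Proof.
(* The summand 1 keeps C positive when [binc s 2] vanishes, that is for s = 1. *)
move=> s0; exists (2 `^ s * (2 * `|binc s 2| * 2 `^ (s + 1)) + 1) => [|t t6].
  by rewrite ltr_wpDl// !mulr_ge0// powR_ge0.
have := bins_error s0 (isT : (0 < 2)%N) t6.
have -> : bins s 2 t = 1 + s * t.
  by rewrite /bins !big_nat_recr//= big_nil/= subr0 mul1r divr1 expr0 expr1 add0r mul1r.
move=> /le_trans; apply; rewrite expr1 -(real_normK (num_real t)).
rewrite [leRHS]mulrDl mul1r ler_wpDr ?sqr_ge0// le_eqVlt; apply/orP; left; apply/eqP; ring.
Qed.

Lemma bins_uniform s eps : 0 < s -> 0 < eps ->
  exists n, forall t, `|t| <= 6^-1 -> `|(1 + t) `^ s - bins s n t| <= eps.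
Proof.
move=> s0 eps0; have [M hM] := binc_bounded s0.
have M0 : 0 <= M by rewrite (le_trans _ (hM 0%N)).
(* The 6 repays the exponent n - 1: by n <= 2^n, n 6^(-(n - 1)) <= 6 (2/6)^n. *)
pose C : R := 2 `^ s * (M * 6 * 2 `^ (s + 1)).
have C0 : 0 <= C by rewrite !mulr_ge0// ?powR_ge0.
have : (C * 3^-1 ^+ n) @[n --> \oo] --> (0 : R).
  rewrite -[X in _ --> X](mulr0 C); apply: cvgMr; apply: cvg_expr.
  by rewrite ger0_norm// invf_lt1// ltr1n.
move=> /cvgrPdist_le/(_ _ eps0)[N _ hN].
exists N.+1 => t t6; apply: (le_trans (bins_error s0 _ t6)) => //.
apply: (@le_trans _ _ (2 `^ s *
    (N.+1%:R * `|binc s N.+1| * 6^-1 ^+ N.+1.-1 * 2 `^ (s + 1)))).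
  rewrite ler_wpM2l ?powR_ge0// -[leRHS]mulr1 ler_pM ?mulr_ge0 ?exprn_ge0 ?powR_ge0//.
    by rewrite ler_wpM2r ?powR_ge0// ler_wpM2l ?mulr_ge0// lerXn2r ?nnegrE ?invr_ge0.
  by rewrite (le_trans t6)// invf_le1// ler1n.
have := hN N.+1 (leqnSn N); rewrite sub0r normrN; apply: le_trans.
rewrite [leRHS]ger0_norm ?mulr_ge0 ?exprn_ge0//.
rewrite /C -[leRHS]mulrA ler_wpM2l ?powR_ge0//.
rewrite -[leRHS]mulrA [2 `^ (s + 1) * _]mulrC mulrA ler_wpM2r ?powR_ge0//.
have n2 : N.+1%:R <= (2:R) ^+ N.+1 by rewrite -natrX ler_nat ltnW// ltn_expl.
have h6 : (6:R)^-1 ^+ N.+1.-1 = 6 * 6^-1 ^+ N.+1.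
  by rewrite /= [in RHS]exprS mulrA mulfV ?mul1r.
have h3 : (3:R)^-1 ^+ N.+1 = 2 ^+ N.+1 * 6^-1 ^+ N.+1.
  by rewrite -exprMn; congr (_ ^+ _); field.
rewrite h6 h3.
have x0 : 0 <= (6:R)^-1 ^+ N.+1 by rewrite exprn_ge0.
have := hM N.+1; have := normr_ge0 (binc s N.+1).
move: x0 n2; set x := _^-1 ^+ N.+1; set y := 2 ^+ N.+1; set z : R := N.+1%:R.
set w := `|binc s N.+1| => x0 n2 w0 wM.
have z0 : 0 <= z by rewrite /z.
have zw : z * w <= y * M by rewrite ler_pM.
by have := ler_wpM2r x0 zw; lra.
Qed.

End BinomialSeries.

(** * Fourier coefficients of |1 + e0 e(x)|^(2 s) and their signs *)

Section FourierSigns.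
Context {R : realType}.
Implicit Types (s c x : R).

(* [nf c n x] is the squared modulus of 1 + c e^(2 pi i n x). *)
Definition nf c (n : nat) x : R := 1 + (c ^+ 2 + 2 * c * cs n x).

(** Small enough that [nf e0] differs from 1 by at most 3/32 <= 1/6, the range of the binomial
    expansion. *)
Definition e0 : R := 32^-1.

Lemma nf_near1 c n x : 0 <= c <= e0 -> `|c ^+ 2 + 2 * c * cs n x| <= 3 * c.
Proof.
move=> /andP[c0 c1].
have := cs_norm n x; rewrite !ler_norml => /andP[x1 x2].
have e01 : e0 = 1/32 by rewrite /e0 div1r.
by rewrite e01 in c1; apply/andP; split; nra.
Qed.

Lemma nf_e0_near1 n x : `|e0 ^+ 2 + 2 * e0 * cs n x| <= 6^-1.
Proof.
rewrite (le_trans (nf_near1 _ _ _))//; first by rewrite lexx andbT /e0 invr_ge0.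
have -> : 6^-1 = 3 * 18^-1 :> R by field.
by rewrite /e0 ler_wpM2l// lef_pV2 ?posrE// ler_nat.
Qed.

Lemma nf_ge0 c n x : 0 <= nf c n x.
Proof.
have := cs2Dsn2 n x => h.
have -> : nf c n x = (1 + c * cs n x) ^+ 2 + (c * sn n x) ^+ 2.
  rewrite /nf; transitivity (1 + (c ^+ 2 * (cs n x ^+ 2 + sn n x ^+ 2) + 2 * c * cs n x)).
    by rewrite h mulr1.
  by ring.
by rewrite addr_ge0 ?sqr_ge0.
Qed.

Lemma bm_nf c n : bm (nf c n).
Proof.
apply: bmD; first exact: bm_cst.
by apply: bmD; [exact: bm_cst|apply: bmZ; exact: bm_cs].
Qed.

Lemma bm_nf_powR c n s : 0 <= s -> bm (fun x => nf c n x `^ s).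
Proof. by move=> s0; apply: bm_powR => //; [exact: nf_ge0|exact: bm_nf]. Qed.

Lemma nf_scale c n N x : nf c n (N%:R * x) = nf c (n * N) x.
Proof. by rewrite /nf cs_scale. Qed.

(** By [bins_uniform], the power of [nf e0 1] is a uniform limit of polynomials in cs 1, which
    [RL_Xcs] covers. *)
Lemma RL_nf_cs s k : 0 < s -> RL (fun x => nf e0 1 x `^ s * cs k x).
Proof.
move=> s0; apply: RL_uniform => [|eps eps0].
  by apply: bmM; [exact: bm_nf_powR (ltW s0)|exact: bm_cs].
have [n hn] := bins_uniform s0 eps0.
exists (fun x => \sum_(0 <= i < n)
  binc s i * ((e0 ^+ 2 + 2 * e0 * cs 1 x) ^+ i * cs k x)).
  by apply: RL_sum => i; apply: RLZ; exact: RL_Xcs.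
move=> x; under eq_bigr do rewrite mulrA; rewrite -mulr_suml -mulrBl normrM.
rewrite -[leRHS]mulr1 ler_pM//; last exact: cs_norm.
exact: hn (nf_e0_near1 1 x).
Qed.

Lemma RL_nf_sn s k : 0 < s -> RL (fun x => nf e0 1 x `^ s * sn k x).
Proof.
move=> s0; apply: RL_uniform => [|eps eps0].
  by apply: bmM; [exact: bm_nf_powR (ltW s0)|exact: bm_sn].
have [n hn] := bins_uniform s0 eps0.
exists (fun x => \sum_(0 <= i < n)
  binc s i * ((e0 ^+ 2 + 2 * e0 * cs 1 x) ^+ i * sn k x)).
  by apply: RL_sum => i; apply: RLZ; exact: RL_Xsn.
move=> x; under eq_bigr do rewrite mulrA; rewrite -mulr_suml -mulrBl normrM.
rewrite -[leRHS]mulr1 ler_pM//; last exact: sn_norm.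
exact: hn (nf_e0_near1 1 x).
Qed.

(* The k-th Fourier coefficient of |1 + e0 e(x)|^(2 s). *)
Definition fc s k := Int (fun x => nf e0 1 x `^ s * cs k x).

Lemma nf_e0_gt0 x : 0 < nf e0 1 x.
Proof.
have := nf_e0_near1 1 x; rewrite ler_norml /nf -(div1r 6) => /andP[h _].
by move: h; lra.
Qed.

Lemma is_derive_nf_powR s x : is_derive x 1 (fun y => nf e0 1 y `^ (s + 1))
  ((s + 1) * nf e0 1 x `^ s * (- (4 * pi * e0) * sn 1 x)).
Proof.
rewrite (_ : (fun y => _) = (fun a => a `^ (s + 1)) \o nf e0 1)//.
have dn : is_derive x 1 (nf e0 1) (- (4 * pi * e0) * sn 1 x).
  have := is_derive_cs 1 x => dc.
  rewrite (_ : nf e0 1 = cst (1 + e0 ^+ 2) + (2 * e0) \*: cs 1); last first.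
    by apply/funext => y; rewrite /nf addrA.
  by apply: is_derive_eq; rewrite /GRing.scale/=; ring.
have := is_derive1_powR (s + 1) (nf_e0_gt0 x) => dpow.
by apply: is_derive_eq; rewrite /GRing.scale/= addrK.
Qed.

Lemma continuous_nf_powR s : continuous (fun y => nf e0 1 y `^ s).
Proof.
rewrite -(subrK 1 s); apply: is_derive_continuous => x; exact: is_derive_nf_powR.
Qed.

(* Integrate the derivative of sin(2 pi (j+1) x) |1 + e0 e(x)|^(2 s + 2) over a
   period. *)
Lemma fc_rec s j : 0 < s ->
  j.+1%:R * (1 + e0 ^+ 2) * fc s j.+1 + e0 * (j.+2%:R + s) * fc s j.+2
  + e0 * (j%:R - s) * fc s j = 0.
Proof.
move=> s0; pose v k x := nf e0 1 x `^ s * cs k x.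
have bv k : bm (v k) by apply: bmM; [exact: bm_nf_powR (ltW s0)|exact: bm_cs].
pose F x := sn j.+1 x * nf e0 1 x `^ (s + 1).
pose f x := 2 * pi * (j.+1%:R * (1 + e0 ^+ 2) * v j.+1 x +
  e0 * (j.+2%:R + s) * v j.+2 x + e0 * (j%:R - s) * v j x).
have cv k : continuous (v k).
  by move=> x; apply: cvgM; [exact: continuous_nf_powR|exact: continuous_cs].
have cf : continuous f.
  move=> x; apply: cvgMr; apply: cvgD; last by apply: cvgMr; exact: cv.
  by apply: cvgD; apply: cvgMr; exact: cv.
have dF x : is_derive x 1 F (f x).
  have := is_derive_sn j.+1 x => d1; have := is_derive_nf_powR s x => d2.
  apply: is_derive_eq; rewrite /GRing.scale/= /f /v.
  have -> : nf e0 1 x `^ (s + 1) = nf e0 1 x * nf e0 1 x `^ s.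
    rewrite powRD ?(gt_eqF (nf_e0_gt0 x)) ?implybT// powRr1 ?nf_ge0//.
    exact: mulrC.
  have hj : cs j x = cs j.+1 x * cs 1 x + sn j.+1 x * sn 1 x.
    by rewrite -csB// subn1.
  have hj2 : cs j.+2 x = cs j.+1 x * cs 1 x - sn j.+1 x * sn 1 x.
    by rewrite -csD addn1.
  rewrite hj hj2 {2}/nf -!natr1; ring.
have := Int_derive dF cf; rewrite /F.
have [_ ->] := @cs_at1 R j.+1; have -> : sn j.+1 0 = 0 :> R by rewrite /sn mulr0 sin0.
rewrite !mul0r subrr /f IntZ; last first.
  by apply: bmD; [apply: bmD|]; exact: bmZ.
have pi2 : 2 * pi != 0 :> R by rewrite gt_eqF// mulr_gt0// pi_gt0.
move=> /eqP; rewrite mulf_eq0 (negbTE pi2)/= => /eqP.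
rewrite IntD; [|by apply: bmD; exact: bmZ|exact: bmZ].
rewrite IntD; [|exact: bmZ|exact: bmZ].
by rewrite !IntZ.
Qed.

Lemma fc0_gt0 s : 0 < s -> 0 < fc s 0.
Proof.
move=> s0; apply: (@lt_le_trans _ _ (2^-1 `^ s)); first by rewrite powR_gt0.
rewrite -[leLHS]Int_cst; apply: le_Int; first exact: bm_cst.
  by apply: bmM; [exact: bm_nf_powR (ltW s0)|exact: bm_cs].
move=> x _; rewrite cs0 mulr1 ge0_ler_powR ?nnegrE ?nf_ge0 ?invr_ge0 ?(ltW s0)//.
have := nf_e0_near1 1 x; rewrite ler_norml /nf -(div1r 6) => /andP[h _].
by move: h; rewrite -(div1r 2); lra.
Qed.

(* For [j > s] the three coefficients of the recurrence are positive, so both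
   signs occur; [s] not being an integer prevents the three terms from vanishing
   simultaneously, since the recurrence could then be run down to [fc s 0]. *)
Lemma fc_signs s : 0 < s -> (forall k : nat, s != k%:R) ->
  (exists2 k, (1 < k)%N & fc s k < 0) /\ (exists2 k, (1 < k)%N & 0 < fc s k).
Proof.
move=> s0 sN.
have e00 : 0 < e0 by rewrite /e0 invr_gt0.
have nz j : ~ (fc s j = 0 /\ fc s j.+1 = 0).
  elim: j => [[h _]|j ih [h1 h2]]; first by have := fc0_gt0 s0; rewrite h ltxx.
  apply: ih; split => //; have := fc_rec j s0; rewrite h1 h2 !mulr0 !add0r.
  move/eqP; rewrite !mulf_eq0 (gt_eqF e00)/= subr_eq0 eq_sym (negbTE (sN j))/=.
  by move/eqP.
(* The bound gives j > s; the two extra units give k > 1, which will place the frequency m + k N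
   beyond the degree of P (1 + e0 z^N). *)
pose j := (Num.bound s).+2.
have js : 0 < j%:R - s.
  rewrite subr_gt0 (lt_le_trans (archi_boundP (ltW s0)))// ler_nat /j.
  by rewrite -addn2 leq_addr.
have := fc_rec j s0.
have : 0 < j.+1%:R * (1 + e0 ^+ 2) by rewrite mulr_gt0 ?ltr0n// ltr_pwDl ?sqr_ge0.
have : 0 < e0 * (j.+2%:R + s) by rewrite mulr_gt0// ltr_pwDl ?ltr0n// ltW.
have : 0 < e0 * (j%:R - s) by rewrite mulr_gt0.
move: (nz j) (nz j.+1).
set A := e0 * (j%:R - s); set B := e0 * _; set C := _.+1%:R * _.
set x := fc s j; set y := fc s j.+1; set z := fc s j.+2.
move=> nz1 nz2 A0 B0 C0 E.
split.
- have [x0|x0] := ltP x 0; first by exists j.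
  have [y0|y0] := ltP y 0; first by exists j.+1.
  have [z0|z0] := ltP z 0; first by exists j.+2.
  exfalso; apply: nz1; split; apply/eqP; rewrite eq_le ?x0 ?y0 andbT.
    by have := mulr_ge0 (ltW B0) z0; have := mulr_ge0 (ltW C0) y0; nra.
  by have := mulr_ge0 (ltW B0) z0; have := mulr_ge0 (ltW A0) x0; nra.
- have [x0|x0] := ltP 0 x; first by exists j.
  have [y0|y0] := ltP 0 y; first by exists j.+1.
  have [z0|z0] := ltP 0 z; first by exists j.+2.
  exfalso; apply: nz1; split; apply/eqP; rewrite eq_le ?x0 ?y0/=.
    by have := mulr_ge0_le0 (ltW B0) z0; have := mulr_ge0_le0 (ltW C0) y0; nra.
  by have := mulr_ge0_le0 (ltW B0) z0; have := mulr_ge0_le0 (ltW A0) x0; nra.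
Qed.

(** The integrand is odd under x -> 1 - x. *)
Lemma Int_nf_sn s k : 0 < s -> Int (fun x => nf e0 1 x `^ s * sn k x) = 0.
Proof.
move=> s0; pose g x := nf e0 1 x `^ s * sn k x.
have bg : bm g by apply: bmM; [exact: bm_nf_powR (ltW s0)|exact: bm_sn].
have cg : continuous g.
  by move=> x; apply: cvgM; [exact: continuous_nf_powR|exact: continuous_sn].
have refl n x : cs n (1 - x) = cs n x /\ sn n (1 - x) = - sn n x.
  have [c1 s1] := @cs_at1 R n; rewrite /cs /sn mulr1 in c1 s1.
  by rewrite /cs /sn mulrBr mulr1 cosB sinB c1 s1; split; ring.
have : Int g = - Int g.
  rewrite -[in RHS]IntN// {1}/Int /unitI Rintegration_by_substitution_onem.
  - rewrite [X in `[X, _]]subrr; apply: eq_Int => x _.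
    have [c1 _] := refl 1%N x; have [_ s1] := refl k x.
    by rewrite -[LHS]/(g (1 - x)) /g /nf c1 s1 mulrN.
  - by rewrite ler01 lexx.
  - exact: continuous_subspaceT.
by rewrite -/g; lra.
Qed.

End FourierSigns.

(** * Gapped polynomials on the circle and comparison of weights *)

Section GappedPolynomials.
Context {R : realType}.
Implicit Types (P : {poly R}) (s b c x : R) (psi : R -> R).

(** Real and imaginary parts of P(e(x)); [nsq P x] is |P(e(x))|^2, so |P|^p is its power p/2. *)
Definition tre P x := \sum_(0 <= i < size P) P`_i * cs i x.
Definition tim P x := \sum_(0 <= i < size P) P`_i * sn i x.
Definition nsq P x := tre P x ^+ 2 + tim P x ^+ 2.

(** F is arbitrary so that cosines, sines and later the radial terms r^n F n are treated alike. *)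
Lemma tsum_widen (F : nat -> R -> R) P n x : (size P <= n)%N ->
  \sum_(0 <= i < size P) P`_i * F i x = \sum_(0 <= i < n) P`_i * F i x.
Proof.
move=> Pn; rewrite [RHS](big_cat_nat (n := size P))//=.
rewrite [X in _ = _ + X]big_nat [X in _ = _ + X]big1 ?addr0// => i /andP[Pi _].
by rewrite nth_default ?mul0r.
Qed.

Lemma tsumMXn (F : nat -> R -> R) P n x :
  \sum_(0 <= i < size (P * 'X^n)) (P * 'X^n)`_i * F i x =
  \sum_(0 <= i < size P) P`_i * F (i + n)%N x.
Proof.
rewrite (tsum_widen _ (n := n + size P)); last first.
  by rewrite (leq_trans (size_polyMleq _ _))// size_polyXn addnS addnC.
rewrite (big_cat_nat (n := n)) ?leq_addr//= [X in X + _]big_nat big1 ?add0r; last first.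
  by move=> i /andP[_ lin]; rewrite coefMXn lin mul0r.
rewrite -{1}[n]add0n big_addn addKn; apply: eq_bigr => i _.
by rewrite coefMXn ltnNge leq_addl/= addnK.
Qed.

Lemma tsumDZ (F : nat -> R -> R) P Q c x :
  \sum_(0 <= i < size (P + c *: Q)) (P + c *: Q)`_i * F i x =
  \sum_(0 <= i < size P) P`_i * F i x + c * \sum_(0 <= i < size Q) Q`_i * F i x.
Proof.
pose n := maxn (size P) (size Q).
rewrite (tsum_widen _ (n := n)); last first.
  rewrite (leq_trans (size_polyD _ _))// geq_max leq_maxl (leq_trans (size_scale_leq _ _))//.
  exact: leq_maxr.
rewrite (@tsum_widen F P n x (leq_maxl _ _)) (@tsum_widen F Q n x (leq_maxr _ _)).
rewrite mulr_sumr -big_split/=; apply: eq_bigr => i _.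
by rewrite coefD coefZ mulrDl mulrA.
Qed.

Lemma treMXn P n x : tre (P * 'X^n) x = tre P x * cs n x - tim P x * sn n x.
Proof.
rewrite /tre /tim tsumMXn !mulr_suml -sumrB; apply: eq_bigr => i _.
by rewrite csD; ring.
Qed.

Lemma timMXn P n x : tim (P * 'X^n) x = tim P x * cs n x + tre P x * sn n x.
Proof.
rewrite /tre /tim tsumMXn !mulr_suml -big_split/=; apply: eq_bigr => i _.
by rewrite snD; ring.
Qed.

Lemma nsqMXn P n x : nsq (P * 'X^n) x = nsq P x.
Proof.
rewrite /nsq treMXn timMXn; have := cs2Dsn2 n x.
set a := tre P x; set d := tim P x; set C := cs n x; set S := sn n x => h.
by transitivity ((a ^+ 2 + d ^+ 2) * (C ^+ 2 + S ^+ 2)); [ring|rewrite h mulr1].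
Qed.

(** The product P (1 + c z^n), written as a sum so that its coefficients can be read off. *)
Definition binMX P c n := P + c *: (P * 'X^n).

Lemma nsq_binMX P c n x : nsq (binMX P c n) x = nsq P x * nf c n x.
Proof.
rewrite /nsq /tre /tim !tsumDZ -/(tre P x) -/(tim P x) -/(tre (P * 'X^n) x).
rewrite -/(tim (P * 'X^n) x) treMXn timMXn /nf; have := cs2Dsn2 n x.
set a := tre P x; set d := tim P x; set C := cs n x; set S := sn n x => h.
transitivity ((a ^+ 2 + d ^+ 2) *
  (1 + (c ^+ 2 * (C ^+ 2 + S ^+ 2) + 2 * c * C))); first by ring.
by rewrite h mulr1.
Qed.

Lemma nsq1 x : nsq 1 x = 1.
Proof.
rewrite /nsq /tre /tim size_poly1 !big_nat_recr//= !big_nil !add0r coef1/=.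
by rewrite cs0 sn0; ring.
Qed.

Lemma nsqZ P c x : nsq (c *: P) x = c ^+ 2 * nsq P x.
Proof.
have h (F : nat -> R -> R) : \sum_(0 <= i < size (c *: P)) (c *: P)`_i * F i x =
    c * \sum_(0 <= i < size P) P`_i * F i x.
  have := tsumDZ F 0 P c x; rewrite add0r size_poly0 => ->.
  by rewrite big_nil add0r.
by rewrite /nsq /tre /tim !h; ring.
Qed.

Lemma nsq_ge0 P x : 0 <= nsq P x.
Proof. by rewrite addr_ge0 ?sqr_ge0. Qed.

Lemma bm_tre P : bm (tre P).
Proof. by apply: bm_sum => i; apply: bmZ; exact: bm_cs. Qed.

Lemma bm_tim P : bm (tim P).
Proof. by apply: bm_sum => i; apply: bmZ; exact: bm_sn. Qed.

Lemma bm_nsq P : bm (nsq P).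
Proof.
rewrite (_ : nsq P = fun x => tre P x * tre P x + tim P x * tim P x).
  by apply: bmD; apply: bmM; (exact: bm_tre || exact: bm_tim).
by apply/funext => x; rewrite /nsq !expr2.
Qed.

Lemma bm_nsq_powR P s : 0 <= s -> bm (fun x => nsq P x `^ s).
Proof. by move=> s0; apply: bm_powR => //; [exact: nsq_ge0|exact: bm_nsq]. Qed.

(** The positive constant coefficient puts the shift M_k itself in the spectrum of the k-th block,
    which makes the final spectrum infinite. *)
Definition gapped (G : nat) P := [/\ forall i, 0 <= P`_i, 0 < P`_0 &
  forall i j, (i < j)%N -> P`_i != 0 -> P`_j != 0 -> (G <= j - i)%N].

Lemma gapped1 G : gapped G 1.
Proof.
split=> [i||i j ij _]; rewrite coef1.
- by rewrite ler0n.
- by rewrite ltr01.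
- by rewrite gtn_eqF ?eqxx// (leq_ltn_trans _ ij).
Qed.

Lemma gappedZ G P c : 0 < c -> gapped G P -> gapped G (c *: P).
Proof.
move=> c0 [P0 P00 gP]; split=> [i||i j ij]; rewrite ?coefZ.
- by rewrite mulr_ge0// ltW.
- exact: mulr_gt0.
- by rewrite !mulf_eq0 !negb_or => /andP[_ Pi] /andP[_ Pj]; exact: gP.
Qed.

Lemma gapped_binMX G P c n : 0 <= c -> (size P + G <= n)%N -> (0 < n)%N ->
  gapped G P -> gapped G (binMX P c n).
Proof.
move=> c0 Pn n0 [P0 P00 gP].
have coefE i : (binMX P c n)`_i = P`_i + c * (if (i < n)%N then 0 else P`_(i - n)).
  by rewrite coefD coefZ coefMXn.
have nz i : (binMX P c n)`_i != 0 ->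
    (P`_i != 0 /\ (i < size P)%N) \/ ((n <= i)%N /\ P`_(i - n) != 0).
  rewrite coefE; have [lin|nlei] := ltnP i n.
    rewrite mulr0 addr0 => Pi; left; split => //.
    by rewrite ltnNge; apply: contra Pi => Pi; rewrite nth_default.
  rewrite nth_default ?add0r; last by rewrite (leq_trans _ nlei)// (leq_trans _ Pn)// leq_addr.
  by rewrite mulf_eq0 negb_or => /andP[_ Pi]; right.
split=> [i||i j ij].
- by rewrite coefE; case: ltnP => _; rewrite ?mulr0 ?addr0// addr_ge0// mulr_ge0.
- by rewrite coefE n0 mulr0 addr0.
(* The exponents i < j lie both in P, in P and its shifted copy, in the impossible opposite order,
   or both in the copy. *)
- move=> /nz[[Pi iP]|[ni Pi]] /nz[[Pj jP]|[nj Pj]].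
  + exact: gP.
  + by lia.
  + by lia.
  + have := gP (i - n)%N (j - n)%N; rewrite ltn_sub2r//; last by rewrite (leq_ltn_trans ni).
    by move=> /(_ isT Pi Pj); lia.
Qed.

Lemma size_binMX P c n : (size (binMX P c n) <= size P + n)%N.
Proof.
rewrite (leq_trans (size_polyD _ _))// geq_max leq_addr/=.
rewrite (leq_trans (size_scale_leq _ _))// (leq_trans (size_polyMleq _ _))//.
by rewrite size_polyXn addnS.
Qed.

(** With psi1 the indicator of a complement and psi2 a small multiple of that of the set, this says
    that |P|^(2 s) concentrates on the set. As a relation between weights it is proved backwards:
    each step trades a factor on the weights for a factor of P, until P = 1 suffices. *)
Definition outweighed s psi1 psi2 := forall G, exists2 P, gapped G P &
  Int (fun x => psi1 x * nsq P x `^ s) < Int (fun x => psi2 x * nsq P x `^ s).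

Lemma outweighed_base s psi1 psi2 : Int psi1 < Int psi2 -> outweighed s psi1 psi2.
Proof.
move=> lt12 G; exists 1; first exact: gapped1.
have h psi : Int (fun x => psi x * nsq 1 x `^ s) = Int psi.
  by apply: eq_Int => x _; rewrite nsq1 powR1 mulr1.
by rewrite !h.
Qed.

Lemma outweighed_eq s psi1 psi2 psi1' psi2' : (forall x, psi1 x = psi1' x) ->
  (forall x, psi2 x = psi2' x) -> outweighed s psi1 psi2 -> outweighed s psi1' psi2'.
Proof. by move=> /funext-> /funext->. Qed.

Lemma outweighed_mono s psi1 psi2 psi1' psi2' : 0 <= s ->
  bm psi1 -> bm psi2 -> bm psi1' -> bm psi2' ->
  (forall x, psi1 x <= psi1' x) -> (forall x, psi2' x <= psi2 x) ->
  outweighed s psi1' psi2' -> outweighed s psi1 psi2.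
Proof.
move=> s0 b1 b2 b1' b2' h1 h2 a G; have [P gP lt12] := a G; exists P => //.
have bP := bm_nsq_powR P s0.
have := @le_Int R (fun x => psi1 x * nsq P x `^ s) (fun x => psi1' x * nsq P x `^ s).
move=> /(_ (bmM b1 bP) (bmM b1' bP)) l1.
have := @le_Int R (fun x => psi2' x * nsq P x `^ s) (fun x => psi2 x * nsq P x `^ s).
move=> /(_ (bmM b2' bP) (bmM b2 bP)) l2.
apply: le_lt_trans (lt_le_trans lt12 _); [apply: l1|apply: l2] => x _;
  by rewrite ler_wpM2r ?powR_ge0.
Qed.

(** Turns a lower factor 1 + y into an exponential, so that iterated factors just add exponents. It
    follows from exp(-z) <= 1 / (1 + z) and (1 + y) (1 - y + 2 y^2) = 1 + y^2 (1 + 2 y). *)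
Lemma expR_sub_sqr_le (y : R) : `|y| <= 2^-1 -> expR (y - 2 * y ^+ 2) <= 1 + y.
Proof.
rewrite -(div1r 2) ler_norml => /andP[y1 y2].
have z0 : 0 < 1 - y + 2 * y ^+ 2 by nra.
rewrite -[leLHS]invrK -expRN.
apply: (@le_trans _ _ (1 - y + 2 * y ^+ 2)^-1).
  rewrite lef_pV2 ?posrE ?expR_gt0//.
  by apply: le_trans (expR_ge1Dx _); lra.
by rewrite -[leLHS]mul1r ler_pdivrMr//; nra.
Qed.

End GappedPolynomials.

(** * One concentration step and its iteration *)

Section Concentration.
Context {R : realType}.
Implicit Types (P : {poly R}) (s b c x : R) (psi h : R -> R).

(* The factor (1 + e0 z^N)(1 + b z^(m + k N)) has, for large N, the effect of
   multiplying |P|^(2 s) by a constant times 1 + (2 s b fc s k / fc s 0) cs m,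
   up to O(b^2). *)
Lemma factor_limit s b c m k h : 0 < s -> bm h ->
  Int (fun x => h x * (nf e0 N x `^ s * (c + 2 * s * b * cs (m + k * N) x)))
    @[N --> \oo] -->
  fc s 0 * Int (fun x => h x * (c + 2 * s * b * (fc s k / fc s 0) * cs m x)).
Proof.
move=> s0 bh.
have f0 : fc s 0 != 0 by rewrite gt_eqF// fc0_gt0.
pose g j x := nf e0 1 x `^ s * cs j x.
pose g' j x := nf e0 1 x `^ s * sn j x.
have bhc : bm (fun x => h x * cs m x) by apply: bmM => //; exact: bm_cs.
have bhs : bm (fun x => h x * sn m x) by apply: bmM => //; exact: bm_sn.
have [bg0 /(_ _ bh) L0] := @RL_nf_cs R s 0 s0.
have [bgk /(_ _ bhc) Lk] := @RL_nf_cs R s k s0.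
have [bgk' /(_ _ bhs) Lk'] := @RL_nf_sn R s k s0.
rewrite Int_nf_sn// mulr0 in Lk'.
have -> : fc s 0 * Int (fun x => h x * (c + 2 * s * b * (fc s k / fc s 0) * cs m x)) =
    c * (Int h * fc s 0) + (2 * s * b) * (Int (fun x => h x * cs m x) * fc s k - 0).
  transitivity (fc s 0 * (c * Int h +
      (2 * s * b * (fc s k / fc s 0)) * Int (fun x => h x * cs m x))).
    congr (_ * _); rewrite -!IntZ// -IntD; [|exact: bmZ|exact: bmZ].
    by congr Int; apply/funext => x; ring.
  by field.
(* Expand cs (m + k N) by the addition formula: cs m meets the k-th harmonic of the dilated weight
   and leaves [fc s k], while the sine part tends to 0 by [Int_nf_sn]. *)
rewrite [X in X @ _](_ : _ = fun N =>
   c * Int (fun x => h x * g 0%N (N%:R * x)) + (2 * s * b) *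
   (Int (fun x => h x * cs m x * g k (N%:R * x)) -
    Int (fun x => h x * sn m x * g' k (N%:R * x)))).
  by apply: cvgD; apply: cvgMr => //; exact: cvgB.
apply/funext => N.
have B0 : bm (fun x => h x * g 0%N (N%:R * x)) by apply: bmM => //; exact: bm_dilate.
have B1 : bm (fun x => h x * cs m x * g k (N%:R * x)).
  by apply: bmM => //; exact: bm_dilate.
have B2 : bm (fun x => h x * sn m x * g' k (N%:R * x)).
  by apply: bmM => //; exact: bm_dilate.
rewrite -IntB// -!IntZ//; last exact: bmB.
rewrite -IntD; [|exact: bmZ|by apply: bmZ; exact: bmB].
congr Int; apply/funext => x; rewrite /g /g' nf_scale mul1n cs0 mulr1.
by rewrite csD -cs_scale -sn_scale; ring.
Qed.

Lemma nf_powR_linear s : 0 < s -> exists2 C, 0 < C & forall b n x, 0 <= b <= e0 ->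
  `|nf b n x `^ s - (1 + 2 * s * b * cs n x)| <= C * b ^+ 2.
Proof.
move=> s0; have [C C0 hC] := powR_linear_error s0.
(* With t = b^2 + 2 b cs n x, t^2 is at most (3 b)^2, and s t exceeds the linear term 2 s b cs n x
   by s b^2. *)
exists (9 * C + s) => [|b n x be]; first by rewrite addr_gt0// mulr_gt0.
have t3 := nf_near1 n x be.
have t6 : `|b ^+ 2 + 2 * b * cs n x| <= 6^-1.
  have /andP[b0 be'] := be.
  rewrite (le_trans t3)//; have -> : 6^-1 = 3 * 18^-1 :> R by field.
  rewrite ler_wpM2l// (le_trans be')// /e0 lef_pV2 ?posrE// ler_nat//.
have := hC _ t6; rewrite -/(nf b n x).
have t2 : (b ^+ 2 + 2 * b * cs n x) ^+ 2 <= 9 * b ^+ 2.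
  rewrite -(real_normK (num_real (_ + _))).
  have -> : 9 * b ^+ 2 = (3 * b) ^+ 2 by ring.
  have /andP[b0 _] := be.
  by rewrite lerXn2r ?nnegrE// mulr_ge0.
move: t2; set y := (_ + _) ^+ 2; set U := _ `^ s => t2 h.
have -> : U - (1 + 2 * s * b * cs n x) =
    (U - (1 + s * (b ^+ 2 + 2 * b * cs n x))) + s * b ^+ 2 by ring.
rewrite (le_trans (ler_normD _ _))// [leRHS]mulrDl lerD//.
  by rewrite (le_trans h)// (mulrC 9) -mulrA ler_wpM2l// ltW.
by rewrite ger0_norm// mulr_ge0 ?sqr_ge0// ltW.
Qed.

Lemma exists_near2 (u v : nat -> R) (lu lv : R) (N0 : nat) :
  u @ \oo --> lu -> v @ \oo --> lv -> lu < lv ->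
  exists2 N, (N0 <= N)%N & u N < v N.
Proof.
move=> cu cv uv; have d0 : 0 < (lv - lu) / 2 by rewrite divr_gt0// subr_gt0.
have /cvgrPdist_lt/(_ _ d0)[N1 _ h1] := cu.
have /cvgrPdist_lt/(_ _ d0)[N2 _ h2] := cv.
pose N := maxn N0 (maxn N1 N2); exists N; first exact: leq_maxl.
have := h1 N; rewrite /= leq_max leq_max leqnn/= orbT => /(_ isT).
have := h2 N; rewrite /= leq_max [X in _ || X]leq_max leqnn/= !orbT => /(_ isT).
by rewrite !ltr_norml => /andP[? ?] /andP[? ?]; lra.
Qed.

(** The coefficient b of the new factor must be positive and the resulting beta has the sign of b
    [fc s k], whence the sign condition. All quadratic errors are charged to exp(C beta^2) above
    psi1 and to exp(- C beta^2) below psi2. *)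
Lemma outweighed_step_signed s k : 0 < s -> (1 < k)%N -> fc s k != 0 ->
  exists C b0, [/\ 0 < C, 0 < b0 & forall beta m psi1 psi2,
    0 < beta * fc s k -> `|beta| <= b0 ->
    bm psi1 -> bm psi2 -> (forall x, 0 <= psi1 x) -> (forall x, 0 <= psi2 x) ->
    outweighed s (fun x => psi1 x * expR (beta * cs m x + C * beta ^+ 2))
          (fun x => psi2 x * expR (beta * cs m x - C * beta ^+ 2)) ->
    outweighed s psi1 psi2].
Proof.
move=> s0 k1 kap0.
have A0 := fc0_gt0 s0; set A := fc s 0 in A0; set kap := fc s k in kap0 *.
have [C2 C20 hC2] := nf_powR_linear s0.
have e00 : 0 < e0 :> R by rewrite /e0 invr_gt0.
have nk : 0 < `|kap| by rewrite normr_gt0.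
(* Chosen so that b = beta q solves 2 s b (kap / A) = beta. *)
pose q := A / (2 * s * kap).
have q0 : q != 0 by rewrite /q mulf_neq0// ?invr_eq0 ?mulf_neq0// gt_eqF.
pose D := C2 * q ^+ 2.
have D0 : 0 < D by rewrite mulr_gt0// exprn_even_gt0.
(* The three entries ensure b <= e0, |beta| <= 1/4 and D beta^2 <= 1/4. *)
pose b0 := Num.min (e0 / `|q|) (Num.min (4^-1) (4 * (D + 1))^-1).
have b00 : 0 < b0.
  by rewrite !lt_min divr_gt0 ?normr_gt0//= invr_gt0// invr_gt0 mulr_gt0// addr_gt0.
(* For y = beta cs m x - D beta^2, y^2 <= 2 beta^2 + 2 D beta^2, so y - 2 y^2 >= beta cs m x - (5 D
   + 4) beta^2. *)
exists (5 * D + 4), b0; split=> //; first by rewrite addr_gt0// mulr_gt0.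
move=> beta m psi1 psi2 bk bb0 B1 B2 p1 p2 a G.
have [P gP lt12] := a G.
pose b := beta * q.
have b_gt0 : 0 < b.
  have -> : b = beta * kap * (A / (2 * s * kap ^+ 2)).
    by rewrite /b /q; field; rewrite kap0 gt_eqF.
  have k2 : 0 < kap ^+ 2 by rewrite exprn_even_gt0.
  by apply: mulr_gt0 => //; apply: divr_gt0 => //; apply: mulr_gt0 => //; exact: mulr_gt0.
move: bb0; rewrite !le_min => /and3P[bq b4 bD].
have be : 0 <= b <= e0.
  by rewrite ltW//= (le_trans (ler_norm _))// normrM -ler_pdivlMr ?normr_gt0.
have betaE : 2 * s * b * (kap / A) = beta.
  by rewrite /b /q; field; rewrite kap0 !gt_eqF.
have DE : C2 * b ^+ 2 = D * beta ^+ 2 by rewrite /D /b; ring.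
have beta2 : beta ^+ 2 = `|beta| ^+ 2 by rewrite real_normK ?num_real.
have Dbeta : D * beta ^+ 2 <= 1/4.
  have nb := normr_ge0 beta.
  have h1 : `|beta| * (4 * (D + 1)) <= 1.
    by rewrite -ler_pdivlMr ?mul1r// mulr_gt0// addr_gt0.
  have h2 : `|beta| <= 1 by rewrite (le_trans b4)// invf_le1// ler1n.
  by rewrite beta2; clear - nb h1 h2 D0; nra.
have b4' : `|beta| <= 1/4 by rewrite div1r.
pose H x := nsq P x `^ s.
have BH : bm H := bm_nsq_powR P (ltW s0).
have H0 x : 0 <= H x by exact: powR_ge0.
pose w1 x := 1 + C2 * b ^+ 2 + 2 * s * b * (kap / A) * cs m x.
pose w2 x := 1 - C2 * b ^+ 2 + 2 * s * b * (kap / A) * cs m x.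
have Bw1 : bm w1 by apply: bmD; [exact: bm_cst|apply: bmZ; exact: bm_cs].
have Bw2 : bm w2 by apply: bmD; [exact: bm_cst|apply: bmZ; exact: bm_cs].
have bcs x : `|beta * cs m x| <= 1/4.
  by rewrite normrM -[leRHS]mulr1 ler_pM//; exact: cs_norm.
have w1le x : w1 x <= expR (beta * cs m x + (5 * D + 4) * beta ^+ 2).
  rewrite /w1 betaE DE; apply: (@le_trans _ _ (expR (beta * cs m x + D * beta ^+ 2))).
    by apply: le_trans (expR_ge1Dx _); rewrite addrAC addrA.
  rewrite ler_expR lerD2l ler_wpM2r ?sqr_ge0//; clear - D0; lra.
have w2ge x : expR (beta * cs m x - (5 * D + 4) * beta ^+ 2) <= w2 x.
  rewrite /w2 betaE DE; set y := beta * cs m x - D * beta ^+ 2.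
  have -> : 1 - D * beta ^+ 2 + beta * cs m x = 1 + y by rewrite /y; ring.
  have Db0 : 0 <= D * beta ^+ 2 by rewrite mulr_ge0 ?sqr_ge0// ltW.
  have y2 : `|y| <= 2^-1.
    rewrite -(div1r 2) (le_trans (ler_normB _ _))// [`|D * _|]ger0_norm//.
    by have := bcs x; clear - Dbeta; lra.
  apply: le_trans (expR_sub_sqr_le y2); rewrite ler_expR.
  have c2 : (beta * cs m x) ^+ 2 <= beta ^+ 2.
    rewrite exprMn ler_piMr ?sqr_ge0// -(real_normK (num_real (cs m x))).
    by rewrite exprn_ile1// cs_norm.
  have ysq : y ^+ 2 <= 2 * beta ^+ 2 + 2 * (D * beta ^+ 2).
    rewrite /y; move: c2 Db0 Dbeta; set u := beta * cs m x; set v := D * beta ^+ 2.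
    move=> c2 v0 v1; have : 0 <= (u + v) ^+ 2 := sqr_ge0 _.
    by clear - c2 v0 v1; nra.
  by rewrite /y in ysq *; clear - ysq; lra.
have Bw h (w : R -> R) : bm h -> bm w -> bm (fun x => h x * H x * w x).
  by move=> bh bw; apply: bmM => //; exact: bmM.
have Bexp c : bm (fun x => expR (beta * cs m x + c)).
  by apply: bm_expR; apply: bmD; [apply: bmZ; exact: bm_cs|exact: bm_cst].
have lims : A * Int (fun x => psi1 x * H x * w1 x) < A * Int (fun x => psi2 x * H x * w2 x).
  rewrite ltr_pM2l//; apply: (le_lt_trans _ (lt_le_trans lt12 _)).
  - apply: le_Int; first exact: Bw.
      by apply: bmM => //; apply: bmM => //; exact: Bexp.
    by move=> x _; rewrite mulrAC ler_wpM2r// ler_wpM2l.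
  - apply: le_Int; last first.
      move=> x _; rewrite -[leRHS]mulrA [H x * _]mulrC [leRHS]mulrA.
      by apply: ler_wpM2r; [exact: powR_ge0|exact: ler_wpM2l].
    exact: Bw.
  by apply: bmM => //; apply: bmM => //; exact: Bexp.
have L1 := @factor_limit s b (1 + C2 * b ^+ 2) m k _ s0 (bmM B1 BH).
have L2 := @factor_limit s b (1 - C2 * b ^+ 2) m k _ s0 (bmM B2 BH).
(* N > size P + G opens the first gap; since k >= 2, n = m + k N >= 2 N opens the second one beyond
   P (1 + e0 z^N). *)
have [N NP ltN] := exists_near2 (size P + G).+1 L1 L2 lims.
pose n := (m + k * N)%N.
have N0 : (0 < N)%N by exact: leq_ltn_trans NP.
have k2N : (N + N <= k * N)%N by rewrite addnn -mul2n leq_mul2r k1 orbT.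
exists (binMX (binMX P e0 N) b n).
  apply: gapped_binMX; [exact: ltW| | |].
  - rewrite (leq_trans (_ : _ <= size P + N + G)%N) ?leq_add2r ?size_binMX//.
    by clear - NP k2N; rewrite /n; lia.
  - by clear - N0 k2N; rewrite /n; lia.
  - by apply: gapped_binMX => //; [exact: ltW|exact: ltnW].
have HE x : nsq (binMX (binMX P e0 N) b n) x `^ s = H x * nf e0 N x `^ s * nf b n x `^ s.
  by rewrite !nsq_binMX !powRM ?mulr_ge0 ?nf_ge0 ?nsq_ge0.
have Bn c j : bm (fun x => nf c j x `^ s) by exact: bm_nf_powR (ltW s0).
have BnP h : bm h -> bm (fun x => h x * (H x * nf e0 N x `^ s * nf b n x `^ s)).
  by move=> bh; apply: bmM => //; apply: bmM => //; exact: bmM.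
have BnQ h c : bm h -> bm (fun x => h x * H x *
    (nf e0 N x `^ s * (c + 2 * s * b * cs (m + k * N) x))).
  move=> bh; apply: bmM; first exact: bmM.
  by apply: bmM => //; apply: bmD; [exact: bm_cst|apply: bmZ; exact: bm_cs].
under [ltLHS]eq_Int do rewrite HE; under [ltRHS]eq_Int do rewrite HE.
apply: (le_lt_trans _ (lt_le_trans ltN _)).
- apply: le_Int; [exact: BnP|exact: BnQ|move=> x _].
  rewrite 2!(mulrA (psi1 x)) (mulrA (psi1 x * H x)) ler_wpM2l ?mulr_ge0 ?powR_ge0//.
  by have := hC2 b n x be; rewrite ler_norml => /andP[_]; clear; rewrite /n; lra.
- apply: le_Int; [exact: BnQ|exact: BnP|move=> x _].
  rewrite 2!(mulrA (psi2 x) _ _) (mulrA (psi2 x * H x)) ler_wpM2l ?mulr_ge0 ?powR_ge0//.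
  by have := hC2 b n x be; rewrite ler_norml => /andP[+ _]; clear; rewrite /n; lra.
Qed.

(** [fc_signs] provides a k of either sign, so the sign condition on beta disappears. *)
Lemma outweighed_step s : 0 < s -> (forall k : nat, s != k%:R) ->
  exists C b0, [/\ 0 < C, 0 < b0 & forall beta m psi1 psi2, `|beta| <= b0 ->
    bm psi1 -> bm psi2 -> (forall x, 0 <= psi1 x) -> (forall x, 0 <= psi2 x) ->
    outweighed s (fun x => psi1 x * expR (beta * cs m x + C * beta ^+ 2))
          (fun x => psi2 x * expR (beta * cs m x - C * beta ^+ 2)) ->
    outweighed s psi1 psi2].
Proof.
move=> s0 sN; have [[k1 k11 kneg] [k2 k21 kpos]] := fc_signs s0 sN.
have [C1 [b1 [C10 b10 h1]]] := outweighed_step_signed s0 k11 (negbT (lt_eqF kneg)).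
have [C2 [b2 [C20 b20 h2]]] := outweighed_step_signed s0 k21 (negbT (gt_eqF kpos)).
exists (Num.max C1 C2), (Num.min b1 b2); split; [by rewrite lt_max C10|by rewrite lt_min b10|].
move=> beta m psi1 psi2; rewrite le_min => /andP[bb1 bb2] B1 B2 p1 p2 a.
have Bexp c : bm (fun x => expR (beta * cs m x + c)).
  by apply: bm_expR; apply: bmD; [apply: bmZ; exact: bm_cs|exact: bm_cst].
(* Enlarging the constant raises the first weight and lowers the second, so the hypothesis passes to
   smaller constants. *)
have mono C : C <= Num.max C1 C2 ->
    outweighed s (fun x => psi1 x * expR (beta * cs m x + C * beta ^+ 2))
          (fun x => psi2 x * expR (beta * cs m x - C * beta ^+ 2)).
  move=> CC; move: a; apply: outweighed_mono; [exact: ltW| | | | | | ].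
  - by apply: bmM => //; exact: Bexp.
  - by apply: bmM => //; exact: Bexp.
  - by apply: bmM => //; exact: Bexp.
  - by apply: bmM => //; exact: Bexp.
  - by move=> x; rewrite ler_wpM2l// ler_expR lerD2l ler_wpM2r ?sqr_ge0.
  - by move=> x; rewrite ler_wpM2l// ler_expR lerD2l lerN2 ler_wpM2r ?sqr_ge0.
have [beta0|beta0|beta0] := ltrgtP beta 0.
- apply: (h1 beta m _ _ _ bb1 B1 B2 p1 p2 (mono C1 _)); last by rewrite le_max lexx.
  by rewrite nmulr_rgt0.
- apply: (h2 beta m _ _ _ bb2 B1 B2 p1 p2 (mono C2 _)); last by rewrite le_max lexx orbT.
  by rewrite mulr_gt0.
- apply: outweighed_eq a => x; rewrite beta0 mul0r expr0n/= mulr0.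
    by rewrite addr0 expR0 mulr1.
  by rewrite subr0 expR0 mulr1.
Qed.

Lemma outweighed_iter s C b0 beta m psi1 psi2 (j : nat) :
  (forall beta m psi1 psi2, `|beta| <= b0 ->
    bm psi1 -> bm psi2 -> (forall x, 0 <= psi1 x) -> (forall x, 0 <= psi2 x) ->
    outweighed s (fun x => psi1 x * expR (beta * cs m x + C * beta ^+ 2))
          (fun x => psi2 x * expR (beta * cs m x - C * beta ^+ 2)) ->
    outweighed s psi1 psi2) ->
  `|beta| <= b0 -> bm psi1 -> bm psi2 ->
  (forall x, 0 <= psi1 x) -> (forall x, 0 <= psi2 x) ->
  outweighed s (fun x => psi1 x * expR (j%:R * (beta * cs m x + C * beta ^+ 2)))
        (fun x => psi2 x * expR (j%:R * (beta * cs m x - C * beta ^+ 2))) ->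
  outweighed s psi1 psi2.
Proof.
move=> step bb; elim: j psi1 psi2 => [|j ih] psi1 psi2 B1 B2 p1 p2.
  by apply: outweighed_eq => x; rewrite mul0r expR0 mulr1.
have Bexp c : bm (fun x => expR (beta * cs m x + c)).
  by apply: bm_expR; apply: bmD; [apply: bmZ; exact: bm_cs|exact: bm_cst].
move=> a; apply: (step beta m _ _ bb B1 B2 p1 p2); apply: ih.
- by apply: bmM => //; exact: Bexp.
- by apply: bmM => //; exact: Bexp.
- by move=> x; rewrite mulr_ge0 ?expR_ge0.
- by move=> x; rewrite mulr_ge0 ?expR_ge0.
- by apply: outweighed_eq a => x; rewrite -mulrA -expRD -natr1 mulrDl mul1r addrC.
Qed.

(** J steps of sizes g1 / J and g2 / J at frequencies 1 and 2 build the exponential, with total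
    error C (g1^2 + g2^2) / J in the exponent, which the strict inequality absorbs for large J. *)
Lemma outweighed_expR s psi1 psi2 g1 g2 : 0 < s -> (forall k : nat, s != k%:R) ->
  bm psi1 -> bm psi2 -> (forall x, 0 <= psi1 x) -> (forall x, 0 <= psi2 x) ->
  Int (fun x => psi1 x * expR (g1 * cs 1 x + g2 * cs 2 x)) <
  Int (fun x => psi2 x * expR (g1 * cs 1 x + g2 * cs 2 x)) ->
  outweighed s psi1 psi2.
Proof.
move=> s0 sN B1 B2 p1 p2 lt12; have [C [b0 [C0 b00 step]]] := outweighed_step s0 sN.
set X := Int _ in lt12; set Y := Int _ in lt12.
have X0 : 0 <= X by apply: Int_ge0 => x _; rewrite mulr_ge0 ?expR_ge0.
(* X < Y leaves a factor exp(2 d) for the errors; any d > 0 serves when X = 0. *)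
have [d d0 hd] : exists2 d, 0 < d & expR d * X < expR (- d) * Y.
  have [X00|Xgt0] := leP X 0.
    exists 1 => //; have -> : X = 0 by apply/eqP; rewrite eq_le X00.
    by rewrite mulr0 mulr_gt0 ?expR_gt0// (le_lt_trans X0).
  have YX : 1 < Y / X by rewrite ltr_pdivlMr// mul1r.
  exists (ln (Y / X) / 4); first by rewrite divr_gt0// ln_gt0.
  rewrite expRN ltr_pdivlMl ?expR_gt0// mulrA -expRD.
  rewrite -ltr_pdivlMr// -[ltRHS]lnK ?posrE; last by rewrite (lt_trans _ YX).
  by rewrite ltr_expR; have := ln_gt0 YX; lra.
have [J [J0 Jb1 Jb2 Jd]] : exists J : nat, [/\ (0 < J)%N, `|g1 / J%:R| <= b0,
    `|g2 / J%:R| <= b0 & C * (g1 ^+ 2 + g2 ^+ 2) / J%:R <= d].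
  (* Each summand is one of the three thresholds, so J >= K meets them all. *)
  pose K := `|g1| / b0 + `|g2| / b0 + C * (g1 ^+ 2 + g2 ^+ 2) / d.
  have K1 : 0 <= `|g1| / b0 by rewrite divr_ge0// ltW.
  have K2 : 0 <= `|g2| / b0 by rewrite divr_ge0// ltW.
  have K3 : 0 <= C * (g1 ^+ 2 + g2 ^+ 2) / d.
    by rewrite divr_ge0 ?mulr_ge0 ?addr_ge0 ?sqr_ge0// ltW.
  have K0 : 0 <= K by rewrite !addr_ge0.
  exists (Num.bound K).+1; have := archi_boundP K0 => KJ.
  have JK : K <= (Num.bound K).+1%:R by rewrite -natr1; lra.
  have J0 : 0 < (Num.bound K).+1%:R :> R by rewrite ltr0n.
  have aux y z : 0 < z -> y / z <= K -> y / (Num.bound K).+1%:R <= z.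
    move=> z0 yz; rewrite ler_pdivrMr//.
    by move: (le_trans yz JK); rewrite ler_pdivrMr// mulrC.
  split => //.
  - rewrite normrM normfV normr_nat; apply: aux => //.
    by rewrite /K -addrA lerDl addr_ge0.
  - rewrite normrM normfV normr_nat; apply: aux => //.
    by rewrite /K addrAC lerDr addr_ge0.
  - by apply: aux => //; rewrite /K lerDr addr_ge0.
have J0' : J%:R != 0 :> R by rewrite pnatr_eq0 -lt0n.
have Bexp beta m c : bm (fun x => expR (J%:R * (beta * cs m x + c))).
  by apply: bm_expR; apply: bmZ; apply: bmD; [apply: bmZ; exact: bm_cs|exact: bm_cst].
apply: (outweighed_iter (m := 1) (j := J) step Jb1 B1 B2 p1 p2).
apply: (outweighed_iter (m := 2) (j := J) step Jb2).
- by apply: bmM => //; exact: Bexp.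
- by apply: bmM => //; exact: Bexp.
- by move=> x; rewrite mulr_ge0 ?expR_ge0.
- by move=> x; rewrite mulr_ge0 ?expR_ge0.
apply: outweighed_base; set dJ := C * (g1 ^+ 2 + g2 ^+ 2) / J%:R in Jd.
pose W x := expR (g1 * cs 1 x + g2 * cs 2 x).
have BW : bm W by apply: bm_expR; apply: bmD; apply: bmZ; exact: bm_cs.
have E1 x : psi1 x * expR (J%:R * (g1 / J%:R * cs 1 x + C * (g1 / J%:R) ^+ 2)) *
   expR (J%:R * (g2 / J%:R * cs 2 x + C * (g2 / J%:R) ^+ 2)) = expR dJ * (psi1 x * W x).
  rewrite -mulrA -expRD [RHS]mulrCA -expRD; congr (_ * expR _).
  by rewrite /dJ; field.
have E2 x : psi2 x * expR (J%:R * (g1 / J%:R * cs 1 x - C * (g1 / J%:R) ^+ 2)) *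
   expR (J%:R * (g2 / J%:R * cs 2 x - C * (g2 / J%:R) ^+ 2)) = expR (- dJ) * (psi2 x * W x).
  rewrite -mulrA -expRD [RHS]mulrCA -expRD; congr (_ * expR _).
  by rewrite /dJ; field.
under [ltLHS]eq_Int do rewrite E1; under [ltRHS]eq_Int do rewrite E2.
rewrite !IntZ; [|exact: bmM|exact: bmM].
apply: (le_lt_trans _ (lt_le_trans hd _)).
  by rewrite ler_wpM2r// ler_expR.
by rewrite ler_wpM2r ?ler_expR ?lerN2// (le_trans X0)// ltW.
Qed.

End Concentration.

(** * The reflection x -> 1 - x and Lebesgue measure *)

Section Reflection.
Context {R : realType}.
Implicit Types (h : R -> R) (A B : set R) (x : R).
Local Notation mu := (@lebesgue_measure R).

Definition refl01 (x : R) : R := 1 - x.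

Lemma measurable_refl01 : measurable_fun setT refl01.
Proof. exact: measurable_funB. Qed.

Lemma mu_refl01 A : measurable A -> mu (refl01 @^-1` A) = mu A.
Proof.
move=> mA; rewrite -[LHS]/(pushforward mu (refl01 : _ -> measurableTypeR R) A).
apply/esym/lebesgue_measure_unique => //=; first exact: measurable_refl01.
move=> _ _ [[a b]] _ <-.
rewrite /pushforward.
have -> : refl01 @^-1` `]a, b]%classic = `[1 - b, 1 - a[%classic.
  by apply/seteqP; split => x /=; rewrite !in_itv/= /refl01 => /andP[? ?];
    apply/andP; split; lra.
rewrite !lebesgue_measure_itv/= !lte_fin ltrD2l ltrN2; case: ifPn => // _.
by rewrite -!EFinD; congr EFin; ring.
Qed.

Lemma refl01_unitI : refl01 @^-1` unitI = unitI.
Proof.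
by apply/seteqP; split => x /=; rewrite /unitI/= !in_itv/= /refl01 => /andP[? ?];
  apply/andP; split; lra.
Qed.

Lemma Int_refl01 h : bm h -> Int (fun x => h (1 - x)) = Int h.
Proof.
move=> bh; have [mh _] := bh.
rewrite /Int /Rintegral; congr fine.
transitivity (\int[pushforward mu (refl01 : _ -> measurableTypeR R)]_(x in unitI)
    (h x)%:E)%E.
  rewrite integral_pushforward//=.
  - by rewrite refl01_unitI.
  - exact: measurable_refl01.
  - exact/measurable_EFinP.
  - rewrite refl01_unitI; apply: (@bm_integrableI _ (fun x => h (1 - x))).
    split; last by case: bh => _ [M hM]; exists M.
    exact: (measurableT_comp mh measurable_refl01).
  - exact: measurable_unitI.
apply: eq_measure_integral => //=; first exact: measurable_refl01.
by move=> _ A mA _; exact: mu_refl01.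
Qed.

Lemma Int_indic A : measurable A -> A `<=` unitI -> Int (\1_A) = fine (mu A).
Proof.
move=> mA AI; rewrite /Int /Rintegral integral_indic//; last exact: measurable_unitI.
by rewrite setIidl.
Qed.

Lemma mu_fin A : measurable A -> A `<=` unitI -> mu A \is a fin_num.
Proof.
move=> mA AI; rewrite ge0_fin_numE ?measure_ge0//.
apply: (@le_lt_trans _ _ (mu unitI)); last by rewrite mu_unitI ltry.
by apply: le_measure; rewrite ?inE//; exact: measurable_unitI.
Qed.

End Reflection.

(** * Separation by cos(2 pi x) and the Cauchy kernel *)

Section Peak.
Context {R : realType}.
Implicit Types (h : R -> R) (A B : set R) (x y r c : R).
Local Notation mu := (@lebesgue_measure R).

(** On [0, 1], the symmetry x -> -x of the circle reads x -> 1 - x. *)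
Definition symset B := [/\ measurable B, B `<=` unitI,
  (forall x, B x -> B (1 - x)) & (0 < mu B)%E].

Lemma cs_refl n x : cs n (1 - x) = cs n x.
Proof.
have [c1 s1] := @cs_at1 R n; rewrite /cs /sn mulr1 in c1 s1.
by rewrite /cs mulrBr mulr1 cosB c1 s1 mul1r mul0r addr0.
Qed.

Lemma cs1_MVT x y : exists2 z, `|z - y| <= `|x - y| &
  cs 1 x - cs 1 y = - (2 * pi) * sn 1 z * (x - y).
Proof.
have cc (a b : R) : {within `[a, b], continuous (@cs R 1)}.
  by apply: continuous_subspaceT; exact: continuous_cs.
have dc (z : R) : is_derive z 1 (@cs R 1) (- (2 * pi) * sn 1 z).
  by have := is_derive_cs 1 z; rewrite mulr1.
have [xy|xy] := leP y x.
  have [z] := MVT_segment xy (fun z _ => dc z) (cc y x).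
  rewrite in_itv/= => /andP[z1 z2] ->; exists z => //.
  by rewrite !ger0_norm ?subr_ge0// lerB.
have [z] := MVT_segment (ltW xy) (fun z _ => dc z) (cc x y).
rewrite in_itv/= => /andP[z1 z2] E; exists z; last by rewrite -opprB E; ring.
by rewrite !ler0_norm ?subr_le0 ?(ltW xy)// lerN2 lerB.
Qed.

Lemma cs1_lipschitz x y : `|cs 1 x - cs 1 y| <= 2 * pi * `|x - y|.
Proof.
have [z _ ->] := cs1_MVT x y; have pi0 := @pi_gt0 R.
have pi20 : 0 <= 2 * pi :> R by rewrite mulr_ge0// ltW.
rewrite normrM ler_wpM2r// normrM normrN [`|2 * pi|]ger0_norm//.
by apply: ler_piMr => //; exact: sn_norm.
Qed.

(** Near y the derivative of the cosine stays away from 0; farther away, monotonicity on [0, 1/2]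
    keeps the distance at least that reached at y - d or y + d. *)
Lemma cs1_dist_ge y : 0 < y < 1/2 -> exists2 c : R, 0 < c &
  forall x, 0 <= x <= 1/2 -> c * `|x - y| <= `|cs 1 x - cs 1 y|.
Proof.
move=> /andP[y0 y2]; have pi0 := @pi_gt0 R.
have s0 : 0 < sn 1 y by rewrite /sn mulr1 sin_gt0_pi//; apply/andP; split; nra.
have [d d0 hd] : exists2 d : R, 0 < d & forall x, `|x - y| <= d -> sn 1 y / 2 <= sn 1 x.
  have e0' : 0 < sn 1 y / 2 by rewrite divr_gt0.
  have /cvgrPdist_le/(_ _ e0') := @continuous_sn R 1 y.
  move=> /nbhs_ballP[d /= d0 hd]; exists (d / 2); first by rewrite divr_gt0.
  move=> x xd; have : ball y d x.
    by rewrite /ball/= distrC (le_lt_trans xd)// ltr_pdivrMr// ltr_pMr// ltr1n.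
  by move=> /hd; rewrite ler_norml => /andP[_]; lra.
pose k := pi * sn 1 y.
have k0 : 0 < k by rewrite mulr_gt0.
have near x : `|x - y| <= d -> k * `|x - y| <= `|cs 1 x - cs 1 y|.
  move=> xd.
  have [z /le_trans/(_ xd) zd ->] := cs1_MVT x y.
  have pi20 : 0 <= 2 * pi :> R by rewrite mulr_ge0// ltW.
  rewrite normrM ler_wpM2r// normrM normrN [`|2 * pi|]ger0_norm//.
  apply: le_trans (ler_wpM2l pi20 (ler_norm _)).
  by have := hd z zd; rewrite /k; clear - pi0; nra.
have mono (a b : R) : 0 <= a -> a <= b -> b <= 1/2 -> cs 1 b <= cs 1 a.
  move=> a0 ab b2.
  have range (z : R) : 0 <= z -> z <= 1/2 -> 0 <= 2 * pi * z <= pi.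
    move=> z0 z2; apply/andP; split.
      by rewrite !mulr_ge0// ltW.
    rewrite mulrAC -[leRHS]mul1r.
    by apply: ler_wpM2r; [exact: ltW|clear - z2; lra].
  rewrite /cs !mulr1 leNgt ltr_cos ?in_itv/= ?range//.
  - by rewrite -leNgt ler_pM2l// mulr_gt0.
  - exact: le_trans a0 ab.
  - exact: le_trans ab b2.
(* Near y the factor k suffices; farther away the bound is k d, and |x - y| <= 1. *)
exists (k * Num.min 1 d); first by rewrite mulr_gt0// lt_min ltr01.
move=> x /andP[x0 x2].
have m1 : Num.min 1 d <= 1 by rewrite ge_min lexx.
have m2 : Num.min 1 d <= d by rewrite ge_min lexx orbT.
have m0 : 0 < Num.min 1 d by rewrite lt_min ltr01.
have [xd|dx] := leP (`|x - y|) d.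
  rewrite (le_trans _ (near x xd))// ler_wpM2r// ler_piMr// ltW//.
have xy1 : `|x - y| <= 1 by rewrite ler_norml; apply/andP; split; lra.
apply: (@le_trans _ _ (k * d)).
  rewrite -mulrA ler_pM2l// (le_trans (_ : _ <= Num.min 1 d))//.
  by rewrite ler_piMr// ltW.
have dd (z : R) : `|z - y| = d -> k * d <= `|cs 1 z - cs 1 y|.
  by move=> zd; have := near z; rewrite zd lexx => /(_ isT).
have [xy|xy] := leP y x.
  rewrite ger0_norm ?subr_ge0// in dx.
  have := dd (y + d); rewrite addrAC subrr add0r ger0_norm ?(ltW d0)// => /(_ erefl).
  have c1 : cs 1 (y + d) <= cs 1 y by apply: mono; lra.
  have c2 : cs 1 x <= cs 1 (y + d) by apply: mono; lra.
  by rewrite !ler0_norm ?subr_le0//; [lra|exact: le_trans c1].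
rewrite ltr0_norm ?subr_lt0// in dx.
have := dd (y - d); rewrite addrAC subrr add0r normrN ger0_norm ?(ltW d0)// => /(_ erefl).
have c1 : cs 1 y <= cs 1 (y - d) by apply: mono; lra.
have c2 : cs 1 (y - d) <= cs 1 x by apply: mono; lra.
by rewrite !ger0_norm ?subr_ge0//; [lra|exact: le_trans c2].
Qed.

Lemma continuous_cauchy a r : 0 < r -> continuous (fun x => (r ^+ 2 + (x - a) ^+ 2)^-1).
Proof.
move=> r0; under eq_fun do rewrite [X in _ + X]expr2.
move=> x; apply: cvgV; first by rewrite gt_eqF// ltr_pwDl -?expr2 ?sqr_ge0// exprn_gt0.
apply: cvgD; first exact: cvg_cst.
by apply: cvgM; apply: cvgB; [exact: cvg_id|exact: cvg_cst|exact: cvg_id|exact: cvg_cst].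
Qed.

Lemma bm_cauchy a r : 0 < r -> bm (fun x => (r ^+ 2 + (x - a) ^+ 2)^-1).
Proof.
move=> r0; apply: (bm_continuous (M := r ^- 2)); first exact: continuous_cauchy.
have r2 : 0 < r ^+ 2 by rewrite exprn_gt0.
move=> x; have h : 0 < r ^+ 2 + (x - a) ^+ 2 by rewrite ltr_pwDl ?sqr_ge0.
by rewrite ger0_norm ?invr_ge0 ?(ltW h)// lef_pV2 ?posrE// lerDl sqr_ge0.
Qed.

(** The antiderivative atan((x - a) / r) / r increases by less than pi / r. This kernel will
    dominate the Gaussian tail. *)
Lemma Int_cauchy_le a r : 0 < r -> Int (fun x => (r ^+ 2 + (x - a) ^+ 2)^-1) <= pi / r.
Proof.
move=> r0.
have dF x : is_derive x 1 (fun y => r^-1 * atan (r^-1 * (y - a))) (r ^+ 2 + (x - a) ^+ 2)^-1.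
  have dl : is_derive x 1 (fun y => r^-1 * (y - a)) r^-1.
    by apply: is_derive_eq; rewrite /GRing.scale/= subr0 mulr1.
  have da : is_derive x 1 (atan \o (fun y => r^-1 * (y - a)))
      (r^-1 * (1 + (r^-1 * (x - a)) ^+ 2)^-1).
    by apply: is_derive_eq; rewrite /GRing.scale/=; ring.
  rewrite (_ : (fun y => _) = r^-1 \*: (atan \o (fun y => r^-1 * (y - a))))//.
  apply: is_derive_eq; rewrite /GRing.scale/=.
  have : 0 < 1 + (r^-1 * (x - a)) ^+ 2 by rewrite ltr_pwDl ?sqr_ge0.
  have : 0 < r ^+ 2 + (x - a) ^+ 2 by rewrite ltr_pwDl ?sqr_ge0// exprn_gt0.
  by move=> /gt_eqF h1 /gt_eqF h2; field; rewrite ?h1 ?h2 gt_eqF.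
have cf := @continuous_cauchy a r r0.
rewrite (Int_derive dF cf) -mulrBr mulrC ler_wpM2r ?invr_ge0 ?ltW//.
have := atan_ltpi2 (r^-1 * (1 - a)); have := atan_gtNpi2 (r^-1 * (0 - a)).
by rewrite !ltr_pdivlMr ?ltr_pdivrMr//; lra.
Qed.

End Peak.

(** * Density points and the Gaussian peak at y and 1 - y *)

Section PeakLemma.
Context {R : realType}.
Implicit Types (h : R -> R) (A B : set R) (x y r c : R).
Local Notation mu := (@lebesgue_measure R).

Lemma indic_refl (B : set R) x : (forall x, B x -> B (1 - x)) -> \1_B (1 - x) = \1_B x :> R.
Proof.
move=> Br; rewrite !indicE; congr (nat_of_bool _)%:R; apply/idP/idP; rewrite !inE.
  by move=> /Br; rewrite opprB addrC subrK.
exact: Br.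
Qed.

Lemma symset_setC B : symset B -> forall x, (~` B) x -> (~` B) (1 - x).
Proof.
by move=> [_ _ Br _] x nB /Br; rewrite opprB addrC subrK.
Qed.

Lemma Int_indic_ball y r : 0 < r -> r <= y -> y + r <= 1 -> Int (\1_(ball y r)) = 2 * r.
Proof.
move=> r0 ry yr; rewrite Int_indic; first by rewrite lebesgue_measure_ball ?(ltW r0)//= mulr_natl.
  exact: measurable_ball.
move=> x; rewrite ball_itv /unitI/= !in_itv/= => /andP[x1 x2].
by apply/andP; split; lra.
Qed.

(** Almost every point of B is a density point. The null set 0, 1/2, 1 is avoided because cos(2 pi
    x) has derivative 0 there. *)
Lemma density_point B : symset B -> exists2 x0 : R, 0 < x0 < 1 /\ x0 != 1/2 &
  forall eta d : R, 0 < eta -> 0 < d -> exists2 r : R, 0 < r <= d &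
    Int (fun x => \1_(~` B) x * \1_(ball x0 r) x) <= eta * r.
Proof.
move=> [mB BI Br muB].
have [N [mN N0 hN]] := lebesgue_density mB.
have [x0 [Bx0 Nx0 nx]] : exists x0, [/\ B x0, ~ N x0 & [/\ x0 != 0, x0 != 1 & x0 != 1/2]].
  apply: contrapT => /forallNP h.
  have sub : B `<=` N `|` ([set 0] `|` ([set 1] `|` [set 1/2])).
    move=> x Bx; have [Nx|Nx] := pselect (N x); [by left|right].
    have := h x => hx; apply: contrapT => h3; apply: hx; split => //.
    by split; apply/eqP => E; apply: h3; [left|right; left|right; right].
  suff : mu B = 0%E by move=> E; move: muB; rewrite E ltxx.
  apply/negligibleP => //; apply: (@negligibleS _ _ _ mu _ _ sub).
  have ng (a : R) : mu.-negligible [set a].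
    by apply/negligibleP => //; exact: lebesgue_measure_set1.
  apply: negligibleU; first by apply/negligibleP.
  by apply: negligibleU => //; exact: negligibleU.
have [x00 x01] : 0 <= x0 /\ x0 <= 1.
  by have := BI _ Bx0; rewrite /unitI/= in_itv/= => /andP.
case: nx => nx0 nx1 nx2; exists x0.
  by split => //; rewrite !lt_neqAle eq_sym nx0 nx1 x00.
move=> eta d eta0 d0.
have dens : (mu (B `&` ball x0 r) * (mu (ball x0 r))^-1)%E @[r --> 0^'+] --> (1%:E : \bar R).
  have := contrapT (fun nd => Nx0 (hN x0 nd)).
  by rewrite /= indicE mem_set.
(* The ball has measure 2 r, so a density above 1 - eta / 2 leaves less than eta r outside B. *)
have nb : nbhs (1%:E : \bar R) [set u | (1 - eta / 2)%:E < u]%E.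
  apply: open_nbhs_nbhs; split; first exact: open_ereal_gt_ereal.
  by rewrite /= lte_fin gtrBl divr_gt0.
have near1 : \forall r \near 0^'+,
    ((1 - eta / 2)%:E < mu (B `&` ball x0 r) * (mu (ball x0 r))^-1)%E.
  exact: (dens _ nb).
have near2 : \forall r \near 0^'+, 0 < r <= d.
  near=> r; apply/andP; split; near: r; first exact: nbhs_right_gt.
  by apply: nbhs_right_le.
have [r [hr /andP[r0 rd]]] : exists r, ((1 - eta / 2)%:E <
    mu (B `&` ball x0 r) * (mu (ball x0 r))^-1)%E /\ 0 < r <= d.
  exact: (@filter_ex _ (0^'+) _ _ (filterI near1 near2)).
exists r; first by rewrite r0.
have mb : measurable (ball x0 r) := measurable_ball x0 r.
have mBb : measurable (B `&` ball x0 r) by exact: measurableI.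
have fB : mu (B `&` ball x0 r) \is a fin_num.
  by apply: mu_fin => // x [/BI].
move: hr; rewrite lebesgue_measure_ball ?(ltW r0)// -(fineK fB) inver.
rewrite mulrn_eq0/= gt_eqF// -EFinM lte_fin ltr_pdivlMr ?mulrn_wgt0//.
set b := fine _ => hr.
have EB : Int (fun x => \1_(~` B) x * \1_(ball x0 r) x) = Int (\1_((~` B `&` ball x0 r) `&` unitI)).
  apply: eq_Int => x Ix; rewrite !indicE !in_setI (mem_set Ix) andbT.
  by rewrite -natrM mulnb.
have mC : measurable (~` B `&` ball x0 r) by apply: measurableI => //; exact: measurableC.
rewrite EB Int_indic; [|apply: measurableI => //; exact: measurable_unitI|by move=> x []].
have le1 : (mu ((~` B `&` ball x0 r) `&` unitI) <= mu (~` B `&` ball x0 r))%E.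
  apply: le_measure; rewrite ?inE//; apply: measurableI => //; exact: measurable_unitI.
have E2 : (mu (ball x0 r) = mu (B `&` ball x0 r) + mu (~` B `&` ball x0 r))%E.
  rewrite -measureU//; last by rewrite setIACA setICr set0I.
  by rewrite -setIUl setUCr setTI.
have fC : mu (~` B `&` ball x0 r) \is a fin_num.
  rewrite ge0_fin_numE ?measure_ge0//; apply: (@le_lt_trans _ _ (mu (ball x0 r))).
    by apply: le_measure; rewrite ?inE// => x [].
  by rewrite lebesgue_measure_ball ?(ltW r0)// ltry.
move: E2; rewrite lebesgue_measure_ball ?(ltW r0)// -(fineK fB) -(fineK fC) -EFinD => -[E2].
apply: (@le_trans _ _ (fine (mu (~` B `&` ball x0 r)))).
  rewrite fine_le//; apply: mu_fin; last by move=> x [].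
  by apply: measurableI => //; exact: measurable_unitI.
by move: E2 hr; rewrite -/b -mulr_natl; clear; lra.
Unshelve. all: by end_near. Qed.

Lemma sym_density_point B : symset B -> exists2 y : R, 0 < y < 1/2 &
  forall eta d : R, 0 < eta -> 0 < d -> exists2 r : R, 0 < r <= d &
    Int (fun x => \1_(~` B) x * \1_(ball y r) x) <= eta * r /\
    Int (fun x => \1_(~` B) x * \1_(ball (1 - y) r) x) <= eta * r.
Proof.
move=> sB; have [x0 [/andP[x00 x01] nx2] hx0] := density_point sB.
have [mB _ _ _] := sB; have mBc := measurableC mB.
have swap (z r : R) : Int (fun x => \1_(~` B) x * \1_(ball (1 - z) r) x) =
    Int (fun x => \1_(~` B) x * \1_(ball z r) x).
  rewrite -Int_refl01; last by apply: bmM; apply: bm_indic => //; exact: measurable_ball.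
  apply: eq_Int => x _; rewrite (indic_refl _ (symset_setC sB)); congr (_ * _).
  rewrite !indicE; congr (nat_of_bool _)%:R; have E : 1 - z - (1 - x) = - (z - x) by ring.
  by apply/idP/idP; rewrite !inE /ball/= E normrN.
have [x2|x2] := leP x0 (1/2).
  exists x0; first by rewrite x00 lt_neqAle nx2.
  by move=> eta d e0' d0; have [r rd hr] := hx0 _ _ e0' d0; exists r; [exact: rd|rewrite swap; split; exact: hr].
exists (1 - x0); first by apply/andP; split; lra.
move=> eta d e0' d0; have [r rd hr] := hx0 _ _ e0' d0.
by exists r; [exact: rd|rewrite !swap; split; exact: hr].
Qed.

Lemma expRN_le_inv (t : R) : 0 < t -> expR (- t) <= t^-1.
Proof.
move=> t0; rewrite expRN lef_pV2 ?posrE ?expR_gt0//.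
by rewrite (le_trans _ (expR_ge1Dx _))// lerDr.
Qed.

(* exp(-L (cos 2 pi x - cos 2 pi y)^2) is, up to a constant factor, of the form
   exp(g1 cos 2 pi x + g2 cos 4 pi x) and peaks exactly at the points y, 1 - y. *)
Lemma peak B (eta : R) : symset B -> 0 < eta -> exists g1 g2 : R,
  Int (fun x => \1_(~` B) x * expR (g1 * cs 1 x + g2 * cs 2 x)) <
  Int (fun x => (eta * \1_B x) * expR (g1 * cs 1 x + g2 * cs 2 x)).
Proof.
move=> sB eta0; have [y /andP[y0 y2] hy] := sym_density_point sB.
have [mB BI Br muB] := sB; have mBc := measurableC mB.
have yy : 0 < y < 1/2 by rewrite y0.
have [c c0 hc] := cs1_dist_ge yy.
have pi0 : 0 < pi :> R := pi_gt0 R.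
(* Lower bound of W within r / T of y, where L (2 pi r / T)^2 = (2 pi)^2. *)
pose w : R := expR (- (2 * pi) ^+ 2).
have w0 : 0 < w := expR_gt0 _.
(* In units of r / T^2: the defects of two balls give 2, and two Cauchy tails, K pi / r each, give 4
   pi / c^2. *)
pose M : R := 2 + 4 * pi / c ^+ 2.
have M0 : 0 < M by rewrite addr_gt0// divr_gt0 ?mulr_gt0// exprn_gt0.
(* The mass of W is at most r M / T^2 off B and at least r w / T on B, so T must exceed M / (eta
   w). *)
pose T : R := M / (eta * w) + 1.
have T1 : 1 <= T by rewrite lerDr divr_ge0 ?mulr_ge0 ?ltW.
have T0 : 0 < T by exact: lt_le_trans T1.
have MT : M < eta * w * T.
  by rewrite -ltr_pdivrMl ?mulr_gt0// mulrC ltrDl.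
have d0 : 0 < Num.min y (1/2 - y) by rewrite lt_min y0 subr_gt0.
(* A defect of r / T^2 in the ball of radius r is small even against the inner ball of radius r / T,
   where W is bounded below. *)
have T2 : 0 < T ^- 2 by rewrite invr_gt0 exprn_gt0.
have [r /andP[r0 rd] [h1 h2]] := hy _ _ T2 d0.
have [ry ry2] : r <= y /\ r <= 1/2 - y by move: rd; rewrite le_min => /andP.
pose L : R := (T / r) ^+ 2; pose W x := expR (- (L * (cs 1 x - cs 1 y) ^+ 2)).
have L0 : 0 < L by rewrite exprn_gt0// divr_gt0.
have bW : bm W.
  apply: bm_expR; apply: bmN; apply: bmZ.
  under eq_fun do rewrite expr2.
  by apply: bmM; (apply: bmB; [exact: bm_cs|exact: bm_cst]).
have W1 x : W x <= 1 by rewrite -expR0 ler_expR oppr_le0 mulr_ge0 ?sqr_ge0// ltW.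
pose K : R := 2 * r ^+ 2 / (T ^+ 2 * c ^+ 2).
have K0 : 0 < K by rewrite divr_gt0// mulr_gt0// ?exprn_gt0.
pose Q (a x : R) : R := (r ^+ 2 + (x - a) ^+ 2)^-1.
have bQ a : bm (Q a) := bm_cauchy a r0.
have Q0 a x : 0 <= Q a x by rewrite invr_ge0 addr_ge0 ?sqr_ge0.
(* exp(-t) <= 1 / t, and 1 / u^2 <= 2 / (r^2 + u^2) for u >= r, turn the Gaussian into a Cauchy
   kernel. *)
have tail x : 0 <= x <= 1/2 -> r <= `|x - y| -> W x <= K * Q y x.
  move=> x01 rx; have := hc x x01; set u := `|x - y| in rx *.
  have u0 : 0 < u by exact: lt_le_trans rx.
  move=> cu.
  have t0 : 0 < (T / r) ^+ 2 * (c * u) ^+ 2 by rewrite mulr_gt0// exprn_gt0// mulr_gt0.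
  apply: (@le_trans _ _ (expR (- ((T / r) ^+ 2 * (c * u) ^+ 2)))).
    rewrite ler_expR lerN2 ler_wpM2l ?(ltW L0)// -[leRHS]real_normK ?num_real//.
    by rewrite lerXn2r ?nnegrE ?mulr_ge0 ?(ltW c0) ?(ltW u0).
  apply: (le_trans (expRN_le_inv t0)).
  have -> : K * Q y x = (T / r) ^- 2 * (c ^- 2 * (2 / (r ^+ 2 + u ^+ 2))).
    rewrite /K /Q /u real_normK ?num_real//.
    have : 0 < r ^+ 2 + (x - y) ^+ 2 by rewrite ltr_pwDl ?sqr_ge0// exprn_gt0.
    by move=> /gt_eqF hq; field; rewrite ?hq !gt_eqF.
  rewrite invfM ler_pM2l ?invr_gt0 ?exprn_gt0 ?divr_gt0// exprMn invfM.
  rewrite ler_pM2l ?invr_gt0 ?exprn_gt0//.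
  have u2 : 0 < u ^+ 2 by rewrite exprn_gt0.
  have r2 : r ^+ 2 <= u ^+ 2 by rewrite lerXn2r ?nnegrE ?(ltW r0) ?(ltW u0).
  have r20 : 0 < r ^+ 2 by rewrite exprn_gt0.
  rewrite ler_pdivlMr ?addr_gt0// mulrC ler_pdivrMr//.
  by clear - u2 r2; lra.
have bB : bm (\1_B : R -> R) := bm_indic mB.
have bBc : bm (\1_(~` B) : R -> R) := bm_indic mBc.
have bball (a b : R) : bm (\1_(ball a b) : R -> R) by apply: bm_indic; exact: measurable_ball.
have i01 (A : set R) x : 0 <= (\1_A x : R) <= 1.
  by rewrite indicE; case: (_ \in _); rewrite /= ?lexx ?ler01.
have upper : Int (fun x => \1_(~` B) x * W x) <= r * T ^- 2 * M.
  have b1 : bm (fun x => \1_(~` B) x * \1_(ball y r) x) by exact: bmM.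
  have b2 : bm (fun x => \1_(~` B) x * \1_(ball (1 - y) r) x) by exact: bmM.
  have b3 : bm (fun x => K * Q y x + K * Q (1 - y) x) by apply: bmD; exact: bmZ.
  have step : Int (fun x => \1_(~` B) x * W x) <=
      Int (fun x => (\1_(~` B) x * \1_(ball y r) x +
        \1_(~` B) x * \1_(ball (1 - y) r) x) + (K * Q y x + K * Q (1 - y) x)).
    apply: le_Int; [exact: bmM|by apply: bmD => //; exact: bmD|].
    move=> x Ix; have /andP[i0 i1] := i01 (~` B) x.
    have W0 : 0 <= W x := expR_ge0 _.
    have iW : \1_(~` B) x * W x <= \1_(~` B) x by rewrite ler_piMr.
    have iW' : \1_(~` B) x * W x <= W x by rewrite ler_piMl.
    have q1 : 0 <= K * Q y x by rewrite mulr_ge0// ltW.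
    have q2 : 0 <= K * Q (1 - y) x by rewrite mulr_ge0// ltW.
    have p1 : 0 <= \1_(~` B) x * \1_(ball y r) x :> R.
      by apply: mulr_ge0 => //; case/andP: (i01 (ball y r) x).
    have p2 : 0 <= \1_(~` B) x * \1_(ball (1 - y) r) x :> R.
      by apply: mulr_ge0 => //; case/andP: (i01 (ball (1 - y) r) x).
    have [xb|xb] := boolP (x \in (ball y r : set R)).
      rewrite [X in _ * X + _](_ : _ = 1); last by rewrite indicE xb.
      by rewrite mulr1; clear - iW q1 q2 p2; lra.
    have [xb'|xb'] := boolP (x \in (ball (1 - y) r : set R)).
      rewrite [X in _ + _ * X + _](_ : _ = 1); last by rewrite indicE xb'.
      by rewrite mulr1; clear - iW q1 q2 p1; lra.
    have ryx : r <= `|x - y|.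
      by move: xb; rewrite notin_setE /ball/= distrC => /negP; rewrite -leNgt.
    have ryx' : r <= `|1 - x - y|.
      move: xb'; rewrite notin_setE /ball/= => /negP; rewrite -leNgt.
      by rewrite addrAC.
    move: Ix; rewrite /unitI/= in_itv/= => /andP[x0 x1].
    have [x2|x2] := leP x (1/2).
      have := tail x; rewrite x0 x2 => /(_ isT ryx) hW.
      by clear - iW' hW q1 q2 p1 p2; lra.
    (* W is invariant under x -> 1 - x, so the right half is handled by reflection, with the kernel
       centred at 1 - y. *)
    have := tail (1 - x); have -> : 0 <= 1 - x <= 1/2 by apply/andP; split; clear - x1 x2; lra.
    move=> /(_ isT ryx'); rewrite /W cs_refl -/(W x) => hW.
    have QE : Q y (1 - x) = Q (1 - y) x by rewrite /Q; congr (_^-1); ring.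
    by rewrite QE in hW; clear - iW' hW q1 q2 p1 p2; lra.
  apply: (le_trans step); rewrite IntD//; last exact: bmD.
  rewrite IntD// IntD; [|exact: bmZ|exact: bmZ]; rewrite !IntZ//.
  have c1 := Int_cauchy_le y r0; have c2 := Int_cauchy_le (1 - y) r0.
  have -> : r * T ^- 2 * M = (T ^- 2 * r + T ^- 2 * r) + (K * (pi / r) + K * (pi / r)).
    by rewrite /M /K; field; rewrite !gt_eqF.
  apply: lerD; first exact: lerD h1 h2.
  by apply: lerD; apply: (ler_wpM2l (ltW K0)); [exact: c1|exact: c2].
have lower : r * T^-1 * w <= Int (fun x => \1_B x * W x).
  pose rho := r / T.
  have rho0 : 0 < rho by rewrite divr_gt0.
  have rhor : rho <= r by rewrite ler_pdivrMr// ler_peMr// ltW.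
  have bb : bm (fun x => \1_(~` B) x * \1_(ball y rho) x) by exact: bmM.
  apply: (@le_trans _ _ (Int (fun x => w * (\1_(ball y rho) x - \1_(~` B) x * \1_(ball y rho) x)))).
    rewrite IntZ; last exact: bmB.
    rewrite IntB// Int_indic_ball//; [|exact: le_trans ry|]; last first.
      by clear - rhor ry2 y2; lra.
    have : Int (fun x => \1_(~` B) x * \1_(ball y rho) x) <= T ^- 2 * r.
      apply: le_trans h1; apply: le_Int => //; first exact: bmM.
      move=> x _; apply: ler_wpM2l; first by case/andP: (i01 (~` B) x).
      rewrite !indicE ler_nat; case: (boolP (x \in (ball y rho : set R))) => //; rewrite inE => xb.
      by rewrite mem_set//; exact: le_ball xb.
    have : T ^- 2 * r <= rho.
      rewrite /rho mulrC ler_pM2l// lef_pV2 ?posrE ?exprn_gt0//.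
      by rewrite expr2 ler_peMr// ltW.
    move=> l1 l2; rewrite -/rho [leLHS]mulrC ler_pM2l//.
    by clear - l1 l2; lra.
  apply: le_Int; [by apply: bmZ; exact: bmB|exact: bmM|move=> x _].
  have -> : \1_(~` B) x = 1 - \1_B x :> R.
    by rewrite !indicE in_setC; case: (x \in B); rewrite ?subrr ?subr0.
  have -> : \1_(ball y rho) x - (1 - \1_B x) * \1_(ball y rho) x =
    \1_B x * \1_(ball y rho) x :> R by ring.
  rewrite mulrCA; apply: ler_wpM2l; first by case/andP: (i01 B x).
  rewrite indicE; case: (boolP (x \in (ball y rho : set R))) => xb; last by rewrite mulr0 expR_ge0.
  rewrite mulr1 ler_expR lerN2.
  have xrho : `|x - y| <= rho by move: xb; rewrite inE /ball/= distrC => /ltW.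
  have pi20 : 0 <= 2 * pi :> R by rewrite mulr_ge0// ltW.
  have h : (cs 1 x - cs 1 y) ^+ 2 <= (2 * pi * rho) ^+ 2.
    rewrite -[leLHS]real_normK ?num_real// lerXn2r ?nnegrE//.
      by rewrite mulr_ge0// ltW.
    exact: le_trans (cs1_lipschitz _ _) (ler_wpM2l pi20 xrho).
  apply: (le_trans (ler_wpM2l (ltW L0) h)); rewrite /L /rho le_eqVlt; apply/orP; left.
  by apply/eqP; field; rewrite !gt_eqF.
(* Expand the square and use cos^2 = (1 + cs 2) / 2; kap collects the constant terms. *)
pose kap := expR (L * (cs 1 y ^+ 2 + 1/2)).
have WE x : expR (2 * L * cs 1 y * cs 1 x + - L / 2 * cs 2 x) = kap * W x.
  rewrite -expRD; congr expR.
  have -> : cs 2 x = 2 * cs 1 x ^+ 2 - 1.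
    have := cs2Dsn2 1 x; have := csD 1 1 x; rewrite addn1 => -> h.
    by have -> : sn 1 x * sn 1 x = 1 - cs 1 x ^+ 2; [rewrite -h; ring|ring].
  by field.
exists (2 * L * cs 1 y), (- L / 2).
have -> : Int (fun x => \1_(~` B) x * expR (2 * L * cs 1 y * cs 1 x + - L / 2 * cs 2 x)) =
    kap * Int (fun x => \1_(~` B) x * W x).
  by rewrite -IntZ; [apply: eq_Int => x _; rewrite WE mulrCA|exact: bmM].
have -> : Int (fun x => (eta * \1_B x) * expR (2 * L * cs 1 y * cs 1 x + - L / 2 * cs 2 x)) =
    kap * (eta * Int (fun x => \1_B x * W x)).
  rewrite -IntZ; last exact: bmM.
  rewrite -IntZ; last by apply: bmZ; exact: bmM.
  by apply: eq_Int => x _; rewrite WE; ring.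
rewrite ltr_pM2l ?expR_gt0//.
apply: (le_lt_trans upper); apply: (lt_le_trans _ (ler_wpM2l (ltW eta0) lower)).
have -> : eta * (r * T^-1 * w) = r * T ^- 2 * (eta * w * T).
  by field; rewrite gt_eqF.
by rewrite ltr_pM2l// mulr_gt0.
Qed.

End PeakLemma.

(** * Disjoint symmetric pieces and polynomials concentrated on them *)

Section ConcentratedPolynomials.
Context {R : realType}.
Implicit Types (P : {poly R}) (A B C : set R) (p q x : R).
Local Notation mu := (@lebesgue_measure R).

Lemma mu_IntE A : measurable A -> A `<=` unitI -> mu A = (Int (\1_A))%:E.
Proof. by move=> mA AI; rewrite Int_indic// fineK//; exact: mu_fin. Qed.

Lemma indic_ge0 A x : 0 <= \1_A x :> R.
Proof. by rewrite indicE. Qed.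

Lemma indicC A x : \1_(~` A) x = 1 - \1_A x :> R.
Proof. by rewrite !indicE in_setC; case: (x \in A); rewrite ?subrr ?subr0. Qed.

Lemma le_indic A B x : A `<=` B -> \1_A x <= \1_B x :> R.
Proof.
move=> AB; rewrite !indicE ler_nat; case: (boolP (x \in A)) => //; rewrite inE => Ax.
by rewrite mem_set//; exact: AB.
Qed.

(** Intersect B with two small balls about a symmetric pair of density points: total length 4 r <=
    tau. *)
Lemma symset_shrink B (tau : R) : symset B -> 0 < tau ->
  exists C, [/\ symset C, C `<=` B & Int (\1_C) <= tau].
Proof.
move=> sB tau0; have [mB BI Br muB] := sB.
have [y /andP[y0 y2] hy] := sym_density_point sB.
have d0 : 0 < Num.min (tau / 4) (Num.min y (1/2 - y)).
  by rewrite !lt_min divr_gt0// y0 subr_gt0.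
(* A defect of at most r in a ball of measure 2 r leaves positive measure in B. *)
have [r /andP[r0 rd] [h1 _]] := hy 1 _ ltr01 d0.
move: rd; rewrite !le_min => /and3P[rt ry ry2].
have mball (a b : R) : measurable (ball a b : set R) := measurable_ball a b.
pose A : set R := ball y r `|` ball (1 - y) r.
pose C : set R := B `&` A.
have mA : measurable A by exact: measurableU.
have mC : measurable C by exact: measurableI.
have CI : C `<=` unitI by move=> x [/BI].
have b1 : bm (\1_(ball y r) : R -> R) := bm_indic (mball y r).
have b2 : bm (\1_(ball (1 - y) r) : R -> R) := bm_indic (mball (1 - y) r).
have bC : bm (\1_C : R -> R) := bm_indic mC.
have bBc : bm (\1_(~` B) : R -> R) := bm_indic (measurableC mB).
have I1 : Int (\1_(ball y r)) = 2 * r by apply: Int_indic_ball => //; clear - ry ry2 r0 y0 y2; lra.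
have I2 : Int (\1_(ball (1 - y) r)) = 2 * r by apply: Int_indic_ball => //; clear - ry ry2 r0 y0 y2; lra.
have leC : Int (\1_C) <= tau.
  apply: (@le_trans _ _ (Int (fun x => \1_(ball y r) x + \1_(ball (1 - y) r) x))).
    apply: le_Int => //; first exact: bmD.
    move=> x _; rewrite !indicE /C /A in_setI in_setU.
    by case: (x \in B); case: (x \in _); case: (x \in _); rewrite /= -natrD ler_nat.
  by rewrite IntD// I1 I2; move: rt; rewrite ler_pdivlMr//; clear; lra.
have gtC : 0 < Int (\1_C).
  apply: (@lt_le_trans _ _ (Int (fun x => \1_(ball y r) x - \1_(~` B) x * \1_(ball y r) x))).
    rewrite IntB//; last exact: bmM.
    by rewrite I1; move: h1; rewrite mul1r; clear - r0; lra.
  apply: le_Int => //; first by apply: bmB => //; exact: bmM.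
  move=> x _; rewrite indicC !indicE /C /A in_setI in_setU.
  by case: (x \in B); case: (x \in _); case: (x \in _); rewrite /=; clear; lra.
exists C; split => //; last by move=> x [].
split => //; last by rewrite mu_IntE// lte_fin.
move=> x [Bx xA]; split; first exact: Br.
have E (z : R) : 1 - z - (1 - x) = - (z - x) by ring.
case: xA => xA; [right|left]; move: xA; rewrite /ball/=; first by rewrite E normrN.
have -> : 1 - y - x = - (y - (1 - x)) by ring.
by rewrite normrN.
Qed.

Lemma symset_split B : symset B ->
  exists C, [/\ symset C, symset (B `\` C) & C `<=` B].
Proof.
move=> sB; have [mB BI Br muB] := sB.
have B0 : 0 < Int (\1_B) by move: muB; rewrite mu_IntE// lte_fin.
have [|C [sC CB Ct]] := symset_shrink (tau := Int (\1_B) / 2) sB.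
  by rewrite divr_gt0.
have [mC CI Cr muC] := sC.
exists C; split => //; split.
- exact: measurableD.
- by move=> x [/BI].
- move=> x [Bx nC]; split; first exact: Br.
  by move=> /Cr; rewrite opprB addrC subrK.
- have mD : measurable (B `\` C) by exact: measurableD.
  rewrite mu_IntE//; last by move=> x [/BI].
  have -> : Int (\1_(B `\` C)) = Int (fun x => \1_B x - \1_C x).
    apply: eq_Int => x _; rewrite !indicE in_setD.
    case: (boolP (x \in C)) => xC; last by rewrite andbT subr0.
    by rewrite andbF (mem_set (CB _ (set_mem xC))) subrr.
  rewrite IntB ?lte_fin; [|exact: bm_indic|exact: bm_indic].
  by move: Ct B0; clear; lra.
Qed.

(** Split a piece off the remainder repeatedly. The sigma type T records that the remainder is still
    a [symset], so that the choice can be iterated. *)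
Lemma disjoint_symsets B : symset B -> exists F : nat -> set R,
  [/\ forall k, symset (F k), forall k, F k `<=` B &
      forall j k, j != k -> F j `<=` ~` F k].
Proof.
move=> sB.
pose T := {B : set R | symset B}.
have /choice[c hc] : forall D : T, exists C : T,
    symset (sval D `\` sval C) /\ sval C `<=` sval D.
  by move=> [D sD]; have [C [sC sDC CD]] := symset_split sD; exists (exist _ C sC).
pose next (D : T) : T := exist _ (sval D `\` sval (c D)) (hc D).1.
pose D n := iter n next (exist _ B sB : T).
have DS n : sval (D n.+1) = sval (D n) `\` sval (c (D n)) by [].
have mono m n : sval (D (m + n)%N) `<=` sval (D m).
  elim: n => [|n ih]; first by rewrite addn0.
  by rewrite addnS DS => x [/ih].
have cD n : sval (c (D n)) `<=` sval (D n) := (hc (D n)).2.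
have lt j k : (j < k)%N -> sval (c (D k)) `<=` ~` sval (c (D j)).
  move=> jk x /cD; rewrite -(subnKC jk) => /mono; rewrite DS => -[_]; exact.
exists (fun k => sval (c (D k))); split.
- by move=> k; exact: svalP.
- by move=> k x /cD; rewrite -[k]add0n => /mono.
- move=> j k; rewrite neq_ltn => /orP[jk|kj]; last exact: lt.
  by move=> x xj xk; exact: (lt _ _ jk _ xk xj).
Qed.

(** Below the threshold b = theta^(1/q) the left side is at most theta; above it, a^q <= b^(q - p)
    a^p. Used where the p-mass is tiny. *)
Lemma powR_le_addl q p (theta : R) : 0 < q < p -> 0 < theta ->
  exists2 K : R, 0 < K & forall a : R, 0 <= a -> a `^ q <= theta + K * a `^ p.
Proof.
move=> /andP[q0 qp] t0; pose b := theta `^ q^-1.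
have b0 : 0 < b by rewrite powR_gt0.
exists (b `^ (q - p)); first by rewrite powR_gt0.
move=> a a0; have [ab|ba] := leP a b.
  apply: (@le_trans _ _ theta); last by rewrite lerDl mulr_ge0 ?powR_ge0.
  apply: (@le_trans _ _ (b `^ q)); first by rewrite ge0_ler_powR ?nnegrE// ltW.
  by rewrite /b -powRrM mulVf ?gt_eqF// powRr1// ltW.
apply: (@le_trans _ _ (b `^ (q - p) * a `^ p)); last by rewrite lerDr ltW.
have agt0 : 0 < a by exact: lt_trans ba.
rewrite -ler_pdivrMr ?powR_gt0// -powRB ?(gt_eqF agt0) ?implybT//.
have -> : q - p = - (p - q) by ring.
rewrite !powRN lef_pV2 ?posrE ?powR_gt0// ge0_ler_powR ?nnegrE ?(ltW b0)// ?(ltW ba)//.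
by rewrite subr_ge0 ltW.
Qed.

(** Here the small factor is on a^p, and the constant K applies below the threshold. Used on a set
    of small measure carrying a large p-mass. *)
Lemma powR_le_addr q p (theta : R) : 0 < q < p -> 0 < theta ->
  exists2 K : R, 0 < K & forall a : R, 0 <= a -> a `^ q <= theta * a `^ p + K.
Proof.
move=> /andP[q0 qp] t0.
pose b := (theta^-1) `^ (p - q)^-1.
have b0 : 0 < b by rewrite powR_gt0// invr_gt0.
have pq0 : 0 < p - q by rewrite subr_gt0.
exists (b `^ q); first by rewrite powR_gt0.
move=> a a0; have [ab|ba] := leP a b.
  apply: (@le_trans _ _ (b `^ q)); first by rewrite ge0_ler_powR ?nnegrE// ltW.
  by rewrite lerDr mulr_ge0 ?powR_ge0// ltW.
have agt0 : 0 < a by exact: lt_trans ba.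
apply: (@le_trans _ _ (theta * a `^ p)); last by rewrite lerDl ltW// powR_gt0.
have -> : p = (p - q) + q by ring.
rewrite powRD ?(gt_eqF agt0) ?implybT// mulrA ler_peMl ?powR_ge0//.
rewrite -ler_pdivrMl// mulr1.
have -> : theta^-1 = b `^ (p - q).
  by rewrite /b -powRrM mulVf ?gt_eqF// powRr1// invr_ge0 ltW.
by rewrite ge0_ler_powR ?nnegrE// ltW.
Qed.

(** The peak is put on a subset C of B of tiny measure. On C the q-mass is at most theta D + K2 |C|,
    so theta = eta / (4 D) fixes K2 and then C; off C it is at most eta / 4 plus K1 times the
    p-mass. Each of the four terms is at most eta / 4. *)
Lemma concentrated_poly p q B (eta D : R) G :
  0 < q < p -> (forall k : nat, p / 2 != k%:R) -> symset B -> 0 < eta -> 0 < D ->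
  exists P, [/\ gapped G P,
    D <= Int (fun x => \1_B x * nsq P x `^ (p / 2)),
    Int (fun x => \1_(~` B) x * nsq P x `^ (p / 2)) <= eta &
    Int (fun x => nsq P x `^ (q / 2)) <= eta].
Proof.
move=> /andP[q0 qp] pN sB eta0 D0.
have p0 : 0 < p by exact: lt_trans qp.
set s := p / 2 in pN *; set t := q / 2.
have s0 : 0 < s by rewrite divr_gt0.
have ts : 0 < t < s by rewrite divr_gt0//= ltr_pM2r.
have e4D : 0 < eta / (4 * D) by rewrite divr_gt0// mulr_gt0.
have e4 : 0 < eta / 4 by rewrite divr_gt0.
have [K2 K20 hK2] := powR_le_addr ts e4D.
have [K1 K10 hK1] := powR_le_addl ts e4.
have [|C [sC CB Ctau]] := symset_shrink (tau := eta / (4 * K2)) sB.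
  by rewrite divr_gt0// mulr_gt0.
(* After scaling, the p-mass off C is at most eta1 D; the two entries bound it by eta and by eta /
   (4 K1). *)
pose eta1 := Num.min (eta / D) (eta / (4 * K1 * D)).
have eta10 : 0 < eta1 by rewrite lt_min !divr_gt0// !mulr_gt0.
have [mC CI _ _] := sC; have [mB BI _ _] := sB.
have bC : bm (\1_C : R -> R) := bm_indic mC.
have bB : bm (\1_B : R -> R) := bm_indic mB.
have bCc : bm (\1_(~` C) : R -> R) := bm_indic (measurableC mC).
have bBc : bm (\1_(~` B) : R -> R) := bm_indic (measurableC mB).
have [g1 [g2 pk]] := peak sC eta10.
have [||P0 gP0 lt0] := outweighed_expR s0 pN bCc (bmZ eta1 bC) _ _ pk G.
- by move=> x; exact: indic_ge0.
- by move=> x; rewrite mulr_ge0 ?indic_ge0// ltW.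
have bH P := bm_nsq_powR P (ltW s0).
pose X := Int (fun x => \1_C x * nsq P0 x `^ s).
have XE : Int (fun x => (eta1 * \1_C x) * nsq P0 x `^ s) = eta1 * X.
  rewrite /X -IntZ; last exact: bmM.
  by apply: eq_Int => x _; rewrite mulrA.
rewrite XE in lt0.
have Y0 : 0 <= Int (fun x => \1_(~` C) x * nsq P0 x `^ s).
  by apply: Int_ge0 => x _; rewrite mulr_ge0 ?indic_ge0 ?powR_ge0.
have X0 : 0 < X by rewrite -(pmulr_rgt0 _ eta10); exact: le_lt_trans lt0.
(* Scaling by c multiplies the p-mass by c^(2 s) = D / X, making it exactly D on C. *)
pose c := (D / X) `^ (2 * s)^-1.
have DX : 0 < D / X by rewrite divr_gt0.
have c0 : 0 < c by rewrite powR_gt0.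
have cs2 : (c ^+ 2) `^ s = D / X.
  rewrite -powR_mulrn ?(ltW c0)// -powRrM /c -powRrM mulVf ?powRr1 ?(ltW DX)//.
  by rewrite gt_eqF// mulr_gt0.
pose P := c *: P0.
have PE x : nsq P x `^ s = D / X * nsq P0 x `^ s.
  by rewrite nsqZ powRM ?sqr_ge0 ?nsq_ge0// cs2.
have IE (psi : R -> R) : bm psi -> Int (fun x => psi x * nsq P x `^ s) =
    D / X * Int (fun x => psi x * nsq P0 x `^ s).
  move=> bpsi; rewrite -IntZ; last exact: bmM.
  by apply: eq_Int => x _; rewrite PE mulrCA.
have IC : Int (fun x => \1_C x * nsq P x `^ s) = D.
  by rewrite IE// -/X divfK// gt_eqF.
have ICc : Int (fun x => \1_(~` C) x * nsq P x `^ s) <= eta1 * D.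
  rewrite IE// mulrC -ler_pdivlMr//.
  have -> : eta1 * D / (D / X) = eta1 * X by field; rewrite !gt_eqF.
  exact: ltW.
have eD : eta1 * D <= eta.
  by rewrite -ler_pdivlMr// ge_min lexx.
have eKD : K1 * (eta1 * D) <= eta / 4.
  have h : eta1 <= eta / (4 * K1 * D) by rewrite ge_min lexx orbT.
  have h2 : eta / (4 * K1 * D) * (K1 * D) = eta / 4 by field; rewrite !gt_eqF.
  by rewrite mulrCA -h2 ler_wpM2r// mulr_ge0// ltW.
exists P; split; first exact: gappedZ.
- rewrite -IC; apply: le_Int; [exact: bmM|exact: bmM|move=> x _].
  by rewrite ler_wpM2r ?powR_ge0// le_indic.
- apply: (le_trans _ eD); apply: (le_trans _ ICc).
  apply: le_Int; [exact: bmM|exact: bmM|move=> x _].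
  by rewrite ler_wpM2r ?powR_ge0// le_indic//; exact: subsetC.
have bHt : bm (fun x => nsq P x `^ t).
  by apply: bm_nsq_powR; case/andP: ts => /ltW.
have b1 : bm (fun x => eta / (4 * D) * (\1_C x * nsq P x `^ s)).
  by apply: bmZ; exact: bmM.
have b2 : bm (fun x => K2 * \1_C x) by exact: bmZ.
have b3 : bm (fun x => K1 * (\1_(~` C) x * nsq P x `^ s)).
  by apply: bmZ; exact: bmM.
have b4 : bm (fun=> eta / 4 : R) by exact: bm_cst.
apply: (@le_trans _ _ (Int (fun x => (eta / (4 * D) * (\1_C x * nsq P x `^ s) + K2 * \1_C x)
    + (eta / 4 + K1 * (\1_(~` C) x * nsq P x `^ s))))).
  apply: le_Int => //; first by apply: bmD; exact: bmD.
  move=> x _; have h1 := hK1 _ (nsq_ge0 P x); have h2 := hK2 _ (nsq_ge0 P x).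
  rewrite indicC indicE; case: (x \in C); rewrite ?subr0 ?subrr ?mul1r ?mul0r ?mulr1 ?mulr0.
    by rewrite addr0; apply: (le_trans h2); rewrite lerDl ltW.
  by rewrite !add0r.
rewrite IntD; [|exact: bmD|exact: bmD].
rewrite (IntD b1 b2) (IntD b4 b3).
rewrite (IntZ _ (bmM bC (bH P))) (IntZ _ bC) (IntZ _ (bmM bCc (bH P))).
rewrite IC Int_cst.
have t1 : eta / (4 * D) * D = eta / 4 by field; rewrite gt_eqF.
have t2 : K2 * Int (\1_C) <= eta / 4.
  have h2 : K2 * (eta / (4 * K2)) = eta / 4 by field; rewrite gt_eqF.
  by rewrite -h2 ler_wpM2l// ltW.
have t3 : K1 * Int (fun x => \1_(~` C) x * nsq P x `^ s) <= eta / 4.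
  by apply: le_trans eKD; rewrite ler_wpM2l// ltW.
rewrite t1; clear - t2 t3.
rewrite [leRHS](_ : eta = (eta / 4 + eta / 4) + (eta / 4 + eta / 4)); last by field.
by apply: lerD; apply: lerD.
Qed.

End ConcentratedPolynomials.

(** * Series dominated by 2^-k and their radial limits *)

Section DyadicSums.
Context {R : realType}.
Implicit Types (e C x y t : R) (v : nat -> R) (A : nat -> R -> R).
Local Notation mu := (@lebesgue_measure R).

Definition half_pow (k : nat) : R := 2^-1 ^+ k.

Lemma half_pow_gt0 k : 0 < half_pow k.
Proof. by rewrite exprn_gt0// invr_gt0. Qed.

Lemma half_powS k : half_pow k.+1 = half_pow k / 2.
Proof. by rewrite /half_pow exprSr. Qed.

Lemma half_pow_cvg0 C : (C * half_pow n) @[n --> \oo] --> (0 : R).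
Proof.
rewrite -[X in _ --> X](mulr0 C); apply: cvgMr; apply: cvg_expr.
by rewrite ger0_norm ?invr_ge0// invf_lt1// ltr1n.
Qed.

(** The subtracted term at m is what makes the induction on m close. *)
Lemma sum_half_pow v C n m : (forall k, `|v k| <= C * half_pow k) -> (n <= m)%N ->
  `|series v m - series v n| <= 2 * C * half_pow n - 2 * C * half_pow m.
Proof.
move=> vC; elim: m => [|m ih]; first by rewrite leqn0 => /eqP->; rewrite !subrr normr0.
rewrite leq_eqVlt => /predU1P[->|]; first by rewrite !subrr normr0.
rewrite ltnS => /ih{}ih; rewrite seriesSr.
rewrite (_ : series v m + v m - series v n = (series v m - series v n) + v m); last by ring.
rewrite (le_trans (ler_normD _ _))// (le_trans (lerD ih (vC m)))// half_powS.
by rewrite le_eqVlt; apply/orP; left; apply/eqP; field.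
Qed.

Lemma half_pow_tail v C n m : (forall k, `|v k| <= C * half_pow k) -> (n <= m)%N ->
  `|series v m - series v n| <= 2 * C * half_pow n.
Proof.
move=> vC nm; rewrite (le_trans (sum_half_pow vC nm))// gerBl.
have C0 : 0 <= C by have := le_trans (normr_ge0 _) (vC 0%N); rewrite /half_pow expr0 mulr1.
by rewrite !mulr_ge0// ltW// half_pow_gt0.
Qed.

Lemma half_pow_cvg v C : (forall k, `|v k| <= C * half_pow k) -> cvgn (series v).
Proof.
move=> vC; apply: normed_cvg; apply: (@series_le_cvg _ _ (geometric C 2^-1)).
- by move=> n /=.
- by move=> n; rewrite (le_trans _ (vC n)).
- by move=> n; exact: vC.
- by apply: is_cvg_geometric_series; rewrite ger0_norm ?invr_ge0// invf_lt1// ltr1n.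
Qed.

Lemma half_pow_lim_tail v C n : (forall k, `|v k| <= C * half_pow k) ->
  `|limn (series v) - series v n| <= 2 * C * half_pow n.
Proof.
move=> vC; have cv := half_pow_cvg vC.
have : (fun m => `|series v m - series v n|) @ \oo --> `|limn (series v) - series v n|.
  by apply: cvg_norm; apply: cvgB => //; exact: cvg_cst.
move=> /(@cvgr_to_le _ _ _ _ _ _ (2 * C * half_pow n)); apply.
by exists n => // m /= nm; exact: half_pow_tail.
Qed.

Lemma half_pow_lim_le v C : (forall k, `|v k| <= C * half_pow k) ->
  `|limn (series v)| <= 2 * C.
Proof.
move=> /(half_pow_lim_tail 0); rewrite /half_pow expr0 mulr1.
by rewrite /series/= big_nil subr0.
Qed.

(** The majorant is uniform in r, so the tails are small for all r at once and finitely many terms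
    decide the limit. *)
Lemma tannery (u : nat -> R -> R) v (f : R -> R) C :
  (forall r, 0 < r < 1 -> forall k, `|u k r| <= C * half_pow k) ->
  (forall k, `|v k| <= C * half_pow k) ->
  (forall r, 0 < r < 1 -> series (u ^~ r) @ \oo --> f r) ->
  (forall k, u k r @[r --> 1^'-] --> v k) ->
  f r @[r --> 1^'-] --> limn (series v).
Proof.
move=> uC vC uf uv; apply/cvgrPdist_le => e e_gt0.
have e4 : 0 < e / 4 by rewrite divr_gt0.
have /cvgrPdist_le/(_ _ e4)[n _ hn] := half_pow_cvg0 (2 * C).
have {}hn : 2 * C * half_pow n <= e / 4.
  by have := hn n (leqnn n); rewrite sub0r normrN; exact: le_trans (ler_norm _).
have : series (u ^~ r) n @[r --> 1^'-] --> series v n.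
  elim: {hn} n => [|n ih].
    rewrite [X in X @ _](_ : _ = fun=> 0); last by apply/funext => r; rewrite /series/= big_nil.
    by rewrite /series/= big_nil; exact: cvg_cst.
  rewrite seriesSr [X in X @ _](_ : _ = fun r => series (u ^~ r) n + u n r); last first.
    by apply/funext => r; rewrite seriesSr.
  exact: cvgD.
move=> /cvgrPdist_le/(_ _ e4) near1.
near=> r.
have r01 : 0 < r < 1.
  by apply/andP; split; near: r; [exact: nbhs_left_gt|exact: nbhs_left_lt].
have h1 : `|series v n - series (u ^~ r) n| <= e / 4 by near: r.
have h2 := half_pow_lim_tail n vC.
have h3 : `|f r - series (u ^~ r) n| <= 2 * C * half_pow n.
  by rewrite -(cvg_lim (@Rhausdorff R) (uf r r01)); exact: half_pow_lim_tail (uC r r01).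
rewrite (_ : limn (series v) - f r = (limn (series v) - series v n) +
  (series v n - series (u ^~ r) n) - (f r - series (u ^~ r) n)); last by ring.
rewrite (le_trans (ler_normB _ _))// (le_trans (lerD (ler_normD _ _) (lexx _)))//.
rewrite (le_trans (lerD (lerD (le_trans h2 hn) h1) (le_trans h3 hn)))//.
by clear - e_gt0; lra.
Unshelve. all: by end_near. Qed.

(** Finiteness at t forces A k t <= Ysum^(1/e) 2^-k, and the integral is at most 1 when A k has
    e-mass at most 2^-(k+1) 2^(-k e). Terms are compared one at a time, so every e > 0 is
    allowed. *)
Definition Ysum (e : R) (A : nat -> R -> R) (t : R) : \bar R :=
  (\sum_(0 <= k <oo) ((2 ^+ k * A k t) `^ e)%:E)%E.

Lemma Ysum_ge0 e A t : (0 <= Ysum e A t)%E.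
Proof. by apply: nneseries_ge0 => k _ _; rewrite lee_fin powR_ge0. Qed.

Lemma Ysum_bound e A t : 0 < e -> (forall k, 0 <= A k t) -> (Ysum e A t < +oo)%E ->
  forall k, A k t <= (fine (Ysum e A t)) `^ e^-1 * half_pow k.
Proof.
move=> e_gt0 A0 Yfin k.
have Yf : Ysum e A t \is a fin_num by rewrite ge0_fin_numE// Ysum_ge0.
have le1 : (2 ^+ k * A k t) `^ e <= fine (Ysum e A t).
  rewrite -lee_fin fineK//.
  apply: le_trans (nneseries_lim_ge k.+1 _); last by move=> n _ _; rewrite lee_fin powR_ge0.
  rewrite big_nat_recr//= leeDr// sume_ge0// => n _.
  by rewrite lee_fin powR_ge0.
have x0 : 0 <= 2 ^+ k * A k t by rewrite mulr_ge0// exprn_ge0.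
have : 2 ^+ k * A k t <= (fine (Ysum e A t)) `^ e^-1.
  have -> : 2 ^+ k * A k t = ((2 ^+ k * A k t) `^ e) `^ e^-1.
    by rewrite -powRrM mulfV ?gt_eqF// powRr1.
  apply: ge0_ler_powR; [by rewrite invr_ge0 ltW|by rewrite nnegrE powR_ge0| |exact: le1].
  by rewrite nnegrE fine_ge0// Ysum_ge0.
by rewrite /half_pow exprVn ler_pdivlMr ?exprn_gt0// mulrC.
Qed.

Lemma measurable_Ysum e A (D : set R) : (forall k, measurable_fun [set: R] (A k)) ->
  measurable_fun D (Ysum e A).
Proof.
move=> mA; apply: measurable_funTS.
apply: (@ge0_emeasurable_sum _ _ _ setT (fun k t => ((2 ^+ k * A k t) `^ e)%:E) xpredT).
  by move=> k x _ _; rewrite lee_fin powR_ge0.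
move=> k _; apply/measurable_EFinP; apply: (measurableT_comp (measurable_powR e)).
exact: measurable_funM.
Qed.

Lemma integral_Ysum_le e A (D : set R) : measurable D ->
  (forall k, measurable_fun [set: R] (A k)) -> (forall k t, 0 <= A k t) ->
  (forall k, \int[mu]_(t in D) ((A k t) `^ e)%:E <=
     ((2 ^ k.+1)%:R^-1 / (2 ^+ k) `^ e)%:E)%E ->
  (\int[mu]_(t in D) Ysum e A t <= 1)%E.
Proof.
move=> mD mA A0 hA.
have mp k : measurable_fun D (fun t => ((A k t) `^ e)%:E).
  apply: measurable_funTS; apply/measurable_EFinP.
  exact: (measurableT_comp (measurable_powR e)).
rewrite (_ : (fun t => _) = fun t => (\sum_(k <oo) ((2 ^+ k * A k t) `^ e)%:E)%E)//.
rewrite integral_nneseries//; last 2 first.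
- move=> k; apply: measurable_funTS; apply/measurable_EFinP.
  apply: (measurableT_comp (measurable_powR e)).
  exact: (measurable_funM (measurable_cst _) (mA k)).
- by move=> k t _; rewrite lee_fin powR_ge0.
apply: le_trans (epsilon_trick0 xpredT ler01); apply: lee_nneseries.
  by move=> k _ _; apply: integral_ge0 => t _; rewrite lee_fin powR_ge0.
move=> k _; have p0 : 0 < (2 ^+ k : R) `^ e by rewrite powR_gt0// exprn_gt0.
under eq_integral do rewrite powRM ?exprn_ge0// EFinM.
rewrite ge0_integralZl_EFin; [|exact: mD|by move=> t _; rewrite lee_fin powR_ge0
  |exact: mp|exact: ltW].
apply: (le_trans (lee_wpmul2l _ (hA k))); first by rewrite lee_fin ltW.
by rewrite -EFinM lee_fin div1r mulrCA mulfV ?gt_eqF// mulr1.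
Qed.

(** From x + y <= 2 max(x, y), which covers exponents below and above 1 alike. *)
Lemma powRD_le (e x y : R) : 0 <= e -> 0 <= x -> 0 <= y ->
  (x + y) `^ e <= 2 `^ e * (x `^ e + y `^ e).
Proof.
move=> e_ge0 x0 y0; rewrite mulrDr.
have [xy|yx] := leP x y.
  apply: (@le_trans _ _ ((2 * y) `^ e)); last first.
    by rewrite powRM// lerDr mulr_ge0 ?powR_ge0.
  by rewrite ge0_ler_powR ?nnegrE ?mulr_ge0 ?addr_ge0//; lra.
apply: (@le_trans _ _ ((2 * x) `^ e)); last first.
  by rewrite powRM// lerDl mulr_ge0 ?powR_ge0.
by rewrite ge0_ler_powR ?nnegrE ?mulr_ge0 ?addr_ge0//; lra.
Qed.

Lemma cmod_le (x y : R) : cmod x y <= `|x| + `|y|.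
Proof.
have s0 : 0 <= `|x| + `|y| by rewrite addr_ge0.
rewrite /cmod -[leRHS]ger0_norm// -sqrtr_sqr ler_wsqrtr//.
rewrite -(real_normK (num_real x)) -(real_normK (num_real y)).
by have := normr_ge0 x; have := normr_ge0 y; nra.
Qed.

Lemma cmod_ge_re (x y : R) : `|x| <= cmod x y.
Proof. by rewrite /cmod -sqrtr_sqr ler_wsqrtr// lerDl sqr_ge0. Qed.

Lemma cmod_ge_im (x y : R) : `|y| <= cmod x y.
Proof. by rewrite /cmod -sqrtr_sqr ler_wsqrtr// lerDr sqr_ge0. Qed.

End DyadicSums.

(** * The series of shifted blocks e(M_k x) P_k *)

Section Blocks.
Context {R : realType}.
Context (P : nat -> {poly R}) (M : nat -> nat).
Context (P_ge0 : forall k i, 0 <= (P k)`_i).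
(** [M_step] leaves a hole longer than k after block k, [P_le] yields polynomial growth of the
    coefficients, and [P_moment] makes the radial error of block k at most 2^-k. *)
Context (M_step : forall k, (M k + size (P k) + k < M k.+1)%N).
Context (P_le : forall k i, (P k)`_i <= (M k)%:R).
Context (P_moment : forall k,
  \sum_(0 <= i < size (P k)) (P k)`_i * i%:R <= half_pow k * (M k).+1%:R).
Implicit Types (F : nat -> R -> R) (r t : R).

Definition block k := P k * 'X^(M k).

(** As k <= M k, blocks with k > n have no coefficient at n, so the sum may stop at n. *)
Definition acoef n := \sum_(0 <= k < n.+1) (block k)`_n.

Lemma M_lt j k : (j < k)%N -> (M j + size (P j) + j < M k)%N.
Proof.
elim: k => // k ih; rewrite ltnS leq_eqVlt => /predU1P[->|/ih jk]; first exact: M_step.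
by rewrite (leq_trans jk)// (leq_trans _ (ltnW (M_step k)))// -addnA leq_addr.
Qed.

Lemma M_ge k : (k <= M k)%N.
Proof.
elim: k => // k ih; rewrite (leq_trans _ (M_step k))// ltnS (leq_trans ih)//.
by rewrite -addnA leq_addr.
Qed.

Lemma M_mono j k : (j <= k)%N -> (M j <= M k)%N.
Proof.
rewrite leq_eqVlt => /predU1P[->//|/M_lt/ltnW]; apply: leq_trans.
by rewrite -addnA leq_addr.
Qed.

Lemma block_coef0 k n : (n < M k)%N -> (block k)`_n = 0.
Proof. by move=> nk; rewrite coefMXn nk. Qed.

Lemma block_ge0 k n : 0 <= (block k)`_n.
Proof. by rewrite coefMXn; case: ifP. Qed.

Lemma acoef_widen K n : (n < M K)%N -> acoef n = \sum_(0 <= k < K) (block k)`_n.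
Proof.
move=> nK.
have widen m m' : (m <= m')%N -> (forall k, (m <= k)%N -> (n < M k)%N) ->
    \sum_(0 <= k < m) (block k)`_n = \sum_(0 <= k < m') (block k)`_n.
  move=> mm h; rewrite [RHS](big_cat_nat (n := m))//=.
  rewrite [X in _ = _ + X]big_nat [X in _ = _ + X]big1 ?addr0//.
  by move=> k /andP[mk _]; rewrite block_coef0//; exact: h.
have hK k : (K <= k)%N -> (n < M k)%N by move=> /M_mono; exact: leq_trans nK.
have hn k : (n.+1 <= k)%N -> (n < M k)%N by move=> nk; exact: leq_trans (M_ge k).
have [le|/ltnW le] := leqP K n.+1; first by rewrite [RHS](widen _ n.+1).
by rewrite /acoef (widen _ K).
Qed.

Lemma acoef_ge0 n : 0 <= acoef n.
Proof. by apply: sumr_ge0 => k _; exact: block_ge0. Qed.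

Lemma acoef_le n : acoef n <= n.+1%:R ^+ 2.
Proof.
apply: (@le_trans _ _ (\sum_(0 <= k < n.+1) n.+1%:R)).
  apply: ler_sum => k _; rewrite coefMXn; case: ltnP => // Mn.
  by rewrite (le_trans (P_le k _))// ler_nat (leq_trans Mn).
by rewrite sumr_const_nat subn0 -[leLHS]mulr_natr expr2.
Qed.

Lemma acoef_nz n : acoef n != 0 -> exists2 k, (M k <= n)%N & (P k)`_(n - M k) != 0.
Proof.
move=> an0; apply: contrapT => h; move/negP: an0; apply; apply/eqP.
rewrite /acoef big1// => k _; rewrite coefMXn; case: ltnP => // Mn.
by apply: contrapT => /eqP nz; apply: h; exists k.
Qed.

(** For F = cs or sn, the real or imaginary part of block k at radius r; r = 1 is the boundary. *)
Definition blk F k r t :=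
  \sum_(0 <= i < size (P k)) (P k)`_i * (r ^+ (i + M k) * F (i + M k)%N t).

Lemma size_block k K : (k < K)%N -> (size (block k) <= M K)%N.
Proof.
move=> /M_lt/ltnW; apply: leq_trans; rewrite (leq_trans (size_polyMleq _ _))//.
by rewrite size_polyXn addnS/= addnC leq_addr.
Qed.

(** Cutting at M K cuts through no block, so block sums are a subsequence of the partial sums. *)
Lemma acoef_series F r t K :
  series (fun n => acoef n * r ^+ n * F n t) (M K) = \sum_(0 <= k < K) blk F k r t.
Proof.
rewrite /series/= big_nat.
under eq_bigr => n /andP[_ nK] do rewrite (acoef_widen nK) -mulrA mulr_suml.
rewrite -big_nat exchange_big/=; rewrite big_nat [RHS]big_nat; apply: eq_bigr => k /andP[_ kK].
rewrite -(@tsum_widen _ (fun n _ => r ^+ n * F n t) (block k) (M K) 0 (size_block kK)).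
exact: (@tsumMXn _ (fun n _ => r ^+ n * F n t) (P k) (M k) 0).
Qed.

(** x^n is the least of 1, x, ..., x^n, and their sum times 1 - x is 1 - x^(n+1). *)
Lemma pow_moment_le (x : R) n : 0 <= x <= 1 -> n.+1%:R * (1 - x) * x ^+ n <= 1.
Proof.
move=> /andP[x0 x1]; elim: n => [|n ih]; first by rewrite mul1r expr0 mulr1 gerBl.
rewrite exprS -natr1.
have xn0 : 0 <= x ^+ n by rewrite exprn_ge0.
have xn1 : x * x ^+ n <= 1 by rewrite -exprS exprn_ile1.
have : n.+1%:R * (1 - x) * x ^+ n * x <= x by rewrite ler_piMl.
by clear - xn1 x1 x0; nra.
Qed.

Lemma acoef_summable F r t : 0 < r < 1 -> (forall n, `|F n t| <= 1) ->
  cvgn (series (fun n => acoef n * r ^+ n * F n t)).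
Proof.
move=> /andP[r0 r1] F1.
(* With x = r^(1/4), (n + 1)^2 x^(2 n) is at most (1 - x)^-2, and the remaining (x^2)^n is
   summable. *)
pose x := Num.sqrt (Num.sqrt r).
have x0 : 0 < x by rewrite !sqrtr_gt0.
have x4 : x ^+ 4 = r.
  by rewrite (_ : 4 = 2 * 2)%N// exprM !sqr_sqrtr// ?sqrtr_ge0 ?ltW.
have x1 : x < 1.
  by rewrite ltNge; apply/negP => /(exprn_ege1 4); rewrite x4 leNgt r1.
apply: normed_cvg.
apply: (@series_le_cvg _ _ (geometric ((1 - x) ^- 2) (x ^+ 2))).
- by move=> n /=.
- by move=> n /=; rewrite mulr_ge0// ?invr_ge0 ?exprn_ge0// ?subr_ge0 ltW.
- move=> n /=; rewrite !normrM [`|acoef n|]ger0_norm ?acoef_ge0//.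
  rewrite [`|r ^+ n|]ger0_norm ?exprn_ge0 ?(ltW r0)//.
  have b1 := acoef_le n.
  have xn0 : 0 <= x ^+ n by rewrite exprn_ge0 ?ltW.
  have b2 : n.+1%:R * x ^+ n <= (1 - x)^-1.
    rewrite -[leRHS]mul1r ler_pdivlMr ?subr_gt0// mulrAC.
    by apply: pow_moment_le; rewrite !ltW.
  have rE : r ^+ n = (x ^+ n) ^+ 2 * (x ^+ 2) ^+ n.
    by rewrite -x4 -!exprM -exprD; congr (_ ^+ _); lia.
  apply: (@le_trans _ _ (n.+1%:R ^+ 2 * r ^+ n * 1)).
    by apply: ler_pM => //; rewrite ?mulr_ge0 ?acoef_ge0 ?exprn_ge0 ?(ltW r0)//
      ler_wpM2r ?exprn_ge0 ?(ltW r0).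
  rewrite mulr1 rE mulrA -exprMn -exprVn ler_wpM2r ?exprn_ge0 ?(ltW x0)//.
  by rewrite lerXn2r ?nnegrE ?mulr_ge0 ?invr_ge0 ?subr_ge0 ?(ltW x1).
- apply: is_cvg_geometric_series; rewrite ger0_norm ?exprn_ge0 ?(ltW x0)//.
  by rewrite exprn_ilt1 ?(ltW x0).
Qed.

Lemma blk_series_cvg F r t : 0 < r < 1 -> (forall n, `|F n t| <= 1) ->
  series (fun k => blk F k r t) @ \oo -->
  limn (series (fun n => acoef n * r ^+ n * F n t)).
Proof.
move=> r01 F1; have /cvgrPdist_lt c := acoef_summable r01 F1.
apply/cvgrPdist_lt => e /c[N _ hN]; exists N => // K /= NK.
rewrite -[series _ K]/(\sum_(0 <= k < K) blk F k r t) -acoef_series.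
by apply: hN => /=; rewrite (leq_trans NK)// M_ge.
Qed.

Lemma blk_bound F k r t : 0 < r < 1 -> (forall n, `|F n t| <= 1) ->
  `|blk F k r t| <= `|blk F k 1 t| + half_pow k.
Proof.
move=> /andP[r0 r1] F1.
have -> : blk F k r t = r ^+ M k * blk F k 1 t -
    \sum_(0 <= i < size (P k)) (P k)`_i * ((r ^+ M k * (1 - r ^+ i)) * F (i + M k)%N t).
  rewrite /blk mulr_sumr -sumrB; apply: eq_bigr => i _.
  by rewrite expr1n exprD; ring.
have rM0 : 0 <= r ^+ M k by rewrite exprn_ge0 ?ltW.
rewrite (le_trans (ler_normB _ _))// lerD//.
  rewrite normrM ger0_norm// ler_piMl// exprn_ile1// ltW//.
rewrite (le_trans (ler_norm_sum _ _ _))//.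
apply: (@le_trans _ _ (\sum_(0 <= i < size (P k)) (P k)`_i * i%:R / (M k).+1%:R)).
  apply: ler_sum => i _; rewrite normrM [`|(P k)`_i|]ger0_norm// -[leRHS]mulrA ler_wpM2l//.
  have ri : r ^+ i <= 1 by rewrite exprn_ile1 ?ltW.
  rewrite normrM -[leRHS]mulr1 ler_pM// ger0_norm ?mulr_ge0 ?subr_ge0//.
  have bern : 1 - r ^+ i <= i%:R * (1 - r).
    clear - r0 r1; elim: i => [|i ih]; first by rewrite mul0r expr0 subrr.
    have ri : r ^+ i <= 1 by rewrite exprn_ile1 ?ltW.
    have ri0 : 0 <= r ^+ i by rewrite exprn_ge0 ?ltW.
    by rewrite exprS -natr1; nra.
  apply: (@le_trans _ _ (r ^+ M k * (i%:R * (1 - r)))); first by rewrite ler_wpM2l.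
  rewrite ler_pdivlMr ?ltr0n// mulrCA -mulrA ler_piMr//.
  apply: le_trans (@pow_moment_le r (M k) _).
    by rewrite le_eqVlt; apply/orP; left; apply/eqP; ring.
  by rewrite !ltW.
rewrite -mulr_suml ler_pdivrMr ?ltr0n//; exact: P_moment.
Qed.

Lemma blk_cvg F k t : blk F k r t @[r --> 1^'-] --> blk F k 1 t.
Proof.
apply: cvg_at_left_filter.
have -> : (fun r => blk F k r t) =
    horner (\sum_(0 <= i < size (P k)) ((P k)`_i * F (i + M k)%N t) *: 'X^(i + M k)).
  apply/funext => r; rewrite /blk horner_sum; apply: eq_bigr => i _.
  by rewrite hornerZ hornerXn; ring.
rewrite [X in _ --> X](_ : _ =
  (\sum_(0 <= i < size (P k)) ((P k)`_i * F (i + M k)%N t) *: 'X^(i + M k)).[1]).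
  exact: continuous_horner.
rewrite /blk horner_sum; apply: eq_bigr => i _.
by rewrite hornerZ hornerXn; ring.
Qed.

Definition amod k t : R := Num.sqrt (nsq (P k) t).

Lemma blk1_modE k t : cmod (blk cs k 1 t) (blk sn k 1 t) = amod k t.
Proof.
rewrite /cmod /amod -(nsqMXn (P k) (M k)) /nsq /tre /tim !tsumMXn; congr (Num.sqrt (_ ^+ 2 + _ ^+ 2));
  by apply: eq_bigr => i _; rewrite expr1n mul1r.
Qed.

(** Successive exponents lie in one block, where the gap hypothesis applies, or in two blocks, which
    [M_step] separates. The nonzero constant coefficients put every M k in the spectrum, so its
    enumeration never stops. *)
Lemma gaps_acoef : (forall k i j, (i < j)%N -> (P k)`_i != 0 -> (P k)`_j != 0 -> (k <= j - i)%N) ->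
  (forall k, (P k)`_0 != 0) -> gaps_to_infty acoef.
Proof.
move=> gapP P00.
(* k <= M k bounds the block index by n, so membership is boolean and [ex_minn] applies. *)
pose S n := [exists k : 'I_n.+1, (M k <= n)%N && ((P k)`_(n - M k) != 0)].
have SP n : reflect (exists2 k, (M k <= n)%N & (P k)`_(n - M k) != 0) (S n).
  apply: (iffP existsP) => [[k /andP[h1 h2]]|[k h1 h2]]; first by exists k.
  have kn : (k < n.+1)%N by rewrite ltnS (leq_trans (M_ge k)).
  by exists (Ordinal kn); rewrite /= h1.
have SM k : S (M k) by apply/SP; exists k => //; rewrite subnn.
have nextP n : exists m, (n < m)%N && S m.
  by exists (M n.+1); rewrite SM (leq_trans _ (M_ge _)).
pose next n := ex_minn (nextP n).
have nextE n : [/\ (n < next n)%N, S (next n) & forall m, (n < m)%N -> S m -> (next n <= m)%N].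
  rewrite /next; case: ex_minnP => m /andP[nm Sm] mmin; split => // m' nm' Sm'.
  by apply: mmin; rewrite nm'.
have S0P : exists m, S m by exists (M 0%N).
pose nk k := iter k next (ex_minn S0P).
have nkS k : nk k.+1 = next (nk k) by [].
have Snk k : S (nk k).
  by case: k => [|k]; [rewrite /nk/=; case: ex_minnP|rewrite nkS; case: (nextE (nk k))].
have nk_lt k : (nk k < nk k.+1)%N by rewrite nkS; case: (nextE (nk k)).
have nk_ge k : (k <= nk k)%N by elim: k => // k ih; exact: leq_ltn_trans (nk_lt k).
have size_nz k i : (P k)`_i != 0 -> (i < size (P k))%N.
  by move=> nz; rewrite ltnNge; apply: contra nz => le; rewrite nth_default.
exists nk; split => //; split.
  move=> m /acoef_nz/SP Sm.
  have [K mK] : exists K, (m < nk K)%N by exists m.+1; exact: nk_ge.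
  elim: K mK => [|K ih mK].
    by rewrite /nk/=; case: ex_minnP => n _ /(_ m Sm) nm; rewrite ltnNge nm.
  have [mK'|] := ltnP m (nk K); first exact: ih.
  rewrite leq_eqVlt => /predU1P[<-|Km]; first by exists K.
  have [_ _ /(_ _ Km Sm)] := nextE (nk K).
  by rewrite -nkS leqNgt mK.
(* Exponents from M G on belong to blocks of index at least G. *)
move=> G; exists (M G) => k Gk.
have /SP[k1 h1 nz1] := Snk k; have /SP[k2 h2 nz2] := Snk k.+1.
have nlt := nk_lt k; have l1 := size_nz _ _ nz1; have l2 := size_nz _ _ nz2.
have Mk : (M G <= nk k)%N := leq_trans Gk (nk_ge k).
have Gk1 : (G <= k1)%N.
  rewrite leqNgt; apply/negP => /M_lt lt; clear - Mk h1 l1 lt; lia.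
have [k12|k21|k12] := ltngtP k1 k2.
- have lt := M_lt k12; clear - lt h1 h2 l1 Gk1; lia.
- have lt := M_lt k21; clear - lt h1 h2 l2 nlt; lia.
- subst k2; have := gapP k1 (nk k - M k1)%N (nk k.+1 - M k1)%N.
  rewrite ltn_sub2r//; last by clear - h1 nlt; lia.
  by move=> /(_ isT nz1 nz2); clear - h1 h2 nlt Gk1; lia.
Qed.

Lemma acoef_distribution : distribution_coefs acoef.
Proof.
by exists 1, 2%N => n; rewrite mul1r ger0_norm ?acoef_ge0// acoef_le.
Qed.

End Blocks.

(** * Hardy bound, boundary values and divergence for a Borel set *)

Section BorelVersion.
Context {R : realType}.
Implicit Types (A : nat -> R -> R) (B D : set R) (e p q r t : R).
Local Notation mu := (@lebesgue_measure R).

Lemma choose_shifts (P : nat -> {poly R}) : (forall k i, 0 <= (P k)`_i) ->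
  exists M : nat -> nat, [/\ forall k, (M k + size (P k) + k < M k.+1)%N,
    forall k i, (P k)`_i <= (M k)%:R & forall k,
    \sum_(0 <= i < size (P k)) (P k)`_i * i%:R <= half_pow k * (M k).+1%:R].
Proof.
move=> P0.
pose c k := \sum_(0 <= i < size (P k)) (P k)`_i.
pose m k := (\sum_(0 <= i < size (P k)) (P k)`_i * i%:R) / half_pow k.
have c0 k : 0 <= c k by apply: sumr_ge0.
have m0 k : 0 <= m k.
  by rewrite divr_ge0 ?(ltW (half_pow_gt0 k))//; apply: sumr_ge0 => i _; rewrite mulr_ge0.
pose n k := Num.bound (c k + m k).
have hn k : c k + m k < (n k)%:R by rewrite archi_boundP// addr_ge0.
pose M := fix M k := if k is j.+1 then (M j + size (P j) + j + 1 + n j.+1)%N else n 0%N.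
have nM k : (n k <= M k)%N by case: k => [|k] //=; exact: leq_addl.
exists M; split.
- by move=> k /=; rewrite addn1 addSn ltnS leq_addr.
- move=> k i; apply: (@le_trans _ _ (c k)).
    have [ik|ki] := ltnP i (size (P k)); last by rewrite nth_default.
    by rewrite /c (bigD1_seq i) ?iota_uniq ?mem_index_iota//= lerDl sumr_ge0.
  apply: (@le_trans _ _ (n k)%:R); last by rewrite ler_nat.
  by rewrite (le_trans _ (ltW (hn k)))// lerDl.
- move=> k; rewrite mulrC -ler_pdivrMr ?half_pow_gt0//.
  apply: (@le_trans _ _ (n k)%:R); last by rewrite ler_nat (leq_trans (nM k)).
  by rewrite (le_trans _ (ltW (hn k)))// lerDr.
Qed.

Lemma integral_indicE D (h : R -> R) : measurable D -> D `<=` unitI -> bm h ->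
  (\int[mu]_(t in D) (h t)%:E)%E = (Int (fun t => \1_D t * h t))%:E.
Proof.
move=> mD DI bh; rewrite -integral_IntE; last by apply: bmM => //; exact: bm_indic.
rewrite -{1}(setIidr DI) integral_mkcondr; apply: eq_integral => t _.
by rewrite patchE indicE; case: (t \in D); rewrite ?mul1r ?mul0r.
Qed.

Lemma amod_powR (P : nat -> {poly R}) k t e : amod P k t `^ e = nsq (P k) t `^ (e / 2).
Proof. by rewrite /amod -powR12_sqrt ?nsq_ge0// -powRrM mulrC. Qed.

Lemma measurable_amod (P : nat -> {poly R}) k : measurable_fun [set: R] (amod P k).
Proof.
have [m _] := bm_nsq_powR (P k) (ltW (half_pow_gt0 (R := R) 1)).
rewrite (_ : amod P k = fun x => nsq (P k) x `^ half_pow 1)//.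
by apply/funext => x; rewrite /amod -powR12_sqrt ?nsq_ge0// /half_pow expr1.
Qed.

Lemma measurable_cmod_powR (f g : R -> R) e :
  measurable_fun [set: R] f -> measurable_fun [set: R] g ->
  measurable_fun [set: R] (fun t => (cmod (f t) (g t)) `^ e).
Proof.
move=> mf mg; apply: (measurableT_comp (measurable_powR e)).
rewrite (_ : (fun t => _) = fun t => (f t * f t + g t * g t) `^ 2^-1).
  apply: (measurableT_comp (measurable_powR _)).
  by apply: measurable_funD; exact: measurable_funM.
by apply/funext => t; rewrite /cmod -!expr2 powR12_sqrt// addr_ge0 ?sqr_ge0.
Qed.

(** When all other terms are dominated, the k-th one is controlled by the whole sum; this makes
    block k visible in the boundary value on F k. *)
Lemma series_remove (v : nat -> R) C k :
  (forall j, `|if j == k then 0 else v j| <= C * half_pow j) ->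
  cvgn (series v) -> `|v k| <= `|limn (series v)| + 2 * C.
Proof.
move=> vC cv; set v' := fun j => if j == k then 0 else v j in vC.
have cv' := half_pow_cvg vC.
have dE n : (k < n)%N -> series v n - series v' n = v k.
  move=> kn; rewrite /series/= -sumrB (bigD1_seq k) ?iota_uniq ?mem_index_iota//=.
  rewrite /v' eqxx subr0 big1 ?addr0// => j jk.
  by rewrite (negbTE jk) subrr.
have lim1 : (fun n => series v n - series v' n) @ \oo --> v k.
  apply: cvg_near_cst; exists k.+1 => // n /= kn; exact: dE.
have lim2 : (fun n => series v n - series v' n) @ \oo --> limn (series v) - limn (series v').
  exact: cvgB.
rewrite (cvg_unique (@Rhausdorff R) lim1 lim2) (le_trans (ler_normB _ _))// lerD2l.
exact: half_pow_lim_le.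
Qed.

Lemma borel_version p q B : 0 < q < p -> (forall k : nat, p / 2 != k%:R) -> symset B ->
  exists a : nat -> R, [/\ forall n, 0 <= a n, distribution_coefs a, gaps_to_infty a &
    (forall r, 0 < r < 1 -> measurable_fun [set: R] (fr_re a r) /\
                            measurable_fun [set: R] (fr_im a r)) /\
    (exists K : R, forall r, 0 < r < 1 ->
      (\int[mu]_(t in unitI) ((cmod (fr_re a r t) (fr_im a r t)) `^ q)%:E <= K%:E)%E) /\
    exists gre gim : R -> R, [/\ measurable_fun [set: R] gre, measurable_fun [set: R] gim,
      {ae mu, forall t, unitI t ->
        (fun r => fr_re a r t) @ 1^'- --> gre t /\
        (fun r => fr_im a r t) @ 1^'- --> gim t},
      (\int[mu]_(t in unitI `\` B) ((cmod (gre t) (gim t)) `^ p)%:E < +oo)%E &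
      (\int[mu]_(t in unitI) ((cmod (gre t) (gim t)) `^ p)%:E = +oo)%E]].
Proof.
move=> qp pN sB; have /andP[q0 qltp] := qp; have p0 : 0 < p := lt_trans q0 qltp.
have [mB BI _ _] := sB; have mI : measurable unitI := @measurable_unitI R.
have [F [sF FB Fdis]] := disjoint_symsets sB.
have two_k k : 1 <= 2 ^+ k :> R by rewrite exprn_ege1// ler1n.
(* The bound required by [integral_Ysum_le] for e = p; it also serves e = q, since q < p. *)
pose eta k : R := (2 ^ k.+1)%:R^-1 / (2 ^+ k) `^ p.
have eta0 k : 0 < eta k.
  by rewrite divr_gt0 ?invr_gt0 ?ltr0n ?expn_gt0// powR_gt0// (lt_le_trans ltr01).
have /choice[P hP] : forall k, exists P : {poly R}, [/\ gapped k P,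
    k.+1%:R <= Int (fun x => \1_(F k) x * nsq P x `^ (p / 2)),
    Int (fun x => \1_(~` F k) x * nsq P x `^ (p / 2)) <= eta k &
    Int (fun x => nsq P x `^ (q / 2)) <= eta k].
  by move=> k; apply: concentrated_poly.
have P_ge0 k i : 0 <= (P k)`_i by have [[]] := hP k.
have [M [M_step P_le P_moment]] := choose_shifts P_ge0.
pose a := acoef P M; pose A := amod P.
have A0 k t : 0 <= A k t by exact: sqrtr_ge0.
have mA k : measurable_fun [set: R] (A k) by exact: measurable_amod.
have bH k (e : R) : 0 <= e -> bm (fun t => nsq (P k) t `^ e) by exact: bm_nsq_powR.
have AE k t e : A k t `^ e = nsq (P k) t `^ (e / 2) by exact: amod_powR.
have p20 : 0 <= p / 2 by rewrite divr_ge0 ?ltW.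
have q20 : 0 <= q / 2 by rewrite divr_ge0 ?ltW.
have mF k : measurable (F k) by have [] := sF k.
have Ap_off D k : measurable D -> D `<=` unitI -> D `<=` ~` F k ->
    (\int[mu]_(t in D) ((A k t) `^ p)%:E <= (eta k)%:E)%E.
  move=> mD DI DF; under eq_integral do rewrite AE.
  rewrite integral_indicE//; last exact: bH.
  have [_ _ h _] := hP k; rewrite lee_fin (le_trans _ h)//.
  have bD : bm (\1_D : R -> R) := bm_indic mD.
  have bFc : bm (\1_(~` F k) : R -> R) := bm_indic (measurableC (mF k)).
  apply: le_Int; [by apply: bmM => //; exact: bH|by apply: bmM => //; exact: bH|].
  by move=> t _; rewrite ler_wpM2r ?powR_ge0// le_indic.
have Yq_int : (\int[mu]_(t in unitI) Ysum q A t <= 1)%E.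
  apply: integral_Ysum_le => // k; under eq_integral do rewrite AE.
  rewrite integral_IntE; last exact: bH.
  have [_ _ _ h] := hP k; rewrite lee_fin (le_trans h)// /eta ler_wpM2l ?invr_ge0//.
  have pos (e : R) : 0 < (2 ^+ k : R) `^ e by rewrite powR_gt0// (lt_le_trans ltr01).
  by rewrite lef_pV2 ?posrE// ler_powR// ltW.
(* Of full measure in [0, 1] because [Ysum q A] is integrable; there the blocks are O(2^-k). *)
pose Om : set R := [set t | (Ysum q A t < +oo)%E].
have mYq D : measurable_fun D (Ysum q A) by exact: measurable_Ysum.
have mOm : measurable Om.
  have := measurable_fun_lte (mYq setT) (measurable_cst (+oo%E : \bar R)).
  by move=> /(_ measurableT [set true] I); rewrite setTI.
have ae_Om : {ae mu, forall t, unitI t -> Om t}.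
  have intY : mu.-integrable unitI (Ysum q A).
    apply/integrableP; split; first exact: mYq.
    under eq_integral do rewrite gee0_abs ?Ysum_ge0//.
    by rewrite (le_lt_trans Yq_int)// ltry.
  have := @integrable_ae _ _ _ mu unitI mI (Ysum q A) intY; apply: filterS => t h It.
  by rewrite /Om/= -ge0_fin_numE ?Ysum_ge0//; exact: h.
have cs1 t n : `|cs n t| <= 1 := cs_norm n t.
have sn1 t n : `|sn n t| <= 1 := sn_norm n t.
have blkA k t : `|blk P M cs k 1 t| <= A k t /\ `|blk P M sn k 1 t| <= A k t.
  by rewrite /A -(blk1_modE P M); split; [exact: cmod_ge_re|exact: cmod_ge_im].
have Om_bound t : Om t -> exists2 C, 0 <= C & forall k, A k t <= C * half_pow k.
  move=> Ot; exists ((fine (Ysum q A t)) `^ q^-1); first exact: powR_ge0.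
  by move=> k; apply: Ysum_bound.
(* The boundary values are set to 0 on the null set where the blocks may diverge. *)
pose v (f : nat -> R -> R) t k : R := \1_Om t * blk P M f k 1 t.
pose g (f : nat -> R -> R) t : R := limn (series (v f t)).
have indE t : Om t -> \1_Om t = 1 :> R by move=> Ot; rewrite indicE mem_set.
have indN t : ~ Om t -> \1_Om t = 0 :> R by move=> Ot; rewrite indicE memNset.
have vA (f : nat -> R -> R) t k : (forall k, `|blk P M f k 1 t| <= A k t) ->
    `|v f t k| <= A k t.
  move=> fA; rewrite /v; have [Ot|Ot] := pselect (Om t); first by rewrite indE// mul1r.
  by rewrite indN// mul0r normr0.
have vcvg (f : nat -> R -> R) t : (forall k, `|blk P M f k 1 t| <= A k t) ->
    series (v f t) @ \oo --> g f t.
  move=> fA; have [Ot|Ot] := pselect (Om t).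
    have [C _ hC] := Om_bound t Ot; apply: (@half_pow_cvg _ _ C) => k.
    exact: le_trans (vA f t k fA) (hC k).
  apply: (@half_pow_cvg _ _ 0) => k.
  by rewrite /v indN// mul0r normr0 mul0r.
have mblk (f : nat -> R -> R) k (r : R) : (forall n, measurable_fun [set: R] (f n)) ->
    measurable_fun [set: R] (blk P M f k r).
  move=> mf; apply: measurable_sum => i.
  by apply: measurable_funM => //; exact: measurable_funM.
have mcs n : measurable_fun [set: R] (@cs R n) by have [] := @bm_cs R n.
have msn n : measurable_fun [set: R] (@sn R n) by have [] := @bm_sn R n.
have mg (f : nat -> R -> R) : (forall n, measurable_fun [set: R] (f n)) ->
    (forall t k, `|blk P M f k 1 t| <= A k t) -> measurable_fun [set: R] (g f).
  move=> mf fA; apply: (@measurable_fun_cvg _ _ _ setT (fun n t => series (v f t) n)).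
    move=> n; apply: measurable_sum => k.
    by apply: measurable_funM; [exact: measurable_indic|exact: mblk].
  by move=> t _; exact: vcvg.
have csA t k : `|blk P M cs k 1 t| <= A k t by case: (blkA k t).
have snA t k : `|blk P M sn k 1 t| <= A k t by case: (blkA k t).
have mfr (f : nat -> R -> R) (r : R) : 0 < r < 1 -> (forall t n, `|f n t| <= 1) ->
    (forall n, measurable_fun [set: R] (f n)) ->
    measurable_fun [set: R] (fun t => limn (series (fun n => a n * r ^+ n * f n t))).
  move=> r01 f1 mf.
  apply: (@measurable_fun_cvg _ _ _ setT (fun n t => series (fun k => blk P M f k r t) n)).
    by move=> n; apply: measurable_sum => k; exact: mblk.
  by move=> t _; apply: blk_series_cvg.
have mcmod (f1 f2 : R -> R) e : measurable_fun [set: R] f1 -> measurable_fun [set: R] f2 ->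
    forall D, measurable_fun D (fun t => ((cmod (f1 t) (f2 t)) `^ e)%:E).
  move=> m1 m2 D; apply: measurable_funTS; apply/measurable_EFinP.
  exact: measurable_cmod_powR.
exists a; split.
- by move=> n; exact: acoef_ge0.
- exact: acoef_distribution.
- apply: gaps_acoef => // [k i j|k]; first by have [[_ _ h] _ _ _] := hP k; exact: h.
  by have [[_ h _] _ _ _] := hP k; rewrite gt_eqF.
split; first by move=> r r01; split; apply: mfr.
split.
  (* Real and imaginary parts are at most 2 (y + 1) with y^q = Ysum, and (4 (y + 1))^q <= 8^q (Ysum
     + 1), whose integral is at most 8^q times 2. *)
  exists (8 `^ q * 2) => r r01.
  have pt t : (((cmod (fr_re a r t) (fr_im a r t)) `^ q)%:E <=
      (8 `^ q)%:E * (Ysum q A t + 1))%E.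
    have [Ot|] := ltP (Ysum q A t) +oo%E; last first.
      rewrite leye_eq => /eqP->; rewrite addye// gt0_muley ?leey// lte_fin powR_gt0//.
    have fY : Ysum q A t \is a fin_num by rewrite ge0_fin_numE ?Ysum_ge0.
    pose y := (fine (Ysum q A t)) `^ q^-1.
    have y0 : 0 <= y by exact: powR_ge0.
    have hy k : A k t <= y * half_pow k by apply: Ysum_bound.
    have bd (f : nat -> R -> R) : (forall n, `|f n t| <= 1) ->
        (forall k, `|blk P M f k 1 t| <= A k t) ->
        `|limn (series (fun n => a n * r ^+ n * f n t))| <= 2 * (y + 1).
      move=> f1 fA.
      rewrite -(cvg_lim (@Rhausdorff R) (blk_series_cvg P_ge0 M_step P_le r01 f1)).
      apply: half_pow_lim_le => k.
      rewrite (le_trans (blk_bound P_ge0 P_moment k r01 f1))// mulrDl mul1r lerD//.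
      exact: le_trans (fA k) (hy k).
    have cm : cmod (fr_re a r t) (fr_im a r t) <= 4 * (y + 1).
      apply: (le_trans (cmod_le _ _)).
      have -> : 4 * (y + 1) = 2 * (y + 1) + 2 * (y + 1) by ring.
      by apply: lerD; [apply: (bd cs)|apply: (bd sn)].
    rewrite -(fineK fY) -EFinD -EFinM lee_fin.
    apply: (@le_trans _ _ ((4 * (y + 1)) `^ q)).
      apply: ge0_ler_powR => //; rewrite ?nnegrE ?sqrtr_ge0 ?(ltW q0)//.
      by rewrite mulr_ge0// addr_ge0.
    rewrite powRM ?addr_ge0//.
    apply: (@le_trans _ _ (4 `^ q * (2 `^ q * (y `^ q + 1 `^ q)))).
      by rewrite ler_wpM2l ?powR_ge0// powRD_le// ltW.
    rewrite powR1 mulrA -powRM// /y -powRrM mulVf ?gt_eqF// powRr1; last first.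
      by rewrite fine_ge0// Ysum_ge0.
    by rewrite (_ : 4 * 2 = 8 :> R)//; ring.
  apply: (@le_trans _ _ (\int[mu]_(t in unitI) ((8 `^ q)%:E * (Ysum q A t + 1)))%E).
    apply: ge0_le_integral => //.
    - by move=> t _; rewrite lee_fin powR_ge0.
    - by apply: mcmod; apply: mfr.
    - apply: measurable_funeM; apply: emeasurable_funD; [exact: mYq|exact: measurable_cst].
  rewrite ge0_integralZl_EFin; [|exact: mI|by move=> t _; rewrite adde_ge0 ?Ysum_ge0
    |by apply: emeasurable_funD; [exact: mYq|exact: measurable_cst]|exact: powR_ge0].
  rewrite ge0_integralD; [|exact: mI|by move=> t _; exact: Ysum_ge0|exact: mYq
    |by []|exact: measurable_cst].
  rewrite integral_cst// -[X in (1 * X)%E]/(mu unitI) mu_unitI mule1 EFinM.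
  rewrite lee_wpmul2l ?lee_fin ?powR_ge0//.
  by rewrite (_ : 2%:E = 1 + 1)%E ?leeD// -EFinD.
exists (g cs), (g sn); split.
- exact: mg.
- exact: mg.
- case: ae_Om => N [mN N0 hN]; exists N; split => //; apply: subset_trans hN.
  apply: subsetC => t Om_t /Om_t Ot.
  have [C C0 hC] := Om_bound t Ot.
  have conv (f : nat -> R -> R) : (forall n, `|f n t| <= 1) ->
      (forall k, `|blk P M f k 1 t| <= A k t) ->
      (fun r => limn (series (fun n => a n * r ^+ n * f n t))) @ 1^'- --> g f t.
    move=> f1 fA; apply: (@tannery _ (fun k r => blk P M f k r t) (v f t) _ (C + 1)).
    - move=> r r01 k; rewrite (le_trans (blk_bound P_ge0 P_moment k r01 f1))// mulrDl mul1r.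
      by rewrite lerD//; exact: le_trans (fA k) (hC k).
    - move=> k; apply: (le_trans (vA f t k fA)); apply: (le_trans (hC k)).
      by rewrite ler_wpM2r ?lerDl// ltW// half_pow_gt0.
    - by move=> r r01; apply: blk_series_cvg.
    - move=> k; rewrite /v indE// mul1r; exact: blk_cvg.
  by split; apply: conv.
(* Off B no F k is met, so every block has small p-mass there. *)
- have Yp_int : (\int[mu]_(t in unitI `\` B) Ysum p A t <= 1)%E.
    apply: integral_Ysum_le => //; first exact: measurableD.
    move=> k; apply: Ap_off; [exact: measurableD|by move=> t []|].
    by move=> t [_ nB] Ft; apply: nB; exact: FB Ft.
  have mYp D : measurable_fun D (Ysum p A) by exact: measurable_Ysum.
  apply: (@le_lt_trans _ _ (\int[mu]_(t in unitI `\` B) ((4 `^ p)%:E * Ysum p A t))%E).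
    apply: ge0_le_integral; first exact: measurableD.
    - by move=> t _; rewrite lee_fin powR_ge0.
    - by apply: mcmod; exact: mg.
    - by apply: measurable_funeM; exact: mYp.
    move=> t _; have [Ot|] := ltP (Ysum p A t) +oo%E; last first.
      by rewrite leye_eq => /eqP->; rewrite gt0_muley ?leey// lte_fin powR_gt0.
    have fY : Ysum p A t \is a fin_num by rewrite ge0_fin_numE ?Ysum_ge0.
    pose y := (fine (Ysum p A t)) `^ p^-1.
    have y0 : 0 <= y by exact: powR_ge0.
    have hy k : A k t <= y * half_pow k by apply: Ysum_bound.
    have bd (f : nat -> R -> R) : (forall k, `|blk P M f k 1 t| <= A k t) ->
        `|g f t| <= 2 * y.
      by move=> fA; apply: half_pow_lim_le => k; exact: le_trans (vA f t k fA) (hy k).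
    have cm : cmod (g cs t) (g sn t) <= 4 * y.
      apply: (le_trans (cmod_le _ _)); have -> : 4 * y = 2 * y + 2 * y by ring.
      by apply: lerD; apply: bd.
    rewrite -(fineK fY) -EFinM lee_fin.
    apply: (@le_trans _ _ ((4 * y) `^ p)).
      apply: ge0_ler_powR => //; rewrite ?nnegrE ?sqrtr_ge0 ?(ltW p0)//.
      by rewrite mulr_ge0.
    rewrite powRM// /y -powRrM mulVf ?gt_eqF// powRr1//.
    by rewrite fine_ge0// Ysum_ge0.
  rewrite ge0_integralZl_EFin; [|exact: measurableD|by move=> t _; exact: Ysum_ge0
    |exact: mYp|exact: powR_ge0].
  apply: (@le_lt_trans _ _ ((4 `^ p)%:E * 1)%E); last by rewrite mule1 ltry.
  by rewrite lee_wpmul2l ?lee_fin ?powR_ge0.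
- apply/eqP; rewrite eq_le leey/= leNgt; apply/negP => fin.
  set J := (\int[mu]_(t in unitI) _)%E in fin.
  have J0 : (0 <= J)%E by apply: integral_ge0 => t _; rewrite lee_fin powR_ge0.
  have fJ : J \is a fin_num by rewrite ge0_fin_numE.
  have p8 : 0 <= (8 : R) `^ p by exact: powR_ge0.
  (* Block k alone has p-mass at least k + 1 on F k and the others cost a bounded amount, so a
     finite J would bound all integers. *)
  suff key k : (k.+1%:R%:E <= (8 `^ p)%:E * (J + 1))%E.
    have := key (Num.bound (8 `^ p * (fine J + 1))).
    rewrite -(fineK fJ) -EFinD -EFinM lee_fin leNgt => /negP; apply.
    rewrite (lt_trans (archi_boundP _)) ?ltr_nat//.
    by rewrite mulr_ge0// addr_ge0// fine_ge0.
  have FI : F k `<=` unitI by have [] := sF k.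
  (* Block k is masked; the others are small on F k, which misses F j for j != k. *)
  pose A' j t := if j == k then 0 else A j t.
  have A'0 j t : 0 <= A' j t by rewrite /A'; case: ifP.
  have mA' j : measurable_fun [set: R] (A' j).
    by rewrite /A'; case: (j == k); [exact: measurable_cst|exact: mA].
  have mY' D : measurable_fun D (Ysum p A') by exact: measurable_Ysum.
  have Y'_int : (\int[mu]_(t in F k) Ysum p A' t <= 1)%E.
    apply: integral_Ysum_le => // j; rewrite /A'; have [jk|jk] := eqVneq j k.
      under eq_integral do rewrite powR0 ?gt_eqF//.
      by rewrite integral0 lee_fin ltW// eta0.
    by apply: Ap_off => //; apply: Fdis; rewrite eq_sym.
  have h1 : (k.+1%:R%:E <= \int[mu]_(t in F k) ((A k t) `^ p)%:E)%E.
    under eq_integral do rewrite AE.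
    rewrite integral_indicE//; last exact: bH.
    by rewrite lee_fin; have [] := hP k.
  apply: (le_trans h1).
  have mg' D : measurable_fun D (fun t => ((cmod (g cs t) (g sn t)) `^ p)%:E).
    by apply: mcmod; exact: mg.
  have cg0 t : (0 <= ((cmod (g cs t) (g sn t)) `^ p)%:E)%E by rewrite lee_fin powR_ge0.
  apply: (@le_trans _ _ (\int[mu]_(t in F k)
      ((8 `^ p)%:E * (((cmod (g cs t) (g sn t)) `^ p)%:E + Ysum p A' t)))%E).
    apply: ae_ge0_le_integral; first exact: mF.
    - by move=> t _; rewrite lee_fin powR_ge0.
    - apply: measurable_funTS; apply/measurable_EFinP.
      exact: (measurableT_comp (measurable_powR p) (mA k)).
    - by move=> t _; rewrite mule_ge0 ?lee_fin// adde_ge0 ?Ysum_ge0.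
    - by apply: measurable_funeM; apply: emeasurable_funD; [exact: mg'|exact: mY'].
    case: ae_Om => N [mN N0 hN]; exists N; split => //; apply: subset_trans hN.
    apply: subsetC => t Om_t /FI/Om_t Ot.
    have [Y'f|] := ltP (Ysum p A' t) +oo%E; last first.
      rewrite leye_eq => /eqP->; rewrite addey; last by [].
      by rewrite gt0_muley; [exact: leey|rewrite lte_fin powR_gt0].
    have fY : Ysum p A' t \is a fin_num by rewrite ge0_fin_numE ?Ysum_ge0.
    pose y := (fine (Ysum p A' t)) `^ p^-1.
    have y0 : 0 <= y by exact: powR_ge0.
    have hy j : A' j t <= y * half_pow j by apply: Ysum_bound.
    have bd (f : nat -> R -> R) : (forall k, `|blk P M f k 1 t| <= A k t) ->
        `|blk P M f k 1 t| <= `|g f t| + 2 * y.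
      move=> fA; have -> : blk P M f k 1 t = v f t k by rewrite /v indE// mul1r.
      apply: series_remove; last by apply: (cvgP (g f t)); exact: vcvg.
      move=> j; apply: le_trans (hy j); rewrite /A'; case: ifP => _; first by rewrite normr0.
      exact: vA.
    have Ak : A k t <= 2 * cmod (g cs t) (g sn t) + 4 * y.
      rewrite /A -(blk1_modE P M); apply: (le_trans (cmod_le _ _)).
      apply: (le_trans (lerD (bd cs (csA t)) (bd sn (snA t)))).
      have := cmod_ge_re (g cs t) (g sn t); have := cmod_ge_im (g cs t) (g sn t).
      by clear; lra.
    have cm0 : 0 <= cmod (g cs t) (g sn t) by exact: sqrtr_ge0.
    rewrite -(fineK fY) -EFinD -EFinM lee_fin.
    apply: (@le_trans _ _ ((2 * cmod (g cs t) (g sn t) + 4 * y) `^ p)).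
      apply: ge0_ler_powR => //; rewrite ?nnegrE ?(ltW p0)//.
      by rewrite addr_ge0// mulr_ge0.
    apply: (le_trans (powRD_le (ltW p0) _ _)); [by rewrite mulr_ge0..|].
    rewrite mulrDr [leRHS]mulrDr; apply: lerD.
      rewrite -powRM// ?mulr_ge0// mulrA powRM ?mulr_ge0// ler_wpM2r ?powR_ge0//.
      by apply: ge0_ler_powR; rewrite ?nnegrE ?(ltW p0)//; lra.
    rewrite -powRM// ?mulr_ge0// mulrA powRM ?mulr_ge0//.
    rewrite /y -powRrM mulVf ?gt_eqF// powRr1; last by rewrite fine_ge0// Ysum_ge0.
    by rewrite (_ : 2 * 4 = 8 :> R)//; ring.
  rewrite ge0_integralZl_EFin; [|exact: mF|by move=> t _; rewrite adde_ge0 ?Ysum_ge0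
    |by apply: emeasurable_funD; [exact: mg'|exact: mY']|exact: p8].
  rewrite lee_wpmul2l ?lee_fin// ge0_integralD; [|exact: mF|by []|exact: mg'
    |by move=> t _; exact: Ysum_ge0|exact: mY'].
  apply: leeD; last exact: Y'_int.
  by apply: ge0_subset_integral; [exact: mF|exact: mI|exact: mg'|move=> t _; exact: cg0|exact: FI].
Qed.

End BorelVersion.

(** * From Borel sets to the Lebesgue sigma-algebra *)

Section Transfer.
Context {R : realType}.
Local Notation mu := (@lebesgue_measure R).

Lemma borel_sub_lebesgue (A : set R) : measurable A -> measurable (A : set (LebT R)).
Proof. by move=> mA; apply: sub_caratheodory. Qed.

Lemma measurable_fun_LebT (D : set (LebT R)) (f : R -> R) :
  measurable_fun [set: R] f -> measurable_fun D (f : LebT R -> R).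
Proof.
move=> mf; apply: measurable_funTS => _ Y mY; rewrite setTI.
by apply: borel_sub_lebesgue; rewrite -[X in measurable X]setTI; exact: mf.
Qed.

(** The two measures agree on Borel sets; the integral is transported along the identity between the
    two measurable spaces. *)
Lemma Leb_integralE (D : set R) (f : R -> R) : measurable D ->
  measurable_fun [set: R] f -> (forall t, 0 <= f t) ->
  (\int[@completed_lebesgue_measure R]_(t in (D : set (LebT R))) (f t)%:E =
   \int[mu]_(t in D) (f t)%:E)%E.
Proof.
move=> mD mf f0.
have mid : measurable_fun [set: LebT R] (id : LebT R -> measurableTypeR R).
  by move=> _ Y mY; rewrite setTI; exact: sub_caratheodory.
transitivity (\int[pushforward (@completed_lebesgue_measure R)
    (id : LebT R -> measurableTypeR R)]_(t in D) (f t)%:E)%E.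
  rewrite ge0_integral_pushforward//.
  - by apply: measurable_funTS; exact/measurable_EFinP.
  - by move=> t _; rewrite lee_fin.
by apply: eq_measure_integral.
Qed.

(** A set of the completed sigma-algebra is a Borel set together with a subset of a Borel null set,
    so the Borel part carries all the measure. *)
Lemma lebesgue_borel_core (E : set (LebT R)) : measurable E ->
  (0 < (@completed_lebesgue_measure R) (E `&` I01 R))%E ->
  exists X : set R, [/\ measurable X, X `<=` E, X `<=` unitI & (0 < mu X)%E].
Proof.
move=> mE E0.
have : (completed_algebra_gen mu).-sigma.-measurable (E : set R).
  by rewrite completed_caratheodory_measurable.
rewrite g_sigma_completed_algebra_genE => -[/= X mX [N [N' [mN' N'0 NN']] XN]].
exists (X `&` unitI); split.
- by apply: measurableI => //; exact: measurable_unitI.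
- by move=> x [Xx _]; rewrite -XN; left.
- by move=> x [].
rewrite lt_neqAle measure_ge0 andbT eq_sym; apply/negP => /eqP X0.
suff : ((@completed_lebesgue_measure R) (E `&` I01 R) <= 0)%E by rewrite leNgt E0.
have U0 : mu ((X `&` unitI) `|` N') = 0%E.
  apply: measure_negligible; first by apply: measurableU => //; apply: measurableI => //;
    exact: measurable_unitI.
  by apply: negligibleU; apply/negligibleP => //; apply: measurableI => //;
    exact: measurable_unitI.
rewrite -U0; apply: le_outer_measure => x [Ex Ix].
by move: Ex; rewrite -XN => -[Xx|/NN' N'x]; [left|right].
Qed.

End Transfer.

Theorem theorem4 (R : realType) (p : R) :
  0 < p -> ~ (exists k : nat, p = 2 * k%:R) ->
  forall E : set (LebT R),
    measurable E ->
    (forall x : R, E (- x) = E x) ->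
    (forall x : R, E (x + 1) = E x) ->
    (0 < Leb (E `&` I01 R))%E ->
  forall q : R, 0 < q < p ->
  exists a : nat -> R,
    (forall n, 0 <= a n) /\
    in_Hardy q a /\
    gaps_to_infty a /\
    exists gre gim : R -> R,
      boundary_value a gre gim /\
      (\int[Leb]_(t in I01 R `\` E) ((cmod (gre t) (gim t)) `^ p)%:E < +oo)%E /\
      (\int[Leb]_(t in I01 R) ((cmod (gre t) (gim t)) `^ p)%:E = +oo)%E.
Proof.
move=> p0 pN E mE EN E1 E0 q qp.
have pN2 (k : nat) : p / 2 != k%:R.
  by apply/eqP => pk; apply: pN; exists k; rewrite -pk mulrC divfK.
have [X [mX XE XI muX]] := lebesgue_borel_core mE E0.
have mI : measurable (unitI : set R) := @measurable_unitI R.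
(* A Borel core of a symmetric set need not be symmetric, so its reflection is added; evenness and
   periodicity keep it inside E. *)
pose B : set R := X `|` refl01 @^-1` X.
have mB : measurable B.
  apply: measurableU => //; rewrite -[X in measurable X]setTI.
  exact: measurable_refl01.
have BE : B `<=` E.
  move=> x [/XE//|/XE]; rewrite /refl01 addrC (_ : (E (- x + 1) : Prop) = E x)//.
  by rewrite E1 EN.
have sB : symset B.
  split => //.
  - by move=> x [/XI//|/XI]; rewrite -[X in _ -> X]/(unitI x) -{2}refl01_unitI.
  - move=> x [Xx|Xx]; [right|left; exact: Xx].
    by rewrite /= /refl01 opprB addrC subrK.
  - by apply: (lt_le_trans muX); apply: le_measure; rewrite ?inE// => x; left.
have [a [a0 ad ag [mfr [[K hK] [gre [gim [mre mim aeg fin inf]]]]]]] :=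
  borel_version qp pN2 sB.
exists a; split => //; split.
  split => //; exists K => r r01; have [m1 m2] := mfr r r01.
  rewrite (@Leb_integralE R unitI); [exact: hK|exact: mI|exact: measurable_cmod_powR|].
  by move=> t; exact: powR_ge0.
split => //; exists gre, gim; split.
  split; [exact: measurable_fun_LebT|split; first exact: measurable_fun_LebT].
  case: aeg => N [mN N0 hN]; exists N; split => //.
  exact: borel_sub_lebesgue.
split; last first.
  rewrite (@Leb_integralE R unitI); [exact: inf|exact: mI|exact: measurable_cmod_powR|].
  by move=> t; exact: powR_ge0.
(* B lies in E, so enlarging the domain to the Borel set off B only increases the integral. *)
apply: (@le_lt_trans _ _ (\int[Leb]_(t in (unitI `\` B : set (LebT R)))
    ((cmod (gre t) (gim t)) `^ p)%:E)%E).
  apply: ge0_subset_integral.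
  - by apply: measurableD => //; exact: borel_sub_lebesgue.
  - by apply: borel_sub_lebesgue; exact: measurableD.
  - apply/measurable_EFinP; apply: measurable_fun_LebT; exact: measurable_cmod_powR.
  - by move=> t _; rewrite lee_fin powR_ge0.
  - by move=> t [It nE]; split => // /BE.
rewrite Leb_integralE; [exact: fin|exact: measurableD|exact: measurable_cmod_powR|].
by move=> t; exact: powR_ge0.
Qed.
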